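(* Let $(Q,W)$ be a quiver with potential and $C$ an algebraic cut of $(Q,W)$. Let $T$ be a $2$-APR tilting (respectively, cotilting) $\mathcal{P}(Q,W)_C$-module associated with a source (respectively, sink) $x$ of the quiver $Q_C$. Then $\operatorname{End}_{\mathcal{P}(Q,W)_C}(T)$ is isomorphic to $\mathcal{P}(Q,W)_{\mu^+_x(C)}$ (respectively, $\mathcal{P}(Q,W)_{\mu^-_x(C)}$).
   Context: $K$ is an algebraically closed field and $D=\operatorname{Hom}_K(-,K)$. An arrow $a$ of a quiver $Q$ goes from $s(a)$ to $e(a)$; $ab$ means first $a$, then $b$. $\widehat{KQ}$ is the complete path algebra, $J$ its Jacobson radical with the $J$-adic topology, $\mathrm{com}\,Q=\overline{[\widehat{KQ},\widehat{KQ}]}$ (closure). A potential is $W\in J^2/(J^2\cap\mathrm{com}\,Q)$; $(Q,W)$ is a quiver with potential. $\partial_a$ is the continuous linear map sending a cycle $a_1\cdots a_n$ to $\sum_{i:\,a_i=a}a_{i+1}\cdots a_na_1\cdots a_{i-1}$, and $\mathcal{P}(Q,W)=\widehat{KQ}/\overline{\langle\partial_aW\mid a\in Q_1\rangle}$. For $C\subset Q_1$ let $g_C(a)=1$ if $a\in C$ and $0$ otherwise, extended additively to paths, and let $Q_C$ be the subquiver of $Q$ with vertices $Q_0$ and arrows $Q_1\setminus C$. $C$ is a cut of $(Q,W)$ if $W$ is homogeneous of degree $1$ for $g_C$; then the truncated Jacobian algebra is $\mathcal{P}(Q,W)_C=\mathcal{P}(Q,W)/\overline{\langle C\rangle}=\widehat{KQ_C}/\overline{\langle\partial_cW\mid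 c\in C\rangle}$. A cut $C$ is algebraic if $\mathcal{P}(Q,W)_C$ is finite dimensional of global dimension at most two and $\{\partial_cW\}_{c\in C}$ is a minimal set of generators of the ideal $\overline{\langle\partial_cW\mid c\in C\rangle}$ of $\widehat{KQ_C}$. For a source $x$ of $Q_C$, $\mu^+_x(C)$ is obtained from $C$ by removing all arrows of $Q$ ending at $x$ and adding all arrows of $Q$ starting at $x$. For a sink $x$ of $Q_C$, $\mu^-_x(C)$ is obtained from $C$ by removing all arrows of $Q$ starting at $x$ and adding all arrows of $Q$ ending at $x$. Modules are left modules and a composition $fg$ of morphisms means first $f$, then $g$ (so $\operatorname{End}_A(A)\simeq A$); thus the simple module at a source of $Q_C$ is projective and that at a sink is injective. Let $A=\mathcal{P}(Q,W)_C$. For a source $x$ with corresponding simple projective module $S$, non-injective and with $\operatorname{Ext}^1_A(DA,S)=0$, the associated $2$-APR tilting module is $T=\tau^-\Omega^-S\oplus(A/S)$, where $\Omega^-$ is the cosyzygy, $\tau^-$ the inverse Auslander-Reiten translation and $A\simeq S\oplus A/S$. Dually, for a sink $x$ with corresponding simple injective module $S$, non-projective and with $\operatorname{Ext}^1_A(S,A)=0$, the associated $2$-APR cotilting module is $T=\tau\Omega S\oplus(DA/S)$, where $DA\simeq S\oplus DA/S$. *)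

(* Defs.v *)
From HB Require Import structures.
From mathcomp Require Import all_boot all_order all_algebra.
From mathcomp Require Import boolp classical_sets functions.

Set Implicit Arguments.
Unset Strict Implicit.
Unset Printing Implicit Defensive.

Import GRing.Theory.
Local Open Scope ring_scope.
Local Open Scope classical_set_scope.

(* A K-algebra is a ring with a morphism from K to its centre.  MathComp's
   algType is not used because it excludes the zero algebra, which occurs as
   End(0) and as a quotient by an improper ideal. *)
Record kalg (K : comPzRingType) := KAlg {
  kring :> pzRingType;
  kscal : {rmorphism K -> kring};
  kscalC : forall k x, kscal k * x = x * kscal k
}.

Definition alg_iso (K : comPzRingType) (A B : kalg K) : Prop :=
  exists f : {rmorphism A -> B},
    (forall k, f (kscal A k) = kscal B k) /\ bijective f.

Section OppositeAlgebra.
Variables (K : comPzRingType) (A : kalg K).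

Definition op_scal (k : K) : A^c := kscal A k.

Fact op_scal_zmod_morphism : zmod_morphism op_scal.
Proof. exact: (raddfB (kscal A)). Qed.

Fact op_scal_monoid_morphism : monoid_morphism op_scal.
Proof.
split=> [|k l]; first exact: (rmorph1 (kscal A)).
by rewrite /op_scal mulrC (rmorphM (kscal A)).
Qed.

HB.instance Definition _ :=
  GRing.isZmodMorphism.Build K A^c op_scal op_scal_zmod_morphism.
HB.instance Definition _ :=
  GRing.isMonoidMorphism.Build K A^c op_scal op_scal_monoid_morphism.

Fact op_scalC k (x : A^c) : op_scal k * x = x * op_scal k.
Proof. exact: (esym (kscalC k (x : A))). Qed.

Definition op_alg : kalg K := KAlg op_scalC.

End OppositeAlgebra.

Section Ideals.
Variable A : pzRingType.
Implicit Types (I J S : set A).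

Definition is_left_ideal I : Prop :=
  [/\ I 0, forall x y, I x -> I y -> I (x - y)
         & forall a x, I x -> I (a * x)].

Definition is_ideal I : Prop :=
  is_left_ideal I /\ forall a x, I x -> I (x * a).

Record ideal := Ideal { ideal_set :> set A; idealP : is_ideal ideal_set }.

Definition ideal_gen S : set A :=
  [set x | forall I, is_ideal I -> S `<=` I -> I x].

Definition ideal_mul I J : set A :=
  ideal_gen [set z | exists x y, [/\ I x, J y & z = x * y]].

Fixpoint ideal_exp J n : set A :=
  if n is n'.+1 then ideal_mul (ideal_exp J n') J else setT.

Definition is_maximal_left_ideal I : Prop :=
  [/\ is_left_ideal I, ~ I 1
    & forall I', is_left_ideal I' -> I `<=` I' -> ~ I' 1 -> I' `<=` I].

Definition jacobson : set A :=
  [set x | forall I, is_maximal_left_ideal I -> I x].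

(* closure in the topology with the powers of J as neighbourhoods of 0 *)
Definition adic_closure J S : set A :=
  [set x | forall n, exists2 y, S y & ideal_exp J n (x - y)].

Lemma ideal_gen_is_ideal S : is_ideal (ideal_gen S).
Proof.
split; first split.
- by move=> I [[I0 _ _] _].
- move=> x y Sx Sy I II SI; case: (II) => -[_ IB _] _.
  by apply: IB; [exact: Sx | exact: Sy].
- move=> a x Sx I II SI; case: (II) => -[_ _ IM] _.
  by apply: IM; exact: Sx.
- move=> a x Sx I II SI; case: (II) => _ IM.
  by apply: IM; exact: Sx.
Qed.

Lemma ideal_exp_is_ideal J n : is_ideal (ideal_exp J n).
Proof. by case: n => [|n] /=; [split | exact: ideal_gen_is_ideal]. Qed.

Lemma adic_closure_is_ideal J I : is_ideal I -> is_ideal (adic_closure J I).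
Proof.
move=> [[I0 IB IMl] IMr]; split; first split.
- by move=> n; exists 0; rewrite ?subrr //; case: (ideal_exp_is_ideal J n) => -[].
- move=> x y cx cy n; have [[x' Ix' Jx] [y' Iy' Jy]] := (cx n, cy n).
  exists (x' - y'); first exact: IB.
  have -> : x - y - (x' - y') = (x - x') - (y - y').
    by rewrite !opprD !opprK addrACA.
  by case: (ideal_exp_is_ideal J n) => -[_ JB _] _; apply: JB.
- move=> a x cx n; have [x' Ix' Jx] := cx n.
  exists (a * x'); first exact: IMl.
  by rewrite -mulrBr; case: (ideal_exp_is_ideal J n) => -[_ _ JM] _; apply: JM.
- move=> a x cx n; have [x' Ix' Jx] := cx n.
  exists (x' * a); first exact: IMr.
  by rewrite -mulrBl; case: (ideal_exp_is_ideal J n) => _ JM; apply: JM.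
Qed.

Definition closed_ideal J S : ideal :=
  Ideal (adic_closure_is_ideal J (ideal_gen_is_ideal S)).

End Ideals.

Definition commutator_space (K : comPzRingType) (A : kalg K) : set A :=
  [set z | forall V : set A,
     [/\ V 0, forall x y, V x -> V y -> V (x + y)
           & forall k x, V x -> V (kscal A k * x)] ->
     (forall x y, V (x * y - y * x)) -> V z].

Section QuotientRing.
Variables (A : pzRingType) (I : ideal A).

Definition quot_rel (x y : A) : bool := `[< ideal_set I (x - y) >].

Fact quot_rel_equiv : equiv_class_of quot_rel.
Proof.
case: (idealP I) => -[I0 IB _] _.
have IN x : ideal_set I x -> ideal_set I (- x).
  by move=> Ix; rewrite -sub0r; exact: IB.
split=> [x|x y|y x z].
- by apply/asboolP; rewrite subrr.
- by apply/asboolP/asboolP=> /IN; rewrite opprB.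
- move=> /asboolP Ixy /asboolP Iyz; apply/asboolP.
  rewrite -[x - z](subrKA y) -[y - z]opprB; apply: IB => //.
  by rewrite -opprB; exact: IN.
Qed.

Canonical quot_equiv := EquivRelPack quot_rel_equiv.

Definition quot : Type := {eq_quot quot_equiv}%qT.
HB.instance Definition _ := Choice.on quot.
HB.instance Definition _ := EqQuotient.on quot.

Definition qpi (x : A) : quot := (\pi_quot x)%qT.

Lemma qpi_eq x y : qpi x = qpi y <-> ideal_set I (x - y).
Proof.
split; first by move/eqP; rewrite /qpi eqmodE => /asboolP.
by move=> ?; apply/eqP; rewrite /qpi eqmodE; apply/asboolP.
Qed.

Let qrepr (x : quot) : A := (repr x)%qT.

Lemma qreprK x : qpi (qrepr x) = x.
Proof. exact: reprK. Qed.

Lemma qrepr_pi x : ideal_set I (x - qrepr (qpi x)).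
Proof. by apply/qpi_eq; rewrite qreprK. Qed.

Lemma quotP (P : quot -> Prop) : (forall x, P (qpi x)) -> forall x, P x.
Proof. by move=> PP x; rewrite -[x]qreprK. Qed.

Definition quot_add x y := qpi (qrepr x + qrepr y).
Definition quot_opp x := qpi (- qrepr x).
Definition quot_mul x y := qpi (qrepr x * qrepr y).

Lemma ideal0 : ideal_set I 0. Proof. by case: (idealP I) => -[]. Qed.
Lemma idealB x y : ideal_set I x -> ideal_set I y -> ideal_set I (x - y).
Proof. by case: (idealP I) => -[_ IB _] _; apply: IB. Qed.
Lemma idealN x : ideal_set I x -> ideal_set I (- x).
Proof. by rewrite -sub0r; apply: idealB; exact: ideal0. Qed.
Lemma idealD x y : ideal_set I x -> ideal_set I y -> ideal_set I (x + y).
Proof. by move=> Ix Iy; rewrite -[y]opprK; apply: idealB => //; exact: idealN. Qed.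
Lemma idealMl a x : ideal_set I x -> ideal_set I (a * x).
Proof. by case: (idealP I) => -[_ _ IM] _; apply: IM. Qed.
Lemma idealMr a x : ideal_set I x -> ideal_set I (x * a).
Proof. by case: (idealP I) => _ IM; apply: IM. Qed.

Lemma quot_addE x y : quot_add (qpi x) (qpi y) = qpi (x + y).
Proof.
apply/esym/qpi_eq; rewrite opprD addrACA.
by apply: idealD; exact: qrepr_pi.
Qed.

Lemma quot_oppE x : quot_opp (qpi x) = qpi (- x).
Proof. by apply/esym/qpi_eq; rewrite -opprD; apply: idealN; exact: qrepr_pi. Qed.

Lemma quot_mulE x y : quot_mul (qpi x) (qpi y) = qpi (x * y).
Proof.
apply/esym/qpi_eq; set x' := qrepr _; set y' := qrepr _.
have -> : x * y - x' * y' = (x - x') * y + x' * (y - y').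
  by rewrite mulrBl mulrBr addrA subrK.
by apply: idealD; [apply: idealMr | apply: idealMl]; exact: qrepr_pi.
Qed.

Fact quot_addA : associative quot_add.
Proof.
elim/quotP=> x; elim/quotP=> y; elim/quotP=> z.
by rewrite !quot_addE addrA.
Qed.
Fact quot_addC : commutative quot_add.
Proof. by elim/quotP=> x; elim/quotP=> y; rewrite !quot_addE addrC. Qed.
Fact quot_add0 : left_id (qpi 0) quot_add.
Proof. by elim/quotP=> x; rewrite quot_addE add0r. Qed.
Fact quot_addN : left_inverse (qpi 0) quot_opp quot_add.
Proof. by elim/quotP=> x; rewrite quot_oppE quot_addE addNr. Qed.

HB.instance Definition _ :=
  GRing.isZmodule.Build quot quot_addA quot_addC quot_add0 quot_addN.

Fact quot_mulA : associative quot_mul.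
Proof.
elim/quotP=> x; elim/quotP=> y; elim/quotP=> z.
by rewrite !quot_mulE mulrA.
Qed.
Fact quot_mul1 : left_id (qpi 1) quot_mul.
Proof. by elim/quotP=> x; rewrite quot_mulE mul1r. Qed.
Fact quot_mulr1 : right_id (qpi 1) quot_mul.
Proof. by elim/quotP=> x; rewrite quot_mulE mulr1. Qed.
Fact quot_mulDl : left_distributive quot_mul +%R.
Proof.
elim/quotP=> x; elim/quotP=> y; elim/quotP=> z.
by rewrite /GRing.add /= !(quot_addE, quot_mulE) mulrDl.
Qed.
Fact quot_mulDr : right_distributive quot_mul +%R.
Proof.
elim/quotP=> x; elim/quotP=> y; elim/quotP=> z.
by rewrite /GRing.add /= !(quot_addE, quot_mulE) mulrDr.
Qed.

HB.instance Definition _ := GRing.Zmodule_isPzRing.Build quot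
  quot_mulA quot_mul1 quot_mulr1 quot_mulDl quot_mulDr.

Fact qpi_zmod_morphism : zmod_morphism qpi.
Proof.
by move=> x y; rewrite [in RHS]/GRing.add [in RHS]/GRing.opp /= quot_oppE quot_addE.
Qed.
Fact qpi_monoid_morphism : monoid_morphism qpi.
Proof. by split=> [//|x y]; rewrite [in RHS]/GRing.mul /= quot_mulE. Qed.

HB.instance Definition _ :=
  GRing.isZmodMorphism.Build A quot qpi qpi_zmod_morphism.
HB.instance Definition _ :=
  GRing.isMonoidMorphism.Build A quot qpi qpi_monoid_morphism.

End QuotientRing.

Section QuotientAlgebra.
Variables (K : comPzRingType) (A : kalg K) (I : ideal A).

Definition quot_scal : K -> quot I := @qpi A I \o kscal A.
HB.instance Definition _ := GRing.RMorphism.on quot_scal.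

Fact quot_scalC k (x : quot I) : quot_scal k * x = x * quot_scal k.
Proof. by elim/quotP: x => x; rewrite /quot_scal /= -!(rmorphM (@qpi A I)) kscalC. Qed.

Definition quot_alg : kalg K := KAlg quot_scalC.

End QuotientAlgebra.

Record quiver := Quiver {
  vertex : finType;
  arrow : finType;
  src : arrow -> vertex;
  tgt : arrow -> vertex
}.

Section Paths.
Variable Q : quiver.
Implicit Types (x : vertex Q) (s t : seq (arrow Q)).

(* (x, [:: a_1; ...; a_n]) stands for the path a_1 ... a_n (first a_1) starting
   at x, and (x, [::]) for the trivial path at x. *)
Fixpoint is_walk x s : bool :=
  if s is a :: s' then (src a == x) && is_walk (tgt a) s' else true.

Definition walk_end x s : vertex Q := last x (map (@tgt Q) s).

Lemma is_walk_cat x s t :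
  is_walk x (s ++ t) = is_walk x s && is_walk (walk_end x s) t.
Proof.
by elim: s x => //= a s IHs x; rewrite IHs andbA.
Qed.

Definition qpath := {p : vertex Q * seq (arrow Q) | is_walk p.1 p.2}.

Definition trivial_path x : qpath := Sub (x, [::]) isT.

End Paths.

(* The elements of the complete path algebra are the arbitrary families of
   coefficients indexed by paths, that is, the formal sums of paths. *)
Definition cpath (K : fieldType) (Q : quiver) : Type := qpath Q -> K.

Section CompletePathAlgebra.
Variables (K : fieldType) (Q : quiver).
Implicit Types (f g h : cpath K Q) (x y : vertex Q) (s t : seq (arrow Q)).

HB.instance Definition _ := GRing.Zmodule.copy (cpath K Q) (qpath Q -> K).

(* the coefficient of f at (x, s), which is 0 if (x, s) is not a path *)
Definition pcoef f x s : K := oapp f 0 (insub (x, s)).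

Lemma pcoef_out f x s : ~~ is_walk x s -> pcoef f x s = 0.
Proof. by move=> xs; rewrite /pcoef insubN. Qed.

Lemma pcoefE f x s (xs : is_walk x s) : pcoef f x s = f (Sub (x, s) xs).
Proof. by rewrite /pcoef insubT. Qed.

Lemma pcoef_val f (p : qpath Q) : pcoef f (val p).1 (val p).2 = f p.
Proof. by rewrite /pcoef -surjective_pairing valK. Qed.

Lemma cpathP f g : (forall x s, pcoef f x s = pcoef g x s) -> f = g.
Proof. by move=> fg; apply/funext=> p; rewrite -!pcoef_val. Qed.

Lemma pcoefD f g x s : pcoef (f + g) x s = pcoef f x s + pcoef g x s.
Proof. by rewrite /pcoef; case: insub => [p|] //=; rewrite addr0. Qed.

Lemma pcoefB f g x s : pcoef (f - g) x s = pcoef f x s - pcoef g x s.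
Proof. by rewrite /pcoef; case: insub => [p|] //=; rewrite subr0. Qed.

Definition cpath_one : cpath K Q := fun p => ((val p).2 == [::])%:R.

(* the sum runs over the factorizations of the path p into two paths *)
Definition cpath_mul f g : cpath K Q := fun p =>
  let: (x, s) := val p in
  \sum_(i < (size s).+1)
    pcoef f x (take i s) * pcoef g (walk_end x (take i s)) (drop i s).

Lemma pcoef1 x s : pcoef cpath_one x s = (s == [::])%:R.
Proof.
have [xs|xs] := boolP (is_walk x s); first by rewrite pcoefE.
by rewrite pcoef_out //; case: s xs.
Qed.

Let conv (u : seq (arrow Q) -> K) g x s : K :=
  \sum_(i < (size s).+1) u (take i s) * pcoef g (walk_end x (take i s)) (drop i s).

Lemma pcoefM f g x s : pcoef (cpath_mul f g) x s = conv (pcoef f x) g x s.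
Proof.
have [xs|nw] := boolP (is_walk x s); first by rewrite pcoefE.
rewrite pcoef_out //; apply/esym/big1 => i _.
move: nw; rewrite -{1}(cat_take_drop i s) is_walk_cat negb_and.
by case/orP=> /pcoef_out ->; rewrite (mul0r, mulr0).
Qed.

Lemma conv_cons u g x a s :
  conv u g x (a :: s) =
  u [::] * pcoef g x (a :: s) + conv (fun t => u (a :: t)) g (tgt a) s.
Proof. by rewrite /conv /= big_ord_recl. Qed.

Lemma conv_nil u g x : conv u g x [::] = u [::] * pcoef g x [::].
Proof. by rewrite /conv big_ord1. Qed.

Lemma eq_conv u v g x s : u =1 v -> conv u g x s = conv v g x s.
Proof. by move=> uv; apply: eq_bigr => i _; rewrite uv. Qed.

Lemma conv_lin (c : K) u v g x s :
  conv (fun t => c * u t + v t) g x s = c * conv u g x s + conv v g x s.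
Proof.
rewrite mulr_sumr -big_split; apply: eq_bigr => i _ /=.
by rewrite mulrDl mulrA.
Qed.

Lemma convA u g h x s :
  conv (conv u g x) h x s = conv u (cpath_mul g h) x s.
Proof.
elim: s x u => [|a s IHs] x u.
  by rewrite !conv_nil pcoefM conv_nil mulrA.
rewrite !conv_cons pcoefM conv_cons.
rewrite (eq_conv _ _ _ (conv_cons u g x a)).
by rewrite conv_lin IHs conv_nil mulrDr addrA mulrA.
Qed.

Fact cpath_mulA : associative cpath_mul.
Proof.
move=> f g h; apply: cpathP => x s; rewrite [RHS]pcoefM [LHS]pcoefM -convA.
by apply: eq_conv => t; rewrite pcoefM.
Qed.

Fact cpath_mul1 : left_id cpath_one cpath_mul.
Proof.
move=> f; apply: cpathP => x s; rewrite pcoefM /conv big_ord_recl /=.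
rewrite take0 drop0 pcoef1 mul1r big1 ?addr0 // => i _.
by case: s i => [|a s] i; [case: i | rewrite pcoef1 mul0r].
Qed.

Fact cpath_mulr1 : right_id cpath_one cpath_mul.
Proof.
move=> f; apply: cpathP => x s; rewrite pcoefM /conv big_ord_recr /=.
rewrite take_size drop_size pcoef1 mulr1 big1 ?add0r // => i _.
by rewrite pcoef1 -size_eq0 size_drop subn_eq0 leqNgt ltn_ord mulr0.
Qed.

Fact cpath_mulDl : left_distributive cpath_mul +%R.
Proof.
move=> f g h; apply: cpathP => x s; rewrite pcoefD !pcoefM -big_split /=.
by apply: eq_bigr => i _; rewrite pcoefD mulrDl.
Qed.

Fact cpath_mulDr : right_distributive cpath_mul +%R.
Proof.
move=> f g h; apply: cpathP => x s; rewrite pcoefD !pcoefM -big_split /=.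
by apply: eq_bigr => i _; rewrite pcoefD mulrDr.
Qed.

HB.instance Definition _ := GRing.Zmodule_isPzRing.Build (cpath K Q)
  cpath_mulA cpath_mul1 cpath_mulr1 cpath_mulDl cpath_mulDr.

Definition cpath_scal (k : K) : cpath K Q := fun p => k * cpath_one p.

Lemma pcoefZ k f x s : pcoef (fun p => k * f p) x s = k * pcoef f x s.
Proof. by rewrite /pcoef; case: insub => //=; rewrite mulr0. Qed.

Lemma cpath_scalMl k f : cpath_scal k * f = (fun p => k * f p) :> cpath K Q.
Proof.
apply: cpathP => x s; rewrite -[in RHS](mul1r f) pcoefZ !pcoefM mulr_sumr.
by apply: eq_bigr => i _; rewrite pcoefZ mulrA.
Qed.

Lemma cpath_scalMr k f : f * cpath_scal k = (fun p => k * f p) :> cpath K Q.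
Proof.
apply: cpathP => x s; rewrite -[in RHS](mulr1 f) pcoefZ !pcoefM mulr_sumr.
by apply: eq_bigr => i _; rewrite pcoefZ mulrCA.
Qed.

Fact cpath_scal_zmod_morphism : zmod_morphism cpath_scal.
Proof. by move=> k l; apply/funext=> p; rewrite /cpath_scal mulrBl. Qed.

Fact cpath_scal_monoid_morphism : monoid_morphism cpath_scal.
Proof.
split=> [|k l]; first by apply/funext=> p; rewrite /cpath_scal mul1r.
by rewrite cpath_scalMl; apply/funext=> p; rewrite /cpath_scal mulrA.
Qed.

HB.instance Definition _ := GRing.isZmodMorphism.Build K (cpath K Q)
  cpath_scal cpath_scal_zmod_morphism.
HB.instance Definition _ := GRing.isMonoidMorphism.Build K (cpath K Q)
  cpath_scal cpath_scal_monoid_morphism.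

Fact cpath_scalC k f : cpath_scal k * f = f * cpath_scal k.
Proof. by rewrite cpath_scalMl cpath_scalMr. Qed.

Definition cpath_alg : kalg K := KAlg cpath_scalC.

End CompletePathAlgebra.

Section Potentials.
Variables (K : fieldType) (Q : quiver).
Implicit Types (W : cpath K Q) (C : {set arrow Q}) (a : arrow Q).

Definition arrow_elt a : cpath K Q := fun p => (val p == (src a, [:: a]))%:R.

Let J : set (cpath K Q) := @jacobson (cpath K Q).

Definition com_closure : set (cpath K Q) :=
  adic_closure J (@commutator_space K (cpath_alg K Q)).

(* A potential, which is a class in J^2 / (J^2 :&: com Q), is given by a
   representative in J^2.  The notions below depend on the class only. *)
Definition is_potential W : Prop := ideal_exp J 2 W.

Definition potential_eq W W' : Prop := com_closure (W - W').

(* The coefficient of the path p in d_a W is the sum of the coefficients in W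
   of the rotations of the cycle a p, one for each of its |p| + 1 positions;
   if a p is not a cycle, there is no such term. *)
Definition cyc_deriv a W : cpath K Q := fun p =>
  let: (x, s) := val p in
  if (x == tgt a) && (walk_end x s == src a) then
    \sum_(i < (size s).+1)
      (if rotr i (a :: s) is b :: t then pcoef W (src b) (b :: t) else 0)
  else 0.

Definition jacobian_ideal W : ideal (cpath K Q) :=
  closed_ideal J [set cyc_deriv a W | a in setT].

Definition jacobian_alg W : kalg K :=
  @quot_alg K (cpath_alg K Q) (jacobian_ideal W).

Definition jacobian_pi W : cpath K Q -> jacobian_alg W :=
  @qpi _ (jacobian_ideal W).

(* the topology on P(Q, W) is the quotient topology *)
Definition truncation_ideal W C : ideal (jacobian_alg W) :=
  closed_ideal (@jacobian_pi W @` J)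
    [set jacobian_pi W (arrow_elt c) | c in [set` C]].

Definition truncated_jacobian W C : kalg K := quot_alg (truncation_ideal W C).

Definition truncated_pi W C (f : cpath K Q) : truncated_jacobian W C :=
  @qpi _ (truncation_ideal W C) (jacobian_pi W f).

Definition gdeg C (p : qpath Q) : nat := \sum_(a <- (val p).2) (a \in C).

Definition homogeneous_potential C (d : nat) W : Prop :=
  exists W', [/\ is_potential W', potential_eq W W'
                & forall p, W' p != 0 -> gdeg C p = d].

Definition is_cut W C : Prop := homogeneous_potential C 1 W.

Definition cut_quiver C : quiver :=
  @Quiver (vertex Q) {a : arrow Q | a \notin C}
    (fun b => src (val b)) (fun b => tgt (val b)).

(* If f is supported on the paths of Q_C, as d_c W is when C is a cut
   containing c, then this is f seen in the complete path algebra of Q_C. *)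
Definition to_cut_quiver C (f : cpath K Q) : cpath K (cut_quiver C) :=
  fun p => pcoef f (val p).1 (map val (val p).2).
Arguments to_cut_quiver : clear implicits.

Definition cut_relation_ideal W C (B : {set arrow Q}) :
    ideal (cpath K (cut_quiver C)) :=
  closed_ideal (@jacobson (cpath K (cut_quiver C)))
    [set to_cut_quiver C (cyc_deriv c W) | c in [set` B]].

Definition minimal_cut_relations W C : Prop :=
  forall B : {set arrow Q}, B \proper C ->
    ideal_set (cut_relation_ideal W C B) <> cut_relation_ideal W C C.

Definition mu_plus (x : vertex Q) C : {set arrow Q} :=
  ((C :\: [set a | tgt a == x]) :|: [set a | src a == x])%SET.

Definition mu_minus (x : vertex Q) C : {set arrow Q} :=
  ((C :\: [set a | src a == x]) :|: [set a | tgt a == x])%SET.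

End Potentials.

Definition is_source (Q : quiver) (x : vertex Q) : Prop :=
  forall a : arrow Q, tgt a != x.

Definition is_sink (Q : quiver) (x : vertex Q) : Prop :=
  forall a : arrow Q, src a != x.

Section Modules.
Variable R : pzRingType.
Implicit Types M N P E I S X : lmodType R.

Definition mod_iso M N : Prop := exists f : {linear M -> N}, bijective f.

Definition surj M N (f : M -> N) : Prop := forall y, exists x, f x = y.

Definition exact_at M N P (f : M -> N) (g : N -> P) : Prop :=
  forall y, g y = 0 <-> exists x, f x = y.

Definition short_exact M N P (f : M -> N) (g : N -> P) : Prop :=
  [/\ injective f, exact_at f g & surj g].

Definition projective P : Prop :=
  forall M N (g : {linear M -> N}) (f : {linear P -> N}), surj g ->
    exists h : {linear P -> M}, forall x, g (h x) = f x.

Definition injective_mod I : Prop :=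
  forall M N (g : {linear M -> N}) (f : {linear M -> I}), injective g ->
    exists h : {linear N -> I}, forall x, h (g x) = f x.

Fixpoint pdim_le (n : nat) M : Prop :=
  if n is n'.+1 then
    exists N P (i : {linear N -> P}) (p : {linear P -> M}),
      [/\ projective P, short_exact i p & pdim_le n' N]
  else projective M.

Definition gldim_le (n : nat) : Prop := forall M, pdim_le n M.

(* in the sense of Yoneda: every extension of M by N splits *)
Definition ext1_vanishes M N : Prop :=
  forall E (i : {linear N -> E}) (p : {linear E -> M}), short_exact i p ->
    exists s : {linear M -> E}, forall x, p (s x) = x.

Definition is_submodule M (U : set M) : Prop :=
  U 0 /\ forall (r : R) x y, U x -> U y -> U (r *: x + y).

(* a projective cover: the kernel is superfluous *)
Definition projective_cover P M (p : {linear P -> M}) : Prop :=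
  [/\ projective P, surj p
    & forall U : set P, is_submodule U ->
        (forall x, exists u k, [/\ U u, p k = 0 & x = u + k]) ->
        forall x, U x].

(* an injective envelope: the image is essential *)
Definition injective_envelope M I (i : {linear M -> I}) : Prop :=
  [/\ injective_mod I, injective i
    & forall U : set I, is_submodule U ->
        (forall x, U (i x) -> x = 0) -> forall y, U y -> y = 0].

(* X is Omega M *)
Definition is_syzygy M X : Prop :=
  exists P (i : {linear X -> P}) (p : {linear P -> M}),
    projective_cover p /\ short_exact i p.

(* X is Omega^- M *)
Definition is_cosyzygy M X : Prop :=
  exists I (i : {linear M -> I}) (q : {linear I -> X}),
    injective_envelope i /\ short_exact i q.

(* d1 factors as P1 -> N -> P0 with N the kernel of d0 *)
Definition minimal_presentation M P1 P0 (d1 : {linear P1 -> P0})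
    (d0 : {linear P0 -> M}) : Prop :=
  projective_cover d0 /\
  exists N (i : {linear N -> P0}) (p : {linear P1 -> N}),
    [/\ short_exact i d0, projective_cover p & forall x, d1 x = i (p x)].

End Modules.

Section Hom.
Variables (R : pzRingType) (M N : lmodType R).

Definition linear_pred : {pred M -> N} := [pred f | `[< linear f >]].

Fact linear_pred_zmod_closed : zmod_closed linear_pred.
Proof.
split=> [|f g /asboolP lf /asboolP lg]; apply: asboolT => r x y.
  by rewrite scaler0 addr0.
by rewrite !fctE lf lg opprD addrACA scalerBr.
Qed.

HB.instance Definition _ :=
  GRing.isZmodClosed.Build (M -> N) linear_pred linear_pred_zmod_closed.

Definition lhom : Type := {f : M -> N | f \in linear_pred}.
HB.instance Definition _ := SubChoice.on lhom.
HB.instance Definition _ := [SubChoice_isSubZmodule of lhom by <:].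

Definition lhom_fun (f : lhom) : M -> N := val f.
Coercion lhom_fun : lhom >-> Funclass.

Lemma lhomP (f g : lhom) : (forall x, f x = g x) -> f = g.
Proof. by move=> fg; apply/val_inj/funext. Qed.

Lemma lhom_linear (f : lhom) : linear f.
Proof. exact: (asboolW (valP f)). Qed.

HB.instance Definition _ (f : lhom) :=
  GRing.isLinear.Build R M N *:%R (lhom_fun f) (lhom_linear f).

Definition Lhom (f : M -> N) (lf : linear f) : lhom :=
  exist _ f (asboolT lf).

End Hom.

(* End_A(T), where the product f g is first f, then g *)
Section Endomorphisms.
Variables (K : comPzRingType) (A : kalg K) (T : lmodType A).

Definition endo : Type := lhom T T.
HB.instance Definition _ := GRing.Zmodule.on endo.

Fact endo_one_linear : linear (@idfun T).
Proof. by []. Qed.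
Definition endo_one : lhom T T := Lhom endo_one_linear.

Fact endo_mul_linear (f g : lhom T T) : linear (fun x => g (f x)).
Proof. by move=> r x y; rewrite !linearP. Qed.
Definition endo_mul (f g : lhom T T) : lhom T T := Lhom (endo_mul_linear f g).

Fact endo_mulA : associative endo_mul.
Proof. by move=> f g h; apply: lhomP. Qed.
Fact endo_mul1 : left_id endo_one endo_mul.
Proof. by move=> f; apply: lhomP. Qed.
Fact endo_mulr1 : right_id endo_one endo_mul.
Proof. by move=> f; apply: lhomP. Qed.
Fact endo_mulDl : left_distributive endo_mul +%R.
Proof. by move=> f g h; apply: lhomP=> x; exact: (linearD h). Qed.
Fact endo_mulDr : right_distributive endo_mul +%R.
Proof. by move=> f g h; apply: lhomP. Qed.

HB.instance Definition _ := GRing.Zmodule_isPzRing.Build endo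
  endo_mulA endo_mul1 endo_mulr1 endo_mulDl endo_mulDr.

Fact endo_scal_linear (k : K) : linear (fun x : T => kscal A k *: x).
Proof. by move=> r x y; rewrite scalerDr !scalerA kscalC. Qed.
Definition endo_scal (k : K) : endo := Lhom (endo_scal_linear k).

Fact endo_scal_zmod_morphism : zmod_morphism endo_scal.
Proof. by move=> k l; apply: lhomP=> x; rewrite -[RHS]scalerBl -(raddfB (kscal A)). Qed.
Fact endo_scal_monoid_morphism : monoid_morphism endo_scal.
Proof.
split=> [|k l]; apply: lhomP=> x.
  by rewrite -[RHS]scale1r -(rmorph1 (kscal A)).
transitivity (kscal A (l * k) *: x); first by rewrite mulrC.
by rewrite (rmorphM (kscal A)) -scalerA.
Qed.

HB.instance Definition _ :=
  GRing.isZmodMorphism.Build K endo endo_scal endo_scal_zmod_morphism.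
HB.instance Definition _ :=
  GRing.isMonoidMorphism.Build K endo endo_scal endo_scal_monoid_morphism.

Fact endo_scalC k (f : endo) : endo_scal k * f = f * endo_scal k.
Proof.
pose g : {linear T -> T} := lhom_fun (f : lhom T T).
by apply: lhomP=> x; exact: (linearZ_LR g).
Qed.

Definition endo_alg : kalg K := KAlg endo_scalC.

End Endomorphisms.

Section RestrictionOfScalars.
Variables (K : comPzRingType) (A : kalg K) (M : lmodType A).

Definition restr_scal : Type := M.
HB.instance Definition _ := GRing.Zmodule.on restr_scal.

Definition restr_scale (k : K) (x : restr_scal) : restr_scal :=
  kscal A k *: (x : M).

Fact restr_scalerA k l x :
  restr_scale k (restr_scale l x) = restr_scale (k * l) x.
Proof. by rewrite /restr_scale scalerA -rmorphM. Qed.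
Fact restr_scale1 : left_id 1 restr_scale.
Proof. by move=> x; rewrite /restr_scale rmorph1 scale1r. Qed.
Fact restr_scalerDr : right_distributive restr_scale +%R.
Proof. by move=> k x y; exact: (@scalerDr A M). Qed.
Fact restr_scalerDl x : {morph restr_scale^~ x : k l / k + l}.
Proof. by move=> k l; rewrite /restr_scale raddfD scalerDl. Qed.

HB.instance Definition _ := GRing.Zmodule_isLmodule.Build K restr_scal
  restr_scalerA restr_scale1 restr_scalerDr restr_scalerDl.

End RestrictionOfScalars.

(* Right A-modules are left modules over op_alg A.  A morphism from B to A^c
   makes the duals of a left A-module into left B-modules; it is used below
   with B the opposite of A, and with A and its opposite exchanged.

   D M = Hom_K(M, K), where (b f)(x) = f (rho(b) x) *)
Definition kdual (K : comPzRingType) (A B : kalg K)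
    (rho : {rmorphism B -> A^c}) (M : lmodType A) : Type :=
  lhom (restr_scal M) K^o.

(* Hom_A(M, A), where (b f)(x) = f(x) rho(b) *)
Definition adual (K : comPzRingType) (A B : kalg K)
    (rho : {rmorphism B -> A^c}) (M : lmodType A) : Type := lhom M A^o.

Section DualModules.
Variables (K : comPzRingType) (A B : kalg K) (rho : {rmorphism B -> A^c}).
Variable M : lmodType A.

HB.instance Definition _ := GRing.Zmodule.on (kdual rho M).
HB.instance Definition _ := GRing.Zmodule.on (adual rho M).

Fact kdual_scale_linear (b : B) (f : lhom (restr_scal M) K^o) :
  linear (fun x : restr_scal M => f ((rho b : A) *: (x : M))).
Proof.
move=> k x y; rewrite -linearP; congr (f _).
have E : (rho b : A) *: (kscal A k *: (x : M) + y) =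
    kscal A k *: ((rho b : A) *: (x : M)) + (rho b : A) *: (y : M).
  by rewrite scalerDr !scalerA kscalC.
exact: E.
Qed.

Definition kdual_scale (b : B) (f : lhom (restr_scal M) K^o) :
  lhom (restr_scal M) K^o := Lhom (kdual_scale_linear b f).

Fact kdual_scalerA b c f : kdual_scale b (kdual_scale c f) = kdual_scale (b * c) f.
Proof.
apply: lhomP=> x.
rewrite -[LHS]/(f ((rho c : A) *: ((rho b : A) *: (x : M)))).
by rewrite -[RHS]/(f ((rho (b * c) : A) *: (x : M))) scalerA rmorphM.
Qed.
Fact kdual_scale1 : left_id 1 kdual_scale.
Proof.
move=> f; apply: lhomP=> x.
by rewrite -[LHS]/(f ((rho 1 : A) *: (x : M))) rmorph1 scale1r.
Qed.
Fact kdual_scalerDr : right_distributive kdual_scale +%R.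
Proof. by move=> b f g; apply: lhomP. Qed.
Fact kdual_scalerDl f : {morph kdual_scale^~ f : b c / b + c}.
Proof.
move=> b c; apply: lhomP=> x.
rewrite -[LHS]/(f ((rho (b + c) : A) *: (x : M))) raddfD scalerDl.
exact: (raddfD (lhom_fun f)).
Qed.

HB.instance Definition _ := GRing.Zmodule_isLmodule.Build B (kdual rho M)
  kdual_scalerA kdual_scale1 kdual_scalerDr kdual_scalerDl.

Fact adual_scale_linear (b : B) (f : lhom M A^o) :
  linear (fun x : M => (f x : A) * (rho b : A) : A^o).
Proof. by move=> r x y; rewrite linearP mulrDl -mulrA. Qed.

Definition adual_scale (b : B) (f : lhom M A^o) : lhom M A^o :=
  Lhom (adual_scale_linear b f).

Fact adual_scalerA b c f : adual_scale b (adual_scale c f) = adual_scale (b * c) f.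
Proof.
apply: lhomP=> x.
rewrite -[LHS]/((f x : A) * (rho c : A) * (rho b : A)).
by rewrite -[RHS]/((f x : A) * (rho (b * c) : A)) rmorphM -mulrA.
Qed.
Fact adual_scale1 : left_id 1 adual_scale.
Proof.
move=> f; apply: lhomP=> x.
by rewrite -[LHS]/((f x : A) * (rho 1 : A)) rmorph1 mulr1.
Qed.
Fact adual_scalerDr : right_distributive adual_scale +%R.
Proof. by move=> b f g; apply: lhomP=> x; exact: mulrDl. Qed.
Fact adual_scalerDl f : {morph adual_scale^~ f : b c / b + c}.
Proof.
move=> b c; apply: lhomP=> x.
by rewrite -[LHS]/((f x : A) * (rho (b + c) : A)) raddfD mulrDr.
Qed.

HB.instance Definition _ := GRing.Zmodule_isLmodule.Build B (adual rho M)
  adual_scalerA adual_scale1 adual_scalerDr adual_scalerDl.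

End DualModules.

(* X is Tr M, that is, the cokernel of Hom_A(d1, A) for a minimal projective
   presentation d1 : P1 -> P0, d0 : P0 -> M. *)
Definition is_transpose (K : comPzRingType) (A B : kalg K)
    (rho : {rmorphism B -> A^c}) (M : lmodType A) (X : lmodType B) : Prop :=
  exists (P1 P0 : lmodType A) (d1 : {linear P1 -> P0}) (d0 : {linear P0 -> M})
         (q : {linear adual rho P1 -> X}),
    [/\ minimal_presentation d1 d0, surj q
      & forall h : lhom P1 A^o,
          q h = 0 <-> exists h0 : lhom P0 A^o, forall x, h x = h0 (d1 x)].

Section AuslanderReiten.
Variables (K : comPzRingType) (A : kalg K).

Definition to_op_op (a : A) : (op_alg A)^c := a.

Fact to_op_op_zmod_morphism : zmod_morphism to_op_op.
Proof. by []. Qed.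
Fact to_op_op_monoid_morphism : monoid_morphism to_op_op.
Proof. by []. Qed.

HB.instance Definition _ :=
  GRing.isZmodMorphism.Build A (op_alg A)^c to_op_op to_op_op_zmod_morphism.
HB.instance Definition _ :=
  GRing.isMonoidMorphism.Build A (op_alg A)^c to_op_op to_op_op_monoid_morphism.

Definition op_id : {rmorphism op_alg A -> A^c} := (@idfun A^c : {rmorphism _ -> _}).

Definition D_left (M : lmodType A) : lmodType (op_alg A) := kdual op_id M.

Definition D_right (N : lmodType (op_alg A)) : lmodType A := kdual to_op_op N.

(* DA *)
Definition dual_regular : lmodType A := D_right ((op_alg A)^o).

(* X is tau M = D Tr M *)
Definition is_tau (M X : lmodType A) : Prop :=
  exists N : lmodType (op_alg A), is_transpose op_id M N /\ mod_iso X (D_right N).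

(* X is tau^- M = Tr D M *)
Definition is_tau_inv (M X : lmodType A) : Prop :=
  is_transpose to_op_op (D_left M) X.

Definition finite_dimensional : Prop :=
  exists n (v : 'I_n -> A), forall x, exists c : 'I_n -> K,
    x = \sum_i kscal A (c i) * v i.

End AuslanderReiten.

Section APRTilting.
Variables (K : fieldType) (Q : quiver) (W : cpath K Q) (C : {set arrow Q}).

Let A : kalg K := truncated_jacobian W C.

Definition is_algebraic_cut : Prop :=
  [/\ is_cut W C, finite_dimensional A, gldim_le A 2
    & minimal_cut_relations W C].

(* S is the simple A-module at the vertex x: a one-dimensional space on which
   each f acts by its coefficient at the trivial path at x *)
Definition is_simple_at (x : vertex Q) (S : lmodType A) : Prop :=
  (exists s : S, s <> 0 /\ forall v : S, exists k, v = kscal A k *: s) /\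
  forall (f : cpath K Q) (v : S),
    truncated_pi W C f *: v = kscal A (f (trivial_path x)) *: v.

Definition is_2APR_tilting (x : vertex Q) (T : lmodType A) : Prop :=
  exists S U : lmodType A,
    [/\ is_simple_at x S, ~ injective_mod S, ext1_vanishes (dual_regular A) S,
        mod_iso A^o (S * U)%type
      & exists X Y : lmodType A,
          [/\ is_cosyzygy S X, is_tau_inv X Y & mod_iso T (Y * U)%type]].

Definition is_2APR_cotilting (x : vertex Q) (T : lmodType A) : Prop :=
  exists S U : lmodType A,
    [/\ is_simple_at x S, ~ projective S, ext1_vanishes S A^o,
        mod_iso (dual_regular A) (S * U)%type
      & exists X Y : lmodType A,
          [/\ is_syzygy S X, is_tau X Y & mod_iso T (Y * U)%type]].

End APRTilting.

(* Main.v *)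
From HB Require Import structures.
From mathcomp Require Import all_boot all_order all_algebra.
From mathcomp Require Import boolp classical_sets functions.
Require Import Defs.

Set Implicit Arguments.
Unset Strict Implicit.
Unset Printing Implicit Defensive.

Import GRing.Theory.
Local Open Scope ring_scope.

(** Let [x] be a source of [Q_C].  All arrows [c] ending at [x] belong to [C], and minimality
    of the relations shows that no arrow [a] starting at [x] does ([src_cut]).  Writing [r a c]
    for the derivative along [c] with the first arrow [a] removed, one has
    [d_c W = \sum_a a * r a c] ([D_in]) and, rotating cycles, [d_a W = \sum_c r a c * c]
    ([D_out]).  The matrix [r] thus holds the relations of [A = P(Q, W)_C] starting at [x], and
    also those relations of the mutated algebra that end at [x], where the arrows [c] have come
    back and the arrows [a] are cut.  Everything else, the paths avoiding [x], is common to
    both algebras.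

    Let [e] be the idempotent at [x].  In [A] the row [a] and the matrix [r] start a resolution
    of the simple right module at [x]: the columns killed by [a] are combinations of those of [r]
    ([relations_at_source]); a bound on the global dimension yields a projection onto the
    syzygies of [r] ([syzygy_projection_gldim]), and minimality then shows that [r] is injective
    ([relations_independent]); the vanishing of [Ext^1(DA, S)] shows that every row killed by
    [r] is a left multiple of [a] ([extension_tilting]).  The dual of [Omega^- S] is the radical
    of [e A] ([cosyzygy_dual]), which is presented by [r].  Hence [V = tau^- Omega^- S] is
    generated by elements [t c], one for each arrow [c] ending at [x], subject to the relations
    [\sum_c r a c *: t c = 0] ([transpose_presents]), and [U = A / S] is [A * (1 - e)]
    ([complement_generator]).

    The path algebra acts on [V * U]: paths avoiding [x] act on [U] by right multiplication, the
    arrow [c] maps [U] to [V] by means of [t c], and the arrows [a] act as zero.  The relations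
    of [V] are the derivatives along the arrows [a], so the kernel of this action is the ideal
    of the mutated cut ([mutation_ker1], [mutation_ker2]).  It is onto because [End V] consists
    of scalars and [Hom(V, U) = 0]; this is where the exactness properties of [r] enter
    ([presented_endo], [presented_hom0], [core_endo_alg]).

    At a sink of [Q_C], which is a source for the opposite quiver, the same theorem is applied
    to the opposite algebra and to the dual of the cotilting module, which is the product of
    [Tr (Omega S)] and [D (DA / S)] ([sink_cotilting]).  The projection onto the syzygies now
    comes from the projective dimension of [S] ([syzygy_projection_pdim]), and the multiples of
    [a] from [Ext^1(S, A) = 0] ([extension_cotilting]). *)

(** * The complete path algebra and its closed ideals *)

Section IdealFacts.
Variable A : pzRingType.
Implicit Types (I S : set A).

Lemma is_ideal0 I : is_ideal I -> I 0. Proof. by case=> [[]]. Qed.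
Lemma is_idealB I x y : is_ideal I -> I x -> I y -> I (x - y).
Proof. by case=> [[_ IB _] _]; apply: IB. Qed.
Lemma is_idealN I x : is_ideal I -> I x -> I (- x).
Proof. by move=> II Ix; rewrite -sub0r; apply: is_idealB => //; exact: is_ideal0. Qed.
Lemma is_idealD I x y : is_ideal I -> I x -> I y -> I (x + y).
Proof. by move=> II Ix Iy; rewrite -[y]opprK; apply: is_idealB => //; exact: is_idealN. Qed.
Lemma is_idealMl I a x : is_ideal I -> I x -> I (a * x).
Proof. by case=> [[_ _ IM] _]; apply: IM. Qed.
Lemma is_idealMr I a x : is_ideal I -> I x -> I (x * a).
Proof. by case=> [_ IM]; apply: IM. Qed.

Lemma is_ideal_sum I (T : Type) (r : seq T) (P : pred T) (F : T -> A) :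
  is_ideal I -> (forall i, P i -> I (F i)) -> I (\sum_(i <- r | P i) F i).
Proof.
move=> II IF; elim/big_ind: _ => //; first exact: is_ideal0.
by move=> x y; exact: is_idealD.
Qed.

Lemma sub_ideal_gen S x : S x -> ideal_gen S x.
Proof. by move=> Sx I _; apply. Qed.

Lemma is_ideal_mk I : I 0 -> (forall x y, I x -> I y -> I (x + y)) ->
  (forall a x, I x -> I (a * x)) -> (forall a x, I x -> I (x * a)) -> is_ideal I.
Proof.
move=> I0 ID IMl IMr; split => //; split=> // x y Ix Iy; apply: ID => //.
by rewrite -mulN1r; apply: IMl.
Qed.

End IdealFacts.

Section Coefficients.
Variables (K : fieldType) (Q : quiver).
Local Notation L := (cpath K Q).
Implicit Types (f g h : L) (x y : vertex Q) (s t : seq (arrow Q)) (a b : arrow Q).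

Lemma pcoef0 x s : pcoef (0 : L) x s = 0.
Proof. by rewrite -(subrr (0 : L)) pcoefB subrr. Qed.

Lemma pcoefN f x s : pcoef (- f) x s = - pcoef f x s.
Proof. by rewrite -sub0r pcoefB pcoef0 sub0r. Qed.

Lemma pcoef_sum (T : Type) (r : seq T) (P : pred T) (F : T -> L) x s :
  pcoef (\sum_(i <- r | P i) F i) x s = \sum_(i <- r | P i) pcoef (F i) x s.
Proof.
by apply: (big_morph (fun f => pcoef f x s)) => [f g|]; rewrite (pcoefD, pcoef0).
Qed.

Lemma pcoef_one x s : pcoef (1 : L) x s = (s == [::])%:R.
Proof. exact: pcoef1. Qed.

Lemma pcoef_mul f g x s : pcoef (f * g) x s =
  \sum_(i < (size s).+1)
    pcoef f x (take i s) * pcoef g (walk_end x (take i s)) (drop i s).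
Proof. exact: pcoefM. Qed.

Lemma pcoef_mul_nil f g x : pcoef (f * g) x [::] = pcoef f x [::] * pcoef g x [::].
Proof. by rewrite pcoef_mul big_ord1. Qed.

Definition vtx x : L := fun p => (val p == (x, [::]))%:R.

Lemma pcoef_vtx y x s : pcoef (vtx y) x s = ((x == y) && (s == [::]))%:R.
Proof.
have [xs|xs] := boolP (is_walk x s); first by rewrite pcoefE /vtx /= xpair_eqE.
by rewrite pcoef_out //; case: s xs => //= a s _; rewrite andbF.
Qed.

Lemma pcoef_arrow a x s : pcoef (arrow_elt K a) x s = ((x == src a) && (s == [:: a]))%:R.
Proof.
have [xs|xs] := boolP (is_walk x s); first by rewrite pcoefE /arrow_elt /= xpair_eqE.
rewrite pcoef_out //; case: eqP => //= xa; case: eqP => //= sa.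
by move: xs; rewrite sa xa /= eqxx.
Qed.

Definition cscal (k : K) : L := kscal (cpath_alg K Q) k.

Lemma cscal0 : cscal 0 = 0. Proof. exact: (raddf0 (kscal (cpath_alg K Q))). Qed.
Lemma cscal1 : cscal 1 = 1. Proof. exact: (rmorph1 (kscal (cpath_alg K Q))). Qed.

Lemma pcoef_scal k f x s : pcoef (cscal k * f) x s = k * pcoef f x s.
Proof. by rewrite [cscal k * f](cpath_scalMl k f) pcoefZ. Qed.

Lemma cscalC k f : cscal k * f = f * cscal k.
Proof. exact: cpath_scalC. Qed.

Lemma pcoef_cscal k x s : pcoef (cscal k) x s = k * (s == [::])%:R.
Proof. by rewrite -[cscal k]mulr1 pcoef_scal pcoef_one. Qed.

Lemma pcoef_vtxl y f x s : pcoef (vtx y * f) x s = (x == y)%:R * pcoef f x s.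
Proof.
rewrite pcoef_mul big_ord_recl /= take0 drop0 pcoef_vtx eqxx andbT.
rewrite big1 ?addr0 // => i _; rewrite pcoef_vtx.
by case: s i => [|b s] i; [case: i | rewrite andbF mul0r].
Qed.

Lemma pcoef_vtxr y f x s :
  pcoef (f * vtx y) x s = (walk_end x s == y)%:R * pcoef f x s.
Proof.
rewrite pcoef_mul big_ord_recr /= take_size drop_size pcoef_vtx eqxx andbT.
rewrite big1 ?add0r 1?mulrC // => i _; rewrite pcoef_vtx -size_eq0 size_drop subn_eq0.
by rewrite leqNgt ltn_ord andbF mulr0.
Qed.

Lemma pcoef_arrowl_nil a f x : pcoef (arrow_elt K a * f) x [::] = 0.
Proof. by rewrite pcoef_mul_nil pcoef_arrow andbF mul0r. Qed.

Lemma pcoef_arrowl a f x b s :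
  pcoef (arrow_elt K a * f) x (b :: s) =
  ((x == src a) && (b == a))%:R * pcoef f (tgt a) s.
Proof.
rewrite pcoef_mul big_ord_recl /= pcoef_arrow andbF mul0r add0r.
rewrite big_ord_recl /= take0 drop0 pcoef_arrow /= eqseq_cons andbT /walk_end /=.
rewrite big1 ?addr0 => [|i _].
  by have [->//|_] := eqVneq b a; rewrite !andbF !mul0r.
rewrite /bump /= !add1n pcoef_arrow.
case: s i => [|c s] i /=; first by case: i.
by rewrite eqseq_cons andbF andbF mul0r.
Qed.

Lemma pcoef_arrowr_nil a f x : pcoef (f * arrow_elt K a) x [::] = 0.
Proof. by rewrite pcoef_mul_nil pcoef_arrow andbF mulr0. Qed.

Lemma pcoef_arrowr a f x s b :
  pcoef (f * arrow_elt K a) x (rcons s b) =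
  ((walk_end x s == src a) && (b == a))%:R * pcoef f x s.
Proof.
rewrite pcoef_mul size_rcons big_ord_recr /= [take _ _]take_oversize ?size_rcons //.
rewrite drop_oversize ?size_rcons // pcoef_arrow andbF mulr0 addr0.
rewrite big_ord_recr /= -cats1 take_size_cat // drop_size_cat //.
rewrite pcoef_arrow eqseq_cons andbT mulrC big1 ?add0r // => i _.
rewrite pcoef_arrow; case: (_ =P [:: a]) => [/(congr1 size)|_]; last by rewrite andbF mulr0.
rewrite size_drop size_cat addn1 /=; move: (ltn_ord i) => il.
by rewrite subSn 1?ltnW // => -[] /eqP; rewrite subn_eq0 leqNgt il.
Qed.

(** The [n]-th power of the radical in terms of coefficients, see [ideal_expE]. *)
Definition ord n f := forall x s, (size s < n)%N -> pcoef f x s = 0.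

Lemma ord0 f : ord 0 f. Proof. by []. Qed.
Lemma ord_zero n : ord n 0. Proof. by move=> x s _; rewrite pcoef0. Qed.
Lemma ordW m n f : (m <= n)%N -> ord n f -> ord m f.
Proof. by move=> mn of_ x s sm; apply: of_; apply: leq_trans mn. Qed.
Lemma ordD n f g : ord n f -> ord n g -> ord n (f + g).
Proof. by move=> of_ og x s sn; rewrite pcoefD of_ // og // addr0. Qed.
Lemma ordN n f : ord n f -> ord n (- f).
Proof. by move=> of_ x s sn; rewrite pcoefN of_ // oppr0. Qed.
Lemma ordB n f g : ord n f -> ord n g -> ord n (f - g).
Proof. by move=> of_ og; apply: ordD => //; apply: ordN. Qed.

Lemma ordM m n f g : ord m f -> ord n g -> ord (m + n) (f * g).
Proof.
move=> of_ og x s smn; rewrite pcoef_mul big1 // => i _.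
have [im|im] := ltnP i m.
  by rewrite of_ ?mul0r // (leq_ltn_trans _ im) // size_take_min geq_minl.
rewrite [pcoef g _ _]og ?mulr0 // size_drop ltn_subLR //; last by rewrite -ltnS.
by apply: leq_trans smn _; rewrite leq_add2r.
Qed.

Lemma ordMl n f g : ord n g -> ord n (f * g).
Proof. by move=> og; rewrite -[n]add0n; apply: ordM. Qed.
Lemma ordMr n f g : ord n f -> ord n (f * g).
Proof. by move=> og; rewrite -[n]addn0; apply: ordM. Qed.

Lemma ord_ideal n : is_ideal (ord n).
Proof.
apply: is_ideal_mk; [exact: ord_zero | by move=> ? ?; exact: ordD
  | by move=> ? ?; exact: ordMl | by move=> ? ?; exact: ordMr].
Qed.

Lemma ord_all f : (forall n, ord n f) -> f = 0.
Proof. by move=> of_; apply: cpathP => x s; rewrite pcoef0 (of_ (size s).+1). Qed.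

Lemma ordX n f : ord 1 f -> ord n (f ^+ n).
Proof.
move=> of_; elim: n => [|n IHn]; first exact: ord0.
by rewrite exprS -add1n; apply: ordM.
Qed.

Lemma ord_arrow a : ord 1 (arrow_elt K a).
Proof. by move=> x [|//] _; rewrite pcoef_arrow andbF. Qed.

Lemma ord1P f : (forall x, pcoef f x [::] = 0) -> ord 1 f.
Proof. by move=> f0 x [|//] _. Qed.

(** The geometric series inverts [1 - h]; its coefficient at a path [p] only involves the
    first [|p| + 1] terms. *)
Lemma left_inverse_1B h : ord 1 h -> exists u, u * (1 - h) = 1.
Proof.
move=> oh; pose sN N : L := \sum_(n < N) h ^+ n.
pose u : L := fun p => sN (size (val p).2).+1 p.
have sNS m n x s : (size s < m)%N -> (m <= n)%N -> pcoef (sN n) x s = pcoef (sN m) x s.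
  move=> sm /subnKC <-; rewrite /sN big_split_ord /= pcoefD [X in _ + X]pcoef_sum.
  rewrite [X in _ + X]big1 ?addr0 // => i _; apply: (@ordX (m + i)) => //.
  by apply: leq_trans sm (leq_addr _ _).
have uE N x s : (size s < N)%N -> pcoef u x s = pcoef (sN N) x s.
  move=> sN'; rewrite (sNS (size s).+1 N) //.
  have [xs|xs] := boolP (is_walk x s); first by rewrite !pcoefE.
  by rewrite !pcoef_out.
have tel N : sN N * (1 - h) + h ^+ N = 1.
  elim: N {sNS uE} => [|N IH]; first by rewrite /sN big_ord0 mul0r add0r.
  rewrite /sN big_ord_recr /= -/(sN N) mulrDl [h ^+ N * _]mulrBr mulr1 -exprSr.
  by rewrite -addrA subrK.
exists u; apply/eqP; rewrite -subr_eq0; apply/eqP/ord_all => N.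
have -> : u * (1 - h) - 1 = (u - sN N) * (1 - h) - h ^+ N.
  by rewrite -[X in _ - X](tel N) mulrBl opprD addrA.
by apply: ordB; [apply: ordMr => x s sN'; rewrite pcoefB (uE N) // subrr | exact: ordX].
Qed.

Lemma inverse_1B h : ord 1 h -> exists2 u, u * (1 - h) = 1 & (1 - h) * u = 1.
Proof.
move=> oh; have [u u1] := left_inverse_1B oh.
have uE : u = 1 - (- (u * h)) by rewrite opprK -[1 in RHS]u1 mulrBr mulr1 subrK.
have [v v1] : exists v, v * (1 - - (u * h)) = 1.
  by apply: left_inverse_1B; apply: ordN; exact: ordMl.
rewrite -uE in v1; exists u => //.
suff -> : 1 - h = v by [].
by rewrite -[LHS]mul1r -[X in X * _]v1 -mulrA u1 mulr1.
Qed.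

(** If [f] has no constant term then [1 - h * f] is always invertible, so that [f] lies in
    every maximal left ideal; conversely the elements whose coefficient vanishes at the
    trivial path of [x] form a maximal left ideal. *)
Lemma jacobsonE f : @jacobson L f <-> ord 1 f.
Proof.
split=> [jf|of_].
  apply: ord1P => x; apply: (jf (fun f => pcoef f x [::] = 0)).
  split; first split.
  - by rewrite pcoef0.
  - by move=> g h g0 h0; rewrite pcoefB g0 h0 subrr.
  - by move=> g h h0; rewrite pcoef_mul_nil h0 mulr0.
  - by rewrite pcoef_one eqxx; apply/eqP/oner_neq0.
  move=> I' [_ IB IM] sI I1 g Ig; apply/eqP/negPn/negP => g0; apply: I1.
  set k := pcoef g x [::] in g0.
  have Ig' : I' (cscal k^-1 * g) by apply: IM.
  have : I' (cscal k^-1 * g - 1).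
    by apply: sI; rewrite pcoefB pcoef_scal pcoef_one mulVf // subrr.
  by move=> /(IB _ _ Ig'); rewrite opprB addrC subrK.
move=> I [[I0 IB IM] I1 Imax]; apply: contrapT => If.
have ID g h : I g -> I h -> I (g + h).
  by move=> Ig Ih; rewrite -[h]opprK -[- h]sub0r; do 2!apply: (IB) => //.
pose I' : set L := fun g => exists i h, I i /\ g = i + h * f.
apply: If; apply: (Imax I').
- split.
  + by exists 0, 0; rewrite mul0r addr0.
  + move=> _ _ [i [h [Ii ->]]] [i' [h' [Ii' ->]]]; exists (i - i'), (h - h').
    by split; [exact: IB | rewrite mulrBl opprD addrACA].
  + move=> g _ [i [h [Ii ->]]]; exists (g * i), (g * h).
    by split; [exact: IM | rewrite mulrDr mulrA].
- by move=> g Ig; exists g, 0; rewrite mul0r addr0.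
- move=> [i [h [Ii e1]]]; have [u u1] := left_inverse_1B (ordMl h of_).
  by apply: I1; rewrite -u1; apply: IM; rewrite e1 addrK.
- by exists 0, 1; rewrite mul1r add0r.
Qed.

(** The quotient of [f] in the division by the arrow [a] on the left, see [ldivE]. *)
Definition ldiv a f : L := fun p =>
  (((val p).1 == tgt a)%:R : K) * pcoef f (src a) (a :: (val p).2).

Lemma pcoef_ldiv a f y s :
  pcoef (ldiv a f) y s = (y == tgt a)%:R * pcoef f (src a) (a :: s).
Proof.
have [ys|ys] := boolP (is_walk y s); first by rewrite pcoefE.
rewrite pcoef_out //; case: eqP => [yE|_]; last by rewrite mul0r.
by rewrite pcoef_out ?mulr0 //= eqxx /= -yE.
Qed.

Definition rdiv c f : L := fun p => pcoef f (val p).1 (rcons (val p).2 c).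

Lemma pcoef_rdiv c f y s : pcoef (rdiv c f) y s = pcoef f y (rcons s c).
Proof.
have [ys|ys] := boolP (is_walk y s); first by rewrite pcoefE.
by rewrite !pcoef_out // -cats1 is_walk_cat (negPf ys).
Qed.

Lemma ldivD a f g : ldiv a (f + g) = ldiv a f + ldiv a g.
Proof. by apply: cpathP => x s; rewrite pcoefD !pcoef_ldiv pcoefD mulrDr. Qed.
Lemma rdivD a f g : rdiv a (f + g) = rdiv a f + rdiv a g.
Proof. by apply: cpathP => x s; rewrite pcoefD !pcoef_rdiv pcoefD. Qed.

Lemma ldivM a f g :
  ldiv a (f * g) = ldiv a f * g + cscal (pcoef f (src a) [::]) * ldiv a g.
Proof.
apply: cpathP => x s; rewrite pcoefD pcoef_scal !pcoef_ldiv !pcoef_mul.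
rewrite big_ord_recl /= /walk_end /= mulrDr addrC; congr (_ + _).
  rewrite mulr_sumr; apply: eq_bigr => i _; rewrite pcoef_ldiv -mulrA.
  by case: eqP => [->|_]; rewrite ?mul0r.
by rewrite mulrCA.
Qed.

Lemma rdivM c f g :
  rdiv c (f * g) = f * rdiv c g + cscal (pcoef g (tgt c) [::]) * rdiv c f.
Proof.
apply: cpathP => x s; rewrite pcoefD pcoef_scal !pcoef_rdiv !pcoef_mul.
rewrite size_rcons big_ord_recr /= take_oversize ?size_rcons //.
rewrite drop_oversize ?size_rcons // [X in _ + X]mulrC /walk_end map_rcons last_rcons.
congr (_ + _); apply: eq_bigr => i _; rewrite pcoef_rdiv.
have il : (i <= size s)%N by rewrite -ltnS.
have -> : drop i (rcons s c) = rcons (drop i s) c by rewrite drop_rcons.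
by rewrite -cats1 takel_cat.
Qed.

Lemma ord_ldiv n a f : ord n.+1 f -> ord n (ldiv a f).
Proof. by move=> of_ x s sn; rewrite pcoef_ldiv of_ ?mulr0. Qed.
Lemma ord_rdiv n a f : ord n.+1 f -> ord n (rdiv a f).
Proof. by move=> of_ x s sn; rewrite pcoef_rdiv of_ // size_rcons. Qed.

Lemma ldivE f : f = \sum_x cscal (pcoef f x [::]) * vtx x
                    + \sum_a arrow_elt K a * ldiv a f.
Proof.
apply: cpathP => y s; rewrite pcoefD !pcoef_sum; case: s => [|b s].
  rewrite [X in _ + X]big1 => [|a _]; last by rewrite pcoef_arrowl_nil.
  rewrite addr0 (bigD1 y) //= pcoef_scal pcoef_vtx !eqxx mulr1 big1 ?addr0 // => x xy.
  by rewrite pcoef_scal pcoef_vtx eq_sym (negPf xy) mulr0.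
rewrite big1 => [|x _]; last by rewrite pcoef_scal pcoef_vtx andbF mulr0.
rewrite add0r (bigD1 b) //= pcoef_arrowl eqxx andbT pcoef_ldiv eqxx mul1r.
rewrite big1 ?addr0 => [|a ab]; last by rewrite pcoef_arrowl [b == a]eq_sym (negPf ab) andbF mul0r.
case: eqP => [->|/eqP yb]; first by rewrite mul1r.
by rewrite mul0r pcoef_out //= eq_sym (negPf yb).
Qed.

Lemma rdivE f : f = \sum_x cscal (pcoef f x [::]) * vtx x
                    + \sum_a rdiv a f * arrow_elt K a.
Proof.
apply: cpathP => y s; rewrite pcoefD !pcoef_sum; case/lastP: s => [|s b].
  rewrite [X in _ + X]big1 => [|a _]; last by rewrite pcoef_arrowr_nil.
  rewrite addr0 (bigD1 y) //= pcoef_scal pcoef_vtx !eqxx mulr1 big1 ?addr0 // => x xy.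
  by rewrite pcoef_scal pcoef_vtx eq_sym (negPf xy) mulr0.
rewrite big1 => [|x _]; last first.
  by rewrite pcoef_scal pcoef_vtx -size_eq0 size_rcons andbF mulr0.
rewrite add0r (bigD1 b) //= pcoef_arrowr eqxx andbT pcoef_rdiv.
rewrite big1 ?addr0 => [|a ab]; last by rewrite pcoef_arrowr [b == a]eq_sym (negPf ab) andbF mul0r.
have [yb|yb] := eqVneq (walk_end y s) (src b); first by rewrite mul1r.
by rewrite mul0r pcoef_out // -cats1 is_walk_cat /= eq_sym (negPf yb) andbF.
Qed.

(** There are finitely many arrows, so splitting off the last arrow writes an element without
    terms of length at most [n] as a finite sum of products of an element of order [n] with an
    arrow. *)
Lemma ideal_expE n f : ideal_exp (@jacobson L) n f <-> ord n f.
Proof.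
elim: n f => [|n IHn] f; first by split.
split=> [|of_] /=.
  apply; first exact: ord_ideal.
  move=> _ [g [h [/IHn og /jacobsonE oh ->]]].
  by rewrite -addn1; apply: ordM.
rewrite (rdivE f) big1 ?add0r => [|x _].
  apply: is_ideal_sum => [|a _]; first exact: ideal_gen_is_ideal.
  apply: sub_ideal_gen; exists (rdiv a f), (arrow_elt K a); split=> //.
    by apply/IHn; exact: ord_rdiv.
  by apply/jacobsonE; exact: ord_arrow.
by rewrite of_ // cscal0 mul0r.
Qed.

(** The closed ideal generated by [S], with [ord n] in place of the powers of the radical. *)
Definition cl (S : set L) : set L :=
  [set f | forall n, exists2 g, ideal_gen S g & ord n (f - g)]%classic.

Lemma clE S : cl S = closed_ideal (@jacobson L) S :> set L.
Proof.
by apply/funext => f; apply/propext; split=> H n; have [g Sg fg] := H n; exists g => //;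
  apply/ideal_expE.
Qed.

Lemma cl_ideal S : is_ideal (cl S).
Proof. by rewrite clE; exact: idealP. Qed.

Lemma cl_gen S f : ideal_gen S f -> cl S f.
Proof. by move=> Sf n; exists f => //; rewrite subrr; exact: ord_zero. Qed.

Lemma sub_cl (S : set L) f : S f -> cl S f.
Proof. by move=> Sf; apply: cl_gen; exact: sub_ideal_gen. Qed.

Lemma cl_closed S f : (forall n, exists2 g, cl S g & ord n (f - g)) -> cl S f.
Proof.
move=> H n; have [g Sg fg] := H n; have [h Sh gh] := Sg n; exists h => //.
by rewrite -[f](subrK g) -addrA; exact: ordD.
Qed.

(** To include a closed ideal in an ideal that contains a power of the radical, it is
    enough to treat the generators. *)
Lemma cl_min S (I : set L) n : is_ideal I -> (forall f, S f -> I f) ->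
  (forall f, ord n f -> I f) -> forall f, cl S f -> I f.
Proof.
move=> II SI oI f /(_ n) [g Sg fg]; rewrite -[f](subrK g); apply: is_idealD => //.
  exact: oI.
exact: Sg.
Qed.

Lemma cl_sub (S T : set L) : (forall f, S f -> cl T f) -> forall f, cl S f -> cl T f.
Proof.
move=> ST f Sf; apply: cl_closed => n; have [g Sg fg] := Sf n; exists g => //.
by apply: Sg => //; exact: cl_ideal.
Qed.

(** A series of paths that all contain an arrow of [X] is a limit of elements of the ideal
    generated by [X], even when it has infinitely many terms. *)
Lemma cl_supp S (X : pred (arrow Q)) f : (forall a, X a -> S (arrow_elt K a)) ->
  (forall x s, ~~ has X s -> pcoef f x s = 0) -> cl S f.
Proof.
move=> XS; move=> supp n; elim: n f supp => [|n IHn] f supp.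
  by exists 0; [exact: (is_ideal0 (ideal_gen_is_ideal _)) | exact: ord0].
have /fin_all_exists [g Hg] a : exists g, ideal_gen S (arrow_elt K a * g)
    /\ ord n (ldiv a f - g).
  have [Xa|Xa] := boolP (X a).
    exists (ldiv a f); rewrite subrr; split; last exact: ord_zero.
    by apply: (is_idealMr (I := ideal_gen S)); [exact: ideal_gen_is_ideal | apply: sub_ideal_gen; exact: XS].
  have [|g Sg fg] := IHn (ldiv a f).
    by move=> x s Xs; rewrite pcoef_ldiv supp ?mulr0 //= negb_or Xa.
  by exists g; split=> //; apply: (is_idealMl (I := ideal_gen S)) => //; exact: ideal_gen_is_ideal.
exists (\sum_a arrow_elt K a * g a).
  by apply: is_ideal_sum => [|a _]; [exact: ideal_gen_is_ideal | case: (Hg a)].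
rewrite [X in X - _](ldivE f) big1 => [|x _]; last by rewrite supp // cscal0 mul0r.
rewrite add0r -sumrB; apply: (is_ideal_sum (I := ord n.+1)) => [|a _]; first exact: ord_ideal.
rewrite -mulrBr -add1n; apply: ordM; first exact: ord_arrow.
by case: (Hg a).
Qed.

End Coefficients.
Arguments vtx {K Q} x.
Arguments cscal {K Q} k.

(** * Cyclic derivatives *)

Section Rotations.
Variables (T : Type) (V : nmodType) (F : seq T -> V).

Lemma sum_rotS s : \sum_(i < size s) F (rot i.+1 s) = \sum_(i < size s) F (rot i s).
Proof.
case: s => [|a s]; first by rewrite !big_ord0.
rewrite [LHS]big_ord_recr [RHS]big_ord_recl /= rot0.
rewrite -[(size s).+1]/(size (a :: s)) rot_size addrC.
by congr (_ + _); apply: eq_bigr.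
Qed.

Lemma sum_rot_rot k s : (k <= size s)%N ->
  \sum_(i < size s) F (rot i (rot k s)) = \sum_(i < size s) F (rot i s).
Proof.
elim: k => [|k IHk] ks; first by rewrite rot0.
rewrite -IHk 1?ltnW //; have := sum_rotS (rot k s); rewrite size_rot => <-.
by apply: eq_bigr => i _; rewrite [rot k.+1 s]rotS // [rot i.+1 _]rotS ?size_rot // rot_rot.
Qed.

Lemma sum_rotr s : \sum_(i < size s) F (rotr i s) = \sum_(i < size s) F (rot i s).
Proof.
rewrite -sum_rotS [RHS](reindex_inj rev_ord_inj) /=; apply: eq_bigr => i _.
by rewrite /rotr subnSK.
Qed.

End Rotations.

Section CyclicDerivatives.
Variables (K : fieldType) (Q : quiver).
Local Notation L := (cpath K Q).
Implicit Types (f g h W : L) (x y : vertex Q) (s t r : seq (arrow Q)) (a b : arrow Q).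

Definition adj a b := tgt a == src b.

(** The coefficient at a nonempty path given by its arrows alone, which rotate more easily
    than a path with its starting vertex. *)
Definition hcoef W s : K := if s is b :: _ then pcoef W (src b) s else 0.

(** All that cyclic derivatives see of [W], see [pcoef_deriv]. *)
Definition cyc W s : K := \sum_(i < size s) hcoef W (rot i s).

Lemma cyc_rot W k s : (k <= size s)%N -> cyc W (rot k s) = cyc W s.
Proof. by move=> ks; rewrite /cyc size_rot sum_rot_rot. Qed.

Lemma adj_path a s : path adj a s = is_walk (tgt a) s.
Proof. by elim: s a => //= b s IHs a; rewrite IHs /adj eq_sym. Qed.

Lemma adj_cycle a s : cycle adj (a :: s) =
  is_walk (tgt a) s && (walk_end (tgt a) s == src a).
Proof. by rewrite /= rcons_path adj_path /adj /walk_end last_map. Qed.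

Lemma pcoef_deriv a W x s : pcoef (cyc_deriv a W) x s =
  if (x == tgt a) && cycle adj (a :: s) then cyc W (a :: s) else 0.
Proof.
rewrite adj_cycle; have [xs|xs] := boolP (is_walk x s); last first.
  by rewrite pcoef_out //; case: eqP => //= <-; rewrite (negPf xs).
rewrite pcoefE /cyc_deriv /=; have [xE|//=] := eqVneq x (tgt a); rewrite -xE xs /=.
by case: eqP => //= _; rewrite /cyc -sum_rotr; apply: eq_bigr => i _; rewrite /hcoef; case: rotr.
Qed.

Lemma cycB f g s : cyc (f - g) s = cyc f s - cyc g s.
Proof.
rewrite -sumrB; apply: eq_bigr => i _; rewrite /hcoef.
by case: (rot i s) => [|b t]; rewrite ?subrr ?pcoefB.
Qed.

Lemma cyc_scal k f s : cyc (cscal k * f) s = k * cyc f s.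
Proof.
rewrite mulr_sumr; apply: eq_bigr => i _; rewrite /hcoef.
by case: (rot i s) => [|b t]; rewrite ?mulr0 ?pcoef_scal.
Qed.

Lemma derivB a f g : cyc_deriv a (f - g) = cyc_deriv a f - cyc_deriv a g.
Proof.
by apply: cpathP => x s; rewrite pcoefB !pcoef_deriv cycB; case: ifP; rewrite ?subr0.
Qed.

Lemma deriv0 a : cyc_deriv a (0 : L) = 0.
Proof. by have := derivB a 0 0; rewrite !subrr. Qed.

Lemma deriv_scal a k f : cyc_deriv a (cscal k * f) = cscal k * cyc_deriv a f.
Proof.
by apply: cpathP => x s; rewrite pcoef_scal !pcoef_deriv cyc_scal; case: ifP; rewrite ?mulr0.
Qed.

Lemma ord_deriv n a W : ord n.+1 W -> ord n (cyc_deriv a W).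
Proof.
move=> oW x s sn; rewrite pcoef_deriv; case: ifP => // _.
apply: big1 => i _; have: size (rot i (a :: s)) = (size s).+1 by rewrite size_rot.
by rewrite /hcoef; case: (rot i _) => // b t st; apply: oW; rewrite st.
Qed.

Let hv v r := if r is b :: _ then src b else v.

Lemma walk_end_rot v j r : cycle adj r -> (j <= size r)%N -> r != [::] ->
  walk_end (hv v r) (take j r) = hv v (rot j r).
Proof.
move=> cr jr r0; rewrite /rot; rewrite -[r](cat_take_drop j) in cr r0 *.
rewrite take_size_cat ?drop_size_cat ?size_takel //.
move: (take j r) (drop j r) cr r0 => p q.
case/lastP: p => [|p a]; first by rewrite cats0.
rewrite /walk_end map_rcons last_rcons.
case: q => [|b q] /=.
  rewrite cats0; case: p => [|c p] /=; first by rewrite andbT => /eqP.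
  by rewrite rcons_path last_rcons => /andP[_ /eqP].
case: p => [|c p] /= ; first by case/andP=> /eqP.
by rewrite rcons_cat cat_path last_rcons /= => /and3P[_ /eqP].
Qed.

(** Both sides sum over the pairs of positions at which the cyclic word [s] can be cut, one
    piece being read in [f] and the other in [g]. *)
Lemma cyc_mulC f g s : cycle adj s -> cyc (f * g) s = cyc (g * f) s.
Proof.
case: s => [|a0 s0]; first by rewrite /cyc !big_ord0.
set s := a0 :: s0 => cs; set n := size s.
pose v := src a0.
pose phi (f g : L) r (j : 'I_n.+1) : K :=
  pcoef f (hv v r) (take j r) * pcoef g (hv v (rot j r)) (drop j r).
have hE (f' g' : L) i : hcoef (f' * g') (rot i s) = \sum_(j < n.+1) phi f' g' (rot i s) j.
  have cr : cycle adj (rot i s) by rewrite rot_cycle.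
  have sr : size (rot i s) = n by rewrite size_rot.
  have r0 : rot i s != [::] by rewrite -size_eq0 sr.
  transitivity (pcoef (f' * g') (hv v (rot i s)) (rot i s)).
    by move: r0; rewrite /hcoef /hv; case: (rot i s).
  rewrite pcoef_mul sr; apply: eq_bigr => j _.
  by rewrite (walk_end_rot v) // sr -ltnS.
have phiE r (j : 'I_n.+1) : size r = n -> phi f g r j = phi g f (rot j r) (rev_ord j).
  move=> sr; rewrite /phi /= subSS.
  have jn : (j <= n)%N by rewrite -ltnS.
  have E : size (drop j r) = (n - j)%N by rewrite size_drop sr.
  have t : take (n - j) (rot j r) = drop j r by rewrite /rot take_size_cat.
  have d : drop (n - j) (rot j r) = take j r by rewrite /rot drop_size_cat.
  have rr : rot (n - j) (rot j r) = r by rewrite [LHS]/rot t d cat_take_drop.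
  by rewrite t d rr mulrC.
have cE f' g' : cyc (f' * g') s = \sum_(i < n) \sum_(j < n.+1) phi f' g' (rot i s) j.
  by apply: eq_bigr => i _; exact: hE.
rewrite !cE.
rewrite exchange_big [RHS]exchange_big /= [RHS](reindex_inj rev_ord_inj) /=.
apply: eq_bigr => j _.
rewrite -(sum_rot_rot (fun r => phi g f r (rev_ord j)) (k := j)); last by rewrite -ltnS.
by apply: eq_bigr => i _; rewrite phiE ?size_rot // rot_rot.
Qed.

Lemma deriv_commutator a f g : cyc_deriv a (f * g - g * f) = 0.
Proof.
apply: cpathP => x s; rewrite pcoef0 pcoef_deriv cycB.
by case: ifP => // /andP[_ /cyc_mulC ->]; rewrite subrr.
Qed.

(** The derivatives kill the commutators by [cyc_mulC], and are continuous by [ord_deriv]. *)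
Lemma deriv_potential_eq W W' : potential_eq W W' ->
  forall a, cyc_deriv a W = cyc_deriv a W'.
Proof.
move=> WW' a; apply/eqP; rewrite -subr_eq0 -derivB; apply/eqP/ord_all => n.
have [z Cz /ideal_expE oz] := WW' n.+1.
suff z0 : cyc_deriv a z = 0.
  by have := ord_deriv a oz; rewrite (derivB a (W - W') z) z0 subr0.
apply: (Cz (fun z => cyc_deriv a z = 0)) => [|f g]; last exact: deriv_commutator.
split=> [|f g f0 g0|k f f0].
- exact: deriv0.
- by rewrite -[g]opprK -[- g]sub0r derivB derivB deriv0 f0 g0 !subrr.
- by rewrite -[kscal _ k]/(cscal k) deriv_scal f0 mulr0.
Qed.

(** The truncated Jacobian algebra is described as a quotient of the path algebra of the whole
    quiver, where the cut arrows are relations; for a homogeneous potential they imply the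
    vanishing of the derivatives along the other arrows. *)
Definition relset W (C : {set arrow Q}) : set L :=
  [set g | (exists2 c, c \in C & g = arrow_elt K c) \/ exists a, g = cyc_deriv a W]%classic.

End CyclicDerivatives.

(** * The truncated Jacobian algebra and the opposite quiver *)

Section SurjectiveImages.
Variables (A B : pzRingType) (pi : {rmorphism A -> B}).
Hypothesis pi_surj : forall y, exists x, pi x = y.
Implicit Types (S I J : set A).

Lemma image_is_ideal I : is_ideal I -> is_ideal (pi @` I)%classic.
Proof.
move=> II; apply: is_ideal_mk.
- by exists 0; rewrite ?rmorph0 //; exact: is_ideal0.
- move=> _ _ [x Ix <-] [y Iy <-]; exists (x + y); last by rewrite rmorphD.
  exact: is_idealD.
- move=> b _ [x Ix <-]; have [a <-] := pi_surj b; exists (a * x); last by rewrite rmorphM.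
  exact: is_idealMl.
- move=> b _ [x Ix <-]; have [a <-] := pi_surj b; exists (x * a); last by rewrite rmorphM.
  exact: is_idealMr.
Qed.

Lemma preimage_is_ideal (I : set B) : is_ideal I -> is_ideal (pi @^-1` I)%classic.
Proof.
move=> II; apply: is_ideal_mk; rewrite /preimage /=.
- by rewrite rmorph0; exact: is_ideal0.
- by move=> x y Ix Iy; rewrite rmorphD; exact: is_idealD.
- by move=> a x Ix; rewrite rmorphM; exact: is_idealMl.
- by move=> a x Ix; rewrite rmorphM; exact: is_idealMr.
Qed.

Lemma image_ideal_gen S y :
  ideal_gen (pi @` S)%classic y <-> exists2 x, ideal_gen S x & pi x = y.
Proof.
split=> [|[x Sx <-]].
  move=> /(_ (pi @` (ideal_gen S))%classic); apply.
    exact/image_is_ideal/ideal_gen_is_ideal.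
  by move=> _ [x Sx <-]; exists x => //; exact: sub_ideal_gen.
apply: (Sx (pi @^-1` (ideal_gen (pi @` S)))%classic).
  exact/preimage_is_ideal/ideal_gen_is_ideal.
by move=> z Sz; apply: sub_ideal_gen; exists z.
Qed.

Lemma image_ideal_exp J n y :
  ideal_exp (pi @` J)%classic n y <-> exists2 x, ideal_exp J n x & pi x = y.
Proof.
elim: n y => [|n IHn] y; first by split=> // _; have [x] := pi_surj y; exists x.
rewrite /= /ideal_mul -image_ideal_gen; suff -> :
    [set z | exists x y, [/\ ideal_exp (pi @` J) n x, (pi @` J) y & z = x * y]]%classic =
    (pi @` [set z | exists x y, [/\ ideal_exp J n x, J y & z = x * y]])%classic by [].
apply/seteqP; split.
  move=> _ [_ [_ [/IHn [x Jx <-] [z Jz <-] ->]]].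
  by exists (x * z); rewrite ?rmorphM //; exists x, z.
move=> _ [_ [x [z [Jx Jz ->]]] <-].
by exists (pi x), (pi z); rewrite rmorphM; split=> //; apply/IHn; exists x.
Qed.

End SurjectiveImages.

Section TruncatedJacobian.
Variables (K : fieldType) (Q : quiver) (W : cpath K Q) (C : {set arrow Q}).
Local Notation L := (cpath K Q).
Local Notation A := (truncated_jacobian W C).

Definition trpi : L -> A := @qpi _ (truncation_ideal W C) \o @qpi _ (jacobian_ideal W).
HB.instance Definition _ := GRing.RMorphism.on trpi.

Lemma trpiE f : trpi f = truncated_pi W C f. Proof. by []. Qed.

Lemma trpi_surj y : exists f, trpi f = y.
Proof. by elim/quotP: y => y; elim/quotP: y => f; exists f. Qed.

Lemma trpi_scal k : trpi (cscal k) = kscal A k. Proof. by []. Qed.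

(** The two closures, in the path algebra and then in its quotient, amount to one, because the
    quotient carries the quotient topology. *)
Lemma trpi_ker f : trpi f = 0 <-> cl (relset W C) f.
Proof.
pose pi : {rmorphism L -> jacobian_alg W} := @qpi _ (jacobian_ideal W).
have piS y : exists f, pi f = y by elim/quotP: y => g; exists g.
have piJ g : pi g = 0 <-> cl [set cyc_deriv a W | a in setT]%classic g.
  by rewrite clE -[X in ideal_set _ X]subr0 -qpi_eq -[qpi _ 0]/(pi 0) rmorph0.
have -> : (trpi f = 0) = (ideal_set (truncation_ideal W C) (pi f)).
  rewrite -[pi f]subr0; apply/propext; rewrite -qpi_eq.
  by rewrite -[qpi _ 0]/(0 : quot (truncation_ideal W C)).
set S0 : set L := [set arrow_elt K c | c in [set` C]]%classic.
have -> : ideal_set (truncation_ideal W C) =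
    adic_closure (pi @` @jacobson L)%classic (ideal_gen (pi @` S0)%classic).
  rewrite /truncation_ideal /= ; congr (adic_closure _ (ideal_gen _)).
  apply/seteqP; split=> [_ [c Cc <-]|_ [_ [c Cc <-] <-]]; last by exists c.
  by exists (arrow_elt K c) => //; exists c.
split=> H n.
  have [_ /(image_ideal_gen piS) [g Sg <-] /(image_ideal_exp piS) [h oh he]] := H n.
  have /piJ /(_ n) [d Sd od] : pi (f - g - h) = 0.
    by rewrite rmorphB he rmorphB subrr.
  exists (g + d).
    apply: (is_idealD (I := ideal_gen (relset W C))); first exact: ideal_gen_is_ideal.
      apply: (Sg (ideal_gen (relset W C))); first exact: ideal_gen_is_ideal.
      by move=> _ [c Cc <-]; apply: sub_ideal_gen; left; exists c.
    apply: (Sd (ideal_gen (relset W C))); first exact: ideal_gen_is_ideal.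
    by move=> _ [a _ <-]; apply: sub_ideal_gen; right; exists a.
  have -> : f - (g + d) = (f - g - h - d) + h.
    by rewrite opprD addrA -[RHS]addrA [- d + h]addrC addrA subrK.
  by apply: ordD => //; apply/ideal_expE.
have [g Sg og] := H n; exists (pi g); last first.
  by rewrite -rmorphB; apply/(image_ideal_exp piS); exists (f - g) => //; apply/ideal_expE.
apply: (Sg (pi @^-1` (ideal_gen (pi @` S0)))%classic).
  exact/preimage_is_ideal/ideal_gen_is_ideal.
move=> h [[c Cc ->]|[a ->]].
  by apply/(image_ideal_gen piS); exists (arrow_elt K c) => //; apply: sub_ideal_gen; exists c.
rewrite /preimage /= ; have -> : pi (cyc_deriv a W) = 0.
  by apply/piJ/sub_cl; exists a.
exact: (is_ideal0 (ideal_gen_is_ideal _)).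
Qed.

End TruncatedJacobian.

(** A map under which ideals pull back to ideals, and which does not shorten paths,
    preserves membership in closed ideals. *)
Lemma cl_map (K : fieldType) (Q Q' : quiver) (phi : cpath K Q -> cpath K Q') S T f :
  (forall I, is_ideal I -> is_ideal (phi @^-1` I)%classic) ->
  (forall f g, phi (f - g) = phi f - phi g) ->
  (forall n f, ord n f -> ord n (phi f)) ->
  (forall g, S g -> cl T (phi g)) -> cl S f -> cl T (phi f).
Proof.
move=> phiI phiB phio ST Sf; apply: cl_closed => n; have [g Sg og] := Sf n.
exists (phi g); last by rewrite -phiB; exact: phio.
exact: (Sg _ (phiI _ (cl_ideal T))).
Qed.

(** The minimality of the relations, inside the path algebra of the whole quiver. *)
Definition min_rel (K : fieldType) (Q : quiver) (W : cpath K Q) (C : {set arrow Q}) :=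
  forall c, c \in C -> ~ cl [set g | (exists2 b, b \in C & g = arrow_elt K b) \/
    (exists2 b, b \in C & b != c /\ g = cyc_deriv b W)]%classic (cyc_deriv c W).

Section CutQuiver.
Variables (K : fieldType) (Q : quiver) (W : cpath K Q) (C : {set arrow Q}).
Local Notation tau := (@to_cut_quiver K Q C).

Lemma is_walk_cut x (s : seq (arrow (cut_quiver C))) :
  is_walk x s = @is_walk Q x (map val s).
Proof. by elim: s x => //= a s IHs x; rewrite IHs. Qed.

Lemma walk_end_cut x (s : seq (arrow (cut_quiver C))) :
  walk_end x s = @walk_end Q x (map val s).
Proof. by rewrite /walk_end -map_comp. Qed.

Lemma pcoef_tau f x s : pcoef (tau f) x s = pcoef f x (map val s).
Proof.
have [xs|xs] := boolP (is_walk x s); first by rewrite pcoefE.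
by rewrite !pcoef_out -?is_walk_cut.
Qed.

Lemma tauB f g : tau (f - g) = tau f - tau g.
Proof. by apply: cpathP => x s; rewrite pcoefB !pcoef_tau pcoefB. Qed.

Lemma tauM f g : tau (f * g) = tau f * tau g.
Proof.
apply: cpathP => x s; rewrite pcoef_tau !pcoef_mul size_map.
by apply: eq_bigr => i _; rewrite !pcoef_tau map_take map_drop walk_end_cut map_take.
Qed.

Lemma tau_preimage I : is_ideal I -> is_ideal (tau @^-1` I)%classic.
Proof.
have tau0 : tau 0 = 0 by rewrite -(subrr (0 : cpath K Q)) tauB subrr.
move=> II; apply: is_ideal_mk; rewrite /preimage /=.
- by rewrite tau0; exact: is_ideal0.
- move=> x y Ix Iy; rewrite -[y]opprK -[- y]sub0r !tauB tau0 sub0r opprK.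
  exact: is_idealD.
- by move=> a x Ix; rewrite tauM; exact: is_idealMl.
- by move=> a x Ix; rewrite tauM; exact: is_idealMr.
Qed.

Lemma tau_ord n f : ord n f -> ord n (tau f).
Proof. by move=> of_ x s sn; rewrite pcoef_tau of_ // size_map. Qed.

Lemma tau_arrow b : b \in C -> tau (arrow_elt K b) = 0.
Proof.
move=> bC; apply: cpathP => x s; rewrite pcoef0 pcoef_tau pcoef_arrow.
case: s => [|a [|c s]]; rewrite ?andbF //=; last by rewrite eqseq_cons !andbF.
have /negPf -> : [:: val a] != [:: b].
  by rewrite eqseq_cons andbT; apply: contraNneq (valP a) => ->.
by rewrite andbF.
Qed.

Lemma cut_relation_idealE (B : {set arrow Q}) : cut_relation_ideal W C B =
  cl [set tau (cyc_deriv c W) | c in [set` B]]%classic :> set _.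
Proof. by rewrite clE. Qed.

(** Restriction to the paths without cut arrows maps a closed ideal of the whole path algebra,
    generated by the cut arrows and some relations, to the one generated by these relations. *)
Lemma minimal_min_rel : minimal_cut_relations W C -> min_rel W C.
Proof.
move=> minW c cC Hc; apply: (minW (C :\ c)%SET).
  by rewrite properE subsetDl; apply/subsetPn; exists c; rewrite // !inE eqxx.
rewrite !cut_relation_idealE; apply/seteqP; split=> f; apply: cl_sub.
  move=> _ [b /= bC <-]; apply: sub_cl; exists b => //.
  by move: bC; rewrite !inE => /andP[].
move=> _ [b /= bC <-]; have [->|bc] := eqVneq b c; last first.
  by apply: sub_cl; exists b => //=; rewrite !inE bc.
apply: (cl_map tau_preimage tauB tau_ord) Hc => g [[d dC ->]|[d dC [dc ->]]].
  by rewrite tau_arrow //; exact: (is_ideal0 (cl_ideal _)).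
by apply: sub_cl; exists d => //=; rewrite !inE dc.
Qed.

End CutQuiver.

Definition opq (Q : quiver) : quiver := Quiver (@tgt Q) (@src Q).

Section OppositeQuiver.
Variables (K : fieldType) (Q : quiver).
Local Notation L := (cpath K Q).
Local Notation L' := (cpath K (opq Q)).
Implicit Types (f : L) (g : L').

(** Reversal of paths, an anti-isomorphism between the path algebras of [Q] and of its
    opposite quiver. *)
Definition rv f : L' := fun p =>
  pcoef f (@walk_end (opq Q) (val p).1 (val p).2) (rev (val p).2).

Definition vr g : L := fun p =>
  pcoef g (@walk_end Q (val p).1 (val p).2) (rev (val p).2).

Lemma walk_end_rcons (R : quiver) (x : vertex R) s a : walk_end x (rcons s a) = tgt a.
Proof. by rewrite /walk_end map_rcons last_rcons. Qed.

Lemma is_walk_rcons (R : quiver) (x : vertex R) s a :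
  is_walk x (rcons s a) = is_walk x s && (src a == walk_end x s).
Proof. by rewrite -cats1 is_walk_cat /= andbT. Qed.

Lemma walk_rev_op (x : vertex Q) s : @is_walk (opq Q) x s ->
  @is_walk Q (@walk_end (opq Q) x s) (rev s) /\
  @walk_end Q (@walk_end (opq Q) x s) (rev s) = x.
Proof.
elim: s x => //= a s IHs x /andP[/eqP <- /IHs [w e]].
rewrite rev_cons is_walk_rcons walk_end_rcons.
by split=> //; rewrite {1}/walk_end /= -/(walk_end _ _) w e eqxx.
Qed.

Lemma walk_rev (x : vertex Q) s : @is_walk Q x s ->
  @is_walk (opq Q) (@walk_end Q x s) (rev s) /\
  @walk_end (opq Q) (@walk_end Q x s) (rev s) = x.
Proof.
elim: s x => //= a s IHs x /andP[/eqP <- /IHs [w e]].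
rewrite rev_cons is_walk_rcons (@walk_end_rcons (opq Q)).
by split=> //; rewrite {1}/walk_end /= -/(walk_end _ _) w e eqxx.
Qed.

Lemma pcoef_rv f x s : @is_walk (opq Q) x s ->
  pcoef (rv f) x s = pcoef f (@walk_end (opq Q) x s) (rev s).
Proof. by move=> w; rewrite pcoefE. Qed.

Lemma pcoef_vr g x s : @is_walk Q x s ->
  pcoef (vr g) x s = pcoef g (@walk_end Q x s) (rev s).
Proof. by move=> w; rewrite pcoefE. Qed.

Lemma cpath_walkP (R : quiver) (f g : cpath K R) :
  (forall x s, is_walk x s -> pcoef f x s = pcoef g x s) -> f = g.
Proof.
move=> fg; apply: cpathP => x s; have [/fg //|w] := boolP (is_walk x s).
by rewrite !pcoef_out.
Qed.

Lemma rvK : cancel rv vr.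
Proof.
move=> f; apply: cpath_walkP => x s w; rewrite pcoef_vr //.
by have [w' e] := walk_rev w; rewrite pcoef_rv // e revK.
Qed.

Lemma vrK : cancel vr rv.
Proof.
move=> f; apply: cpath_walkP => x s w; rewrite pcoef_rv //.
by have [w' e] := walk_rev_op w; rewrite pcoef_vr // e revK.
Qed.

Lemma rvB f h : rv (f - h) = rv f - rv h.
Proof. by apply: cpath_walkP => x s w; rewrite pcoefB !pcoef_rv // pcoefB. Qed.

Lemma rvM f h : rv (f * h) = rv h * rv f.
Proof.
apply: cpath_walkP => x s w; rewrite pcoef_rv // !pcoef_mul size_rev.
rewrite [RHS](reindex_inj rev_ord_inj) /=; apply: eq_bigr => i _; rewrite subSS.
rewrite take_rev drop_rev; move: (take _ s) (drop _ s) (cat_take_drop (size s - i) s) => p q sE.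
move: w; rewrite -sE is_walk_cat => /andP[w1 w2].
rewrite !pcoef_rv // mulrC.
have -> : @walk_end (opq Q) x (p ++ q) = @walk_end (opq Q) (@walk_end (opq Q) x p) q.
  by rewrite /walk_end map_cat last_cat.
by have [_ ->] := walk_rev_op w2.
Qed.

Lemma rv_ord n f : ord n f -> ord n (rv f).
Proof.
move=> of_ x s sn; have [w|w] := boolP (@is_walk (opq Q) x s); last by rewrite pcoef_out.
by rewrite pcoef_rv // of_ // size_rev.
Qed.

Lemma vrB g h : vr (g - h) = vr g - vr h.
Proof. by apply: (can_inj rvK); rewrite rvB !vrK. Qed.

Lemma vrM g h : vr (g * h) = vr h * vr g.
Proof. by apply: (can_inj rvK); rewrite rvM !vrK. Qed.

Lemma vr_ord n g : ord n g -> ord n (vr g).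
Proof.
move=> og x s sn; have [w|w] := boolP (@is_walk Q x s); last by rewrite pcoef_out.
by rewrite pcoef_vr // og // size_rev.
Qed.

Lemma rv_arrow a : rv (arrow_elt K a) = @arrow_elt K (opq Q) a.
Proof.
apply: cpath_walkP => x s w; rewrite pcoef_rv // !pcoef_arrow /=.
have -> : (rev s == [:: a]) = (s == [:: a]) by rewrite (can2_eq revK revK).
have [sE|] := eqVneq s [:: a]; last by rewrite !andbF.
by move: w; rewrite sE /= /walk_end /= !eqxx !andbT eq_sym => ->.
Qed.

Lemma rv_vtx x : rv (vtx x) = @vtx K (opq Q) x.
Proof.
apply: cpath_walkP => y s w; rewrite pcoef_rv // !pcoef_vtx.
by case: s w => [|a s] //= _; rewrite rev_cons -size_eq0 size_rcons !andbF.
Qed.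

Lemma rv_cscal k : rv (cscal k) = @cscal K (opq Q) k.
Proof.
apply: cpath_walkP => y s w; rewrite pcoef_rv // !pcoef_cscal.
by rewrite -!size_eq0 size_rev.
Qed.

Lemma rv1 : rv 1 = 1.
Proof. by rewrite -cscal1 rv_cscal cscal1. Qed.

Lemma hcoef_rv W s : hcoef (rv W) s = hcoef W (rev s).
Proof.
case/lastP: s => [//|s a]; rewrite rev_rcons /hcoef.
case E : (rcons s a) => [|b t]; first by move/eqP: E; rewrite -size_eq0 size_rcons.
have [w|w] := boolP (@is_walk (opq Q) (@src (opq Q) b) (b :: t)).
  rewrite pcoef_rv //; apply: (f_equal2 (pcoef W)); rewrite -E; last exact: (rev_rcons s a).
  exact: (@walk_end_rcons (opq Q)).
rewrite pcoef_out // pcoef_out //; apply: contra w => w.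
have [] := walk_rev w; rewrite -[in rev (a :: rev s)]rev_rcons revK E => w'.
by rewrite {1}/walk_end map_cons /= => e; move: w' => /= /andP[_ ->]; rewrite eqxx.
Qed.

Lemma cyc_rv W s : cyc (rv W) s = cyc W (rev s).
Proof.
rewrite /cyc -[RHS]sum_rotr size_rev; apply: eq_bigr => i _.
by rewrite hcoef_rv rev_rot.
Qed.

(** A cycle and its reversal have the same rotations, reversed. *)
Lemma rv_deriv a W : rv (cyc_deriv a W) = @cyc_deriv K (opq Q) a (rv W).
Proof.
apply: cpath_walkP => x s w; rewrite pcoef_rv // !pcoef_deriv /=.
have [w' e] := walk_rev_op w.
have cE : cyc (rv W) (a :: s) = cyc W (a :: rev s).
  by rewrite cyc_rv rev_cons -rot1_cons cyc_rot.
rewrite cE -/(cycle _ (a :: rev s)) -/(cycle _ (a :: s)) !adj_cycle.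
have -> : (@walk_end (opq Q) x s == tgt a) && (@is_walk Q (tgt a) (rev s) &&
    (@walk_end Q (tgt a) (rev s) == src a)) = (@walk_end (opq Q) x s == tgt a) && (x == src a).
  by have [<-|//] := eqVneq (@walk_end (opq Q) x s) (tgt a); rewrite w' e.
congr (if _ then _ else _); rewrite andbC -[src a]/(@tgt (opq Q) a).
have -> : cycle (@adj (opq Q)) (a :: s) = _ := @adj_cycle (opq Q) a s.
by have [<-|//] := eqVneq x (@tgt (opq Q) a); rewrite w.
Qed.

Lemma rv_preimage_is_ideal (I : set L') : is_ideal I -> is_ideal (rv @^-1` I)%classic.
Proof.
have rv0 : rv 0 = 0 by rewrite -(subrr (0 : L)) rvB subrr.
move=> II; apply: is_ideal_mk; rewrite /preimage /=.
- by rewrite rv0; exact: is_ideal0.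
- move=> x y Ix Iy; rewrite -[y]opprK -[- y]sub0r !rvB rv0 sub0r opprK.
  exact: is_idealD.
- by move=> a x Ix; rewrite rvM; exact: is_idealMr.
- by move=> a x Ix; rewrite rvM; exact: is_idealMl.
Qed.

End OppositeQuiver.

Section OppositeRelations.
Variables (K : fieldType) (Q : quiver) (W : cpath K Q) (C : {set arrow Q}).

Lemma vr_preimage_is_ideal (I : set (cpath K Q)) : is_ideal I ->
  is_ideal (@vr K Q @^-1` I)%classic.
Proof.
have vr0 : @vr K Q 0 = 0 by rewrite -(subrr (0 : cpath K (opq Q))) vrB subrr.
move=> II; apply: is_ideal_mk; rewrite /preimage /=.
- by rewrite vr0; exact: is_ideal0.
- move=> x y Ix Iy; rewrite -[y]opprK -[- y]sub0r !vrB vr0 sub0r opprK.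
  exact: is_idealD.
- by move=> a x Ix; rewrite vrM; exact: is_idealMr.
- by move=> a x Ix; rewrite vrM; exact: is_idealMl.
Qed.

Lemma cl_relset_op (D : {set arrow Q}) g :
  cl (relset W D) (vr g) <-> cl (@relset K (opq Q) (rv W) D) g.
Proof.
split=> H.
  rewrite -[g]vrK.
  apply: (cl_map (@rv_preimage_is_ideal K Q) (@rvB K Q) (@rv_ord K Q)) H => f.
  case=> [[c cD ->]|[a ->]]; apply: sub_cl; last by right; exists a; rewrite rv_deriv.
  by left; exists c => //; exact: rv_arrow.
apply: (cl_map vr_preimage_is_ideal (@vrB K Q) (@vr_ord K Q)) H => f.
case=> [[c cD ->]|[a ->]]; apply: sub_cl; last first.
  by right; exists a; apply: (can_inj (@rvK K Q)); rewrite vrK rv_deriv.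
by left; exists c => //; apply: (can_inj (@rvK K Q)); rewrite vrK rv_arrow.
Qed.

Lemma min_rel_op : min_rel W C -> @min_rel K (opq Q) (rv W) C.
Proof.
move=> minW c cC Hc; apply: (minW c cC).
rewrite -[@cyc_deriv K Q c W]rvK rv_deriv.
apply: (cl_map vr_preimage_is_ideal (@vrB K Q) (@vr_ord K Q)) Hc => f.
case=> [[b bC ->]|[b bC [bc ->]]]; apply: sub_cl; [left|right]; exists b => //.
  by apply: (can_inj (@rvK K Q)); rewrite vrK rv_arrow.
by split=> //; apply: (can_inj (@rvK K Q)); rewrite vrK rv_deriv.
Qed.

End OppositeRelations.

(** * A source of the quiver without the cut arrows *)

Section Source.
Variables (K : fieldType) (Q : quiver) (W : cpath K Q) (C : {set arrow Q}) (x : vertex Q).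
Local Notation L := (cpath K Q).
Implicit Types (f g h : L) (y : vertex Q) (s t : seq (arrow Q)) (a b c : arrow Q).

Hypothesis oW : ord 2 W.
Hypothesis homW : forall y s, pcoef W y s != 0 -> count (mem C) s = 1%N.
Hypothesis minW : min_rel W C.
Hypothesis srcx : forall a, tgt a = x -> a \in C.

Local Notation I := (cl (relset W C)).

Let II : is_ideal I. Proof. exact: cl_ideal. Qed.

Lemma cyc_supp s : cyc W s != 0 -> count (mem C) s = 1%N /\ (1 < size s)%N.
Proof.
move=> cs; have [i ci] : exists i : 'I_(size s), hcoef W (rot i s) != 0.
  apply/existsP; apply: contraNT cs => /existsPn cs; rewrite /cyc big1 // => i _.
  by apply/eqP/negPn/cs.
have : count (mem C) (rot i s) = count (mem C) s by apply/permP/permEl/perm_rot.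
have : size (rot i s) = size s by rewrite size_rot.
case: (rot i s) ci => [|b t] /=; first by rewrite eqxx.
move=> bt <- <-; split; first exact: homW bt.
by rewrite ltnNge; apply: contra bt => st; rewrite oW.
Qed.

Lemma deriv_supp a y s : pcoef (cyc_deriv a W) y s != 0 ->
  [/\ y = tgt a, is_walk y s, walk_end y s = src a, s != [::]
    & ((a \in C) + count (mem C) s = 1)%N].
Proof.
rewrite pcoef_deriv; case: ifP => [/andP[/eqP ->]|]; last by rewrite eqxx.
rewrite adj_cycle => /andP[w /eqP e] /cyc_supp [cs sz].
by split=> //; case: s sz {w e cs}.
Qed.

Lemma walk_end_x y s : walk_end y s = x -> s != [::] -> (0 < count (mem C) s)%N.
Proof.
case/lastP: s => // s a; rewrite walk_end_rcons => /srcx aC _.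
by rewrite -cats1 count_cat /= aC addnC.
Qed.

(** The paths in the derivative along a cut arrow starting at [x] would end at [x], so they
    would contain a second cut arrow; the derivative would vanish, against minimality. *)
Lemma src_cut c : c \in C -> src c != x.
Proof.
move=> cC; apply/eqP => cx; apply: (minW cC).
suff -> : cyc_deriv c W = 0 by exact: (is_ideal0 (cl_ideal _)).
apply: cpathP => y s; rewrite pcoef0; apply/eqP; apply: contraT => /deriv_supp.
by case=> _ _; rewrite cx cC => /walk_end_x H /H; case: count.
Qed.

Lemma tgt_out a : src a = x -> tgt a != x.
Proof. by move=> ax; apply/eqP => /srcx /src_cut; rewrite ax eqxx. Qed.

Lemma src_in c : tgt c = x -> src c != x.
Proof. by move=> /srcx /src_cut. Qed.

Lemma out_notin a : src a = x -> a \notin C.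
Proof. by move=> ax; apply: contraTN isT => /src_cut; rewrite ax eqxx. Qed.

Lemma I_supp f : (forall y s, ~~ has (mem C) s -> pcoef f y s = 0) -> I f.
Proof.
move=> fs; apply: (cl_supp (X := mem C)) => // a aC; left; exists a => //.
Qed.

Definition avoids y s := (y != x) && all (fun a => tgt a != x) s.

Lemma avd_cat y s t : avoids y (s ++ t) = avoids y s && avoids (walk_end y s) t.
Proof.
rewrite /avoids all_cat -!andbA; case: (boolP (y != x)) => //= yx.
case: (boolP (all _ s)) => //=; case/lastP: s => [|s a]; first by rewrite yx.
by rewrite walk_end_rcons all_rcons => /andP[-> _].
Qed.

(** Deleting the paths through [x] is multiplicative; by [av_corner] it represents the corner
    of the quotient at the idempotent [1 - vtx x]. *)
Definition avoiding f : L := fun p => ((avoids (val p).1 (val p).2)%:R : K) * f p.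

Lemma pcoef_av f y s : pcoef (avoiding f) y s = (avoids y s)%:R * pcoef f y s.
Proof.
have [w|w] := boolP (is_walk y s); first by rewrite !pcoefE.
by rewrite !pcoef_out ?mulr0.
Qed.

Lemma avB f g : avoiding (f - g) = avoiding f - avoiding g.
Proof. by apply: cpathP => y s; rewrite pcoefB !pcoef_av pcoefB mulrBr. Qed.

Lemma av0 : avoiding 0 = 0.
Proof. by have := avB 0 0; rewrite !subrr. Qed.

Lemma avD f g : avoiding (f + g) = avoiding f + avoiding g.
Proof. by apply: cpathP => y s; rewrite pcoefD !pcoef_av pcoefD mulrDr. Qed.

Lemma av_sum (T : Type) (l : seq T) (P : pred T) (F : T -> L) :
  avoiding (\sum_(i <- l | P i) F i) = \sum_(i <- l | P i) avoiding (F i).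
Proof. by apply: (big_morph avoiding) => [f g|]; rewrite (avD, av0). Qed.

Lemma avM f g : avoiding (f * g) = avoiding f * avoiding g.
Proof.
apply: cpathP => y s; rewrite pcoef_av !pcoef_mul mulr_sumr.
apply: eq_bigr => i _; rewrite !pcoef_av mulrACA -natrM mulnb.
by rewrite -avd_cat cat_take_drop.
Qed.

Lemma av_ord n f : ord n f -> ord n (avoiding f).
Proof. by move=> of_ y s sn; rewrite pcoef_av of_ ?mulr0. Qed.

Lemma av_id f : (forall y s, pcoef f y s != 0 -> avoids y s) -> avoiding f = f.
Proof.
move=> H; apply: cpathP => y s; rewrite pcoef_av.
by have [->|/H ->] := eqVneq (pcoef f y s) 0; rewrite ?mulr0 ?mul1r.
Qed.

Lemma av_av f : avoiding (avoiding f) = avoiding f.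
Proof.
by apply: av_id => y s; rewrite pcoef_av; case: avoids => //; rewrite mul0r eqxx.
Qed.

Lemma avd_noC y s : y != x -> count (mem C) s = 0%N -> avoids y s.
Proof.
move=> yx sC; rewrite /avoids yx /=; apply/allP => a sa; apply/eqP => /srcx aC.
by have : has (mem C) s; [apply/hasP; exists a | rewrite has_count sC].
Qed.

Lemma av_supp f : (forall y s, ~~ has (mem C) s -> pcoef f y s = 0) -> I (avoiding f).
Proof. by move=> fs; apply: I_supp => y s sC; rewrite pcoef_av fs // mulr0. Qed.

Local Notation D c := (cyc_deriv c W).

Lemma D_I a : I (D a).
Proof. by apply: sub_cl; right; exists a. Qed.

Lemma D_cut0 a y s : a \notin C -> ~~ has (mem C) s -> pcoef (D a) y s = 0.
Proof.
move=> aC; rewrite has_count -eqn0Ngt => /eqP sC; apply/eqP; apply: contraT.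
by move=> /deriv_supp [_ _ _ _]; rewrite (negPf aC) sC.
Qed.

Lemma D_count c y s : c \in C -> pcoef (D c) y s != 0 -> count (mem C) s = 0%N.
Proof. by move=> cC /deriv_supp [_ _ _ _]; rewrite cC => -[]. Qed.

Lemma D_av c : c \in C -> tgt c != x -> avoiding (D c) = D c.
Proof.
move=> cC cx; apply: av_id => y s H; apply: avd_noC (D_count cC H).
by have [-> _ _ _ _] := deriv_supp H.
Qed.

Lemma D_av0 c : tgt c = x -> avoiding (D c) = 0.
Proof.
move=> cx; apply: cpathP => y s; rewrite pcoef_av pcoef0.
have [->|] := eqVneq (pcoef (D c) y s) 0; first by rewrite mulr0.
by case/deriv_supp => -> _ _ _ _; rewrite /avoids cx eqxx mul0r.
Qed.

Lemma D_nil a : pcoef (D a) x [::] = 0.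
Proof. by apply: (ord_deriv a oW). Qed.

(** The relations at the source: by [D_in] and [D_out] the same matrix gives the derivatives
    along the arrows ending at [x], with its columns, and along those starting at [x], with
    its rows.  All families are extended by zero to the whole set of arrows, so that sums and
    matrices have one index type. *)
Definition rel_entry a c : L := if (src a == x) && (tgt c == x) then ldiv a (D c) else 0.
Definition in_vtx c : L := if tgt c == x then vtx (src c) else 0.
Definition out_vtx a : L := if src a == x then vtx (tgt a) else 0.
Definition out_arrow a : L := if src a == x then arrow_elt K a else 0.

Lemma r_supp a c y s : pcoef (rel_entry a c) y s != 0 ->
  [/\ src a = x, tgt c = x, y = tgt a, walk_end y s = src c & count (mem C) s = 0%N].
Proof.
rewrite /rel_entry; case: ifP => [/andP[/eqP ax /eqP cx]|]; last by rewrite pcoef0 eqxx.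
rewrite pcoef_ldiv; have [->|_] := eqVneq y (tgt a); last by rewrite mul0r eqxx.
rewrite mul1r => /deriv_supp [_ _ e _]; rewrite srcx // /= (negPf (out_notin ax)).
by case=> sC; split.
Qed.

Lemma r_av a c : avoiding (rel_entry a c) = rel_entry a c.
Proof.
apply: av_id => y s /r_supp [ax cx -> _ sC]; apply: avd_noC => //.
exact: tgt_out.
Qed.

Lemma yv_r a c : out_vtx a * rel_entry a c = rel_entry a c.
Proof.
apply: cpathP => y s; have [E|nz] := eqVneq (pcoef (rel_entry a c) y s) 0.
  by rewrite E /out_vtx; case: ifP => _; rewrite ?pcoef_vtxl ?E ?mulr0 // mul0r pcoef0.
have [ax _ yE _ _] := r_supp nz.
by rewrite /out_vtx ax eqxx pcoef_vtxl yE eqxx mul1r.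
Qed.

Lemma r_z a c : rel_entry a c * in_vtx c = rel_entry a c.
Proof.
apply: cpathP => y s; have [E|nz] := eqVneq (pcoef (rel_entry a c) y s) 0.
  by rewrite E /in_vtx; case: ifP => _; rewrite ?pcoef_vtxr ?E ?mulr0 // pcoef0.
have [_ cx _ e _] := r_supp nz.
by rewrite /in_vtx cx eqxx pcoef_vtxr e eqxx mul1r.
Qed.

Lemma D_in c : tgt c = x -> D c = \sum_a out_arrow a * rel_entry a c.
Proof.
move=> cx; rewrite [LHS]ldivE big1 => [|y _].
  rewrite add0r; apply: eq_bigr => a _; rewrite /out_arrow /rel_entry cx eqxx andbT.
  case: eqP => // /eqP ax; rewrite mul0r; suff -> : ldiv a (D c) = 0 by rewrite mulr0.
  apply: cpathP => y s; rewrite pcoef0 pcoef_ldiv.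
  have [->|] := eqVneq (pcoef (D c) (src a) (a :: s)) 0; first by rewrite mulr0.
  by case/deriv_supp => aE _ _ _ _; rewrite aE cx eqxx in ax.
by rewrite (ord_deriv c oW) // cscal0 mul0r.
Qed.

(** By rotation: the cycles of [W] through [a] pass from an arrow [c] ending at [x] directly
    to [a]. *)
Lemma D_out a : src a = x -> D a = \sum_c rel_entry a c * arrow_elt K c.
Proof.
move=> ax; rewrite [LHS]rdivE big1 => [|y _].
  rewrite add0r; apply: eq_bigr => c _; congr (_ * _).
  apply: cpathP => y s; rewrite pcoef_rdiv /rel_entry ax eqxx /= pcoef_deriv -/(cycle _ (a :: rcons s c)).
  have -> : cycle (@adj Q) (a :: rcons s c) = cycle (@adj Q) (c :: a :: s).
    by rewrite -rcons_cons -rot1_cons rot_cycle.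
  have -> : cyc W (a :: rcons s c) = cyc W (c :: a :: s).
    by rewrite -rcons_cons -rot1_cons cyc_rot.
  have [cx|cx] := eqVneq (tgt c) x; last first.
    rewrite pcoef0 [cycle _ _]adj_cycle /= ax [x == _]eq_sym (negPf cx) andbF //.
  by rewrite pcoef_ldiv pcoef_deriv ax cx eqxx /=; case: (y == _); rewrite ?mul1r ?mul0r.
by rewrite (ord_deriv a oW) // cscal0 mul0r.
Qed.

Lemma I_scal k f : I f -> I (cscal k * f).
Proof. exact: is_idealMl. Qed.

(** A nontrivial path ending at [x] contains a cut arrow. *)
Lemma vtx_x_r f : I (f * vtx x - cscal (pcoef f x [::]) * vtx x).
Proof.
apply: I_supp => y s sC; rewrite pcoefB pcoef_scal pcoef_vtx pcoef_vtxr.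
have [s0|s0] := eqVneq s [::].
  rewrite s0 /walk_end /= andbT; have [->|_] := eqVneq y x; first by rewrite mulr1 mul1r subrr.
  by rewrite mul0r mulr0 subrr.
rewrite andbF mulr0 subr0; case: eqP => [e|]; last by rewrite mul0r.
by have := walk_end_x e s0; rewrite -has_count (negPf sC).
Qed.

Lemma pcoef_covtxl f y s : pcoef ((1 - vtx x) * f) y s = (y != x)%:R * pcoef f y s.
Proof.
by rewrite mulrBl mul1r pcoefB pcoef_vtxl; case: eqP; rewrite !(mul1r, mul0r) ?(subrr, subr0).
Qed.

Lemma pcoef_covtxr f y s :
  pcoef (f * (1 - vtx x)) y s = (walk_end y s != x)%:R * pcoef f y s.
Proof.
by rewrite mulrBr mulr1 pcoefB pcoef_vtxr; case: eqP; rewrite !(mul1r, mul0r) ?(subrr, subr0).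
Qed.

Lemma av_corner f : I ((1 - vtx x) * f * (1 - vtx x) - avoiding f).
Proof.
apply: I_supp => y s sC; rewrite pcoefB pcoef_covtxr pcoef_covtxl pcoef_av.
have [->|yx] := eqVneq y x; first by rewrite /avoids eqxx /= !mul0r mulr0 subrr.
rewrite avd_noC //; last by apply/eqP; rewrite eqn0Ngt -has_count.
rewrite mul1r; case: eqP => [e|]; last by rewrite mul1r subrr.
have [s0|/(walk_end_x e)] := eqVneq s [::]; last by rewrite -has_count (negPf sC).
by move: e; rewrite s0 /walk_end /= => /eqP; rewrite (negPf yx).
Qed.

Variable N : nat.
Hypothesis hN : forall f, ord N f -> I f.

(** The statement holds for the generators and is stable under ideal operations; it passes to
    the closure because [I] contains a power of the radical. *)
Lemma I_at_source f : I f -> pcoef f x [::] = 0 /\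
  exists v : arrow Q -> L, forall a, src a = x -> I (ldiv a f - \sum_c rel_entry a c * v c).
Proof.
pose P : set L := fun f => I f /\ (pcoef f x [::] = 0 /\
  exists v : arrow Q -> L, forall a, src a = x -> I (ldiv a f - \sum_c rel_entry a c * v c)).
have ldiv0 a : ldiv a (0 : L) = 0.
  by apply: cpathP => y s; rewrite pcoef_ldiv !pcoef0 mulr0.
suff H : forall f, I f -> P f by move=> /H [].
apply: (cl_min (n := N.+1)).
- apply: is_ideal_mk.
  + split; first exact: (is_ideal0 II).
    split; first exact: pcoef0.
    exists (fun=> 0) => a _; rewrite ldiv0 big1 ?subr0 => [|c _]; last by rewrite mulr0.
    exact: (is_ideal0 II).
  + move=> g h [Ig [g0 [v vP]]] [Ih [h0 [w wP]]]; split; first exact: (is_idealD II Ig Ih).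
    split; first by rewrite pcoefD g0 h0 addr0.
    exists (fun c => v c + w c) => a ax.
    have -> : ldiv a (g + h) - \sum_c rel_entry a c * (v c + w c) =
      (ldiv a g - \sum_c rel_entry a c * v c) + (ldiv a h - \sum_c rel_entry a c * w c).
      rewrite ldivD addrACA -opprD -big_split; congr (_ - _).
      by apply: eq_bigr => c _; rewrite mulrDr.
    exact: (is_idealD II (vP a ax) (wP a ax)).
  + move=> g h [Ih [h0 [v vP]]]; split; first exact: (is_idealMl _ II Ih).
    split; first by rewrite pcoef_mul_nil h0 mulr0.
    exists (fun c => cscal (pcoef g x [::]) * v c) => a ax.
    rewrite ldivM ax -addrA; apply: (is_idealD II); first exact: (is_idealMl _ II Ih).
    have -> : \sum_c rel_entry a c * (cscal (pcoef g x [::]) * v c) =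
      cscal (pcoef g x [::]) * \sum_c rel_entry a c * v c.
      by rewrite mulr_sumr; apply: eq_bigr => c _; rewrite !mulrA cscalC.
    rewrite -mulrBr; exact: (I_scal _ (vP a ax)).
  + move=> g h [Ih [h0 [v vP]]]; split; first exact: (is_idealMr _ II Ih).
    split; first by rewrite pcoef_mul_nil h0 mul0r.
    exists (fun c => v c * g) => a ax.
    rewrite ldivM ax h0 cscal0 mul0r addr0.
    have -> : \sum_c rel_entry a c * (v c * g) = (\sum_c rel_entry a c * v c) * g.
      by rewrite mulr_suml; apply: eq_bigr => c _; rewrite mulrA.
    rewrite -mulrBl; exact: (is_idealMr _ II (vP a ax)).
- move=> _ [[b bC ->]|[b ->]].
    split; first by apply: sub_cl; left; exists b.
    split; first by rewrite pcoef_arrow andbF.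
    exists (fun=> 0) => a ax; rewrite big1 ?subr0 => [|c _]; last by rewrite mulr0.
    suff -> : ldiv a (arrow_elt K b) = 0 by exact: (is_ideal0 II).
    apply: cpathP => y s; rewrite pcoef0 pcoef_ldiv pcoef_arrow ax.
    by rewrite [x == _]eq_sym (negPf (src_cut bC)) mulr0.
  split; first exact: D_I.
  split; first exact: D_nil.
  exists (fun c => (c == b)%:R) => a ax.
  have -> : \sum_c rel_entry a c * (c == b)%:R = rel_entry a b.
    rewrite (bigD1 b) //= eqxx mulr1 big1 ?addr0 // => c /negPf ->.
    by rewrite mulr0.
  rewrite /rel_entry ax eqxx /=; case: eqP => bx; first by rewrite subrr; exact: (is_ideal0 II).
  rewrite subr0; have [bC|bC] := boolP (b \in C).
    suff -> : ldiv a (D b) = 0 by exact: (is_ideal0 II).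
    apply: cpathP => y s; rewrite pcoef0 pcoef_ldiv.
    have [->|] := eqVneq (pcoef (D b) (src a) (a :: s)) 0; first by rewrite mulr0.
    by case/deriv_supp => e _ _ _ _; case: bx; rewrite -e.
  apply: I_supp => y s sC; rewrite pcoef_ldiv D_cut0 ?mulr0 //=.
  by rewrite (negPf (out_notin ax)).
- move=> g og; split; first by apply: hN; apply: ordW og.
  split; first exact: og.
  exists (fun=> 0) => a ax; rewrite big1 ?subr0 => [|c _]; last by rewrite mulr0.
  by apply: hN; exact: ord_ldiv.
Qed.

(** Exactness, at the arrows starting at [x], of the resolution of the simple right module at
    [x]. *)
Lemma relations_at_source (u : arrow Q -> L) : I (\sum_a out_arrow a * u a) ->
  exists v : arrow Q -> L, forall a, I (out_vtx a * u a - \sum_c rel_entry a c * v c).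
Proof.
move=> /I_at_source [_ [v vP]]; exists v => a.
have [ax|ax] := eqVneq (src a) x; last first.
  rewrite /out_vtx (negPf ax) mul0r big1 ?subr0 => [|c _]; first exact: (is_ideal0 II).
  by rewrite /rel_entry (negPf ax) mul0r.
have := vP a ax; congr (I (_ - _)); apply: cpathP => y s.
rewrite pcoef_ldiv pcoef_sum (bigD1 a) //= /out_arrow /out_vtx ax eqxx big1 => [|b ba].
  rewrite addr0 pcoef_arrowl ax !eqxx mul1r pcoef_vtxl.
  by have [->|_] := eqVneq y (tgt a); rewrite ?mul0r.
case: eqP => // bx; last by rewrite mul0r pcoef0.
by rewrite pcoef_arrowl [a == b]eq_sym (negPf ba) andbF mul0r.
Qed.

Lemma idealB_sym f g : I (f - g) -> I f -> I g.
Proof. by move=> Ifg If; rewrite -[g](subKr f); exact: (is_idealB II). Qed.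

Lemma z_idem c : in_vtx c * in_vtx c = in_vtx c.
Proof.
apply: cpathP => y s; rewrite /in_vtx; case: ifP => _; last by rewrite mulr0.
by rewrite pcoef_vtxl pcoef_vtx; case: eqP; rewrite ?mul1r ?mul0r.
Qed.

Lemma yv_co a : (1 - vtx x) * out_vtx a = out_vtx a.
Proof.
apply: cpathP => y s; rewrite pcoef_covtxl /out_vtx; case: eqP => [->|_]; last by rewrite mul1r.
case: eqP => [ax|_]; last by rewrite pcoef0 mulr0.
by rewrite pcoef_vtx [x == _]eq_sym (negPf (tgt_out ax)) mul0r.
Qed.

(** In the corner at [y], the element [g] is a nonzero scalar plus a radical element. *)
Lemma corner_inverse g y : vtx y * g = g -> pcoef g y [::] != 0 ->
  exists w, g * w = vtx y.
Proof.
move=> yg g0; set k := pcoef g y [::] in g0.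
pose h := (1 - cscal k^-1 * (g + cscal k * (1 - vtx y))).
have gE v : pcoef g v [::] = (v == y)%:R * k.
  by rewrite -yg pcoef_vtxl; case: eqP => [->|]; rewrite ?mul0r ?mul1r // yg.
have oh : ord 1 h.
  apply: ord1P => v; rewrite pcoefB pcoef_one eqxx pcoef_scal pcoefD pcoef_scal pcoefB.
  rewrite pcoef_one eqxx pcoef_vtx andbT gE.
  by case: (v == y); rewrite ?mul1r ?mul0r ?subrr ?subr0 ?mulr0 ?addr0 ?add0r ?mulr1 mulVf // subrr.
have [w _ w1] := inverse_1B oh; exists (w * cscal k^-1).
have vy : vtx y * (1 - vtx y) = 0 :> L.
  apply: cpathP => v s; rewrite mulrBr mulr1 pcoefB pcoef_vtxr pcoef_vtx pcoef0.
  case: (v =P y) => [->|]; last by rewrite mulr0 subrr.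
  by case: s => [|b s]; rewrite /walk_end /= ?eqxx ?mulr1 ?mulr0 subrr.
have gw : vtx y * (1 - h) = cscal k^-1 * g.
  rewrite /h subKr mulrA -cscalC -mulrA mulrDr yg.
  by rewrite [vtx y * (_ * _)]mulrA -cscalC -mulrA vy mulr0 addr0.
by rewrite mulrA -cscalC mulrA -gw -mulrA w1 mulr1.
Qed.

(** If the relations at the source were dependent in the sense that the projection [rho] on
    their syzygies is nonzero, then either one of them could be expressed through the others,
    against their minimality, or [rho] would be an idempotent with radical entries. *)
Lemma relations_independent (rho : arrow Q -> arrow Q -> L) :
  (forall j k, in_vtx j * rho j k * in_vtx k = rho j k) ->
  (forall a k, I (\sum_j rel_entry a j * rho j k)) ->
  (forall v : arrow Q -> L, (forall j, in_vtx j * v j = v j) ->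
     (forall a, I (\sum_j rel_entry a j * v j)) -> forall j, I (\sum_k rho j k * v k - v j)) ->
  forall v : arrow Q -> L, (forall j, in_vtx j * v j = v j) ->
    (forall a, I (\sum_j rel_entry a j * v j)) -> forall j, I (v j).
Proof.
move=> rhoz rrho rhov v zv rv j.
have zrho j' k : in_vtx j' * rho j' k = rho j' k by rewrite -rhoz !mulrA z_idem.
have [orho|] := pselect (forall j k, ord 1 (rho j k)).
  suff Irho k : I (rho j k).
    apply: (idealB_sym (rhov v zv rv j)); apply: (is_ideal_sum _ II) => k _.
    exact: (is_idealMr _ II).
  (* [rho * rho = rho] modulo [I], so the entries are in all powers of the radical *)
  have H n : forall j k, exists2 g, ord n g & I (rho j k - g).
    elim: n => [|n IHn] i l; first by exists (rho i l); rewrite ?subrr //; exact: (is_ideal0 II).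
    have /choice [g gP] m : exists g, ord n g /\ I (rho m l - g).
      by have [g og Ig] := IHn m l; exists g.
    exists (\sum_m rho i m * g m).
      apply: (is_ideal_sum (I := ord n.+1)) => [|m _]; [exact: ord_ideal | rewrite -add1n].
      by apply: ordM; [exact: orho | case: (gP m)].
    have -> : rho i l - \sum_m rho i m * g m =
       \sum_m rho i m * (rho m l - g m) - (\sum_m rho i m * rho m l - rho i l).
      have -> : \sum_m rho i m * (rho m l - g m) =
          \sum_m rho i m * rho m l - \sum_m rho i m * g m.
        by rewrite -sumrB; apply: eq_bigr => m _; rewrite mulrBr.
      by rewrite opprB [RHS]addrC addrA subrK.
    apply: (is_idealB II).
      by apply: (is_ideal_sum _ II) => m _; apply: (is_idealMl _ II); case: (gP m).
    exact: (rhov (fun m => rho m l)).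
  have [g og Ig] := H N j k.
  by rewrite -[rho j k](subrK g); apply: (is_idealD II) => //; exact: hN.
move=> /existsNP [k' /existsNP [k nord]]; exfalso.
have [kx|kx] := eqVneq (tgt k') x; last first.
  by apply: nord; rewrite -zrho /in_vtx (negPf kx) mul0r; exact: ord_zero.
have zk : in_vtx k' = vtx (src k') by rewrite /in_vtx kx eqxx.
have k'C := srcx kx.
have nz : pcoef (rho k' k) (src k') [::] != 0.
  apply/eqP => e; apply: nord; apply: ord1P => y; rewrite -zrho zk pcoef_vtxl.
  by case: eqP => [->|]; rewrite ?mul0r // e mulr0.
have [|w ww] := @corner_inverse (rho k' k) (src k') _ nz; first by rewrite -zk zrho.
(* otherwise one entry is invertible in its corner, and the relation [k'] follows from the
   others: [T] generates the closed ideal excluded by minimality *)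
set T : set L := [set g | (exists2 b, b \in C & g = arrow_elt K b) \/
    (exists2 b, b \in C & b != k' /\ g = D b)]%classic.
apply: (minW k'C); rewrite -/T; have TT : is_ideal (cl T) by exact: cl_ideal.
have T_supp f : (forall y s, ~~ has (mem C) s -> pcoef f y s = 0) -> cl T f.
  by move=> fs; apply: (cl_supp (X := mem C)) => // a aC; left; exists a.
(* the relation [k'] starts at [x], so that it disappears away from [x] *)
have Tco f g : I f -> cl T ((1 - vtx x) * g * f).
  pose P : set L := fun f => forall g, cl T ((1 - vtx x) * g * f).
  have PP : is_ideal P.
    apply: is_ideal_mk.
    - by move=> h; rewrite mulr0; exact: (is_ideal0 TT).
    - by move=> f1 f2 P1 P2 h; rewrite mulrDr; apply: (is_idealD TT).
    - by move=> f1 f2 P2 h; rewrite mulrA -[_ * h * f1]mulrA; exact: P2.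
    - by move=> f1 f2 P2 h; rewrite mulrA; apply: (is_idealMr _ TT); exact: P2.
  move=> If; apply: cl_closed => n; have [f0 f0P of0] := If n.
  exists ((1 - vtx x) * g * f0); last by rewrite -mulrBr; exact: ordMl.
  apply: (f0P _ PP) => {f0 f0P of0} _ [[b bC ->]|[b ->]] h.
    by apply: (is_idealMl _ TT); apply: sub_cl; left; exists b.
  have [bC|bC] := boolP (b \in C); last first.
    apply: (is_idealMl _ TT); apply: T_supp => y s sC; exact: D_cut0.
  have [bk|bk] := eqVneq b k'; last first.
    by apply: (is_idealMl _ TT); apply: sub_cl; right; exists b.
  have -> : D b = vtx x * D b.
    apply: cpathP => y s; rewrite pcoef_vtxl.
    have [->|/deriv_supp [-> _ _ _ _]] := eqVneq (pcoef (D b) y s) 0; first by rewrite mulr0.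
    by rewrite bk kx eqxx mul1r.
  rewrite mulrA; apply: (is_idealMr _ TT); apply: T_supp => y s sC.
  rewrite pcoef_vtxr pcoef_covtxl; case: eqP => [e|]; last by rewrite mul0r.
  have [s0|/(walk_end_x e)] := eqVneq s [::]; last by rewrite -has_count (negPf sC).
  by move: e; rewrite s0 /walk_end /= => ->; rewrite eqxx mul0r mulr0.
pose ia a := \sum_j rel_entry a j * rho j k * w.
have Iia a : I (ia a) by rewrite /ia -mulr_suml; apply: (is_idealMr _ II).
have iaE a : ia a = rel_entry a k' + \sum_(j | j != k') rel_entry a j * (rho j k * w).
  rewrite /ia (bigD1 k') //= -mulrA ww -zk r_z; congr (_ + _).
  by apply: eq_bigr => i _; rewrite mulrA.
have -> : D k' = \sum_a out_arrow a * ia a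
    - \sum_(j | (j != k') && (tgt j == x)) D j * (rho j k * w).
  rewrite D_in //; apply/eqP; rewrite eq_sym subr_eq; apply/eqP.
  rewrite (eq_bigr (fun a => out_arrow a * rel_entry a k' +
     \sum_(j | j != k') out_arrow a * rel_entry a j * (rho j k * w))) => [|a _]; last first.
    rewrite iaE mulrDr mulr_sumr; congr (_ + _); apply: eq_bigr => i _.
    by rewrite mulrA.
  rewrite big_split /=; congr (_ + _); rewrite exchange_big /=.
  rewrite (bigID (fun i => tgt i == x)) /= [X in _ + X]big1 ?addr0 => [|i /andP[_ ix]].
    by apply: eq_bigr => i /andP[_ /eqP ix]; rewrite D_in // mulr_suml.
  by apply: big1 => a _; rewrite /rel_entry (negPf ix) andbF mulr0 mul0r.
apply: (is_idealB TT).
  apply: (is_ideal_sum _ TT) => a _; apply: (is_idealMl _ TT).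
  have -> : ia a = (1 - vtx x) * out_vtx a * ia a.
    by rewrite yv_co /ia mulr_sumr; apply: eq_bigr => i _; rewrite !mulrA yv_r.
  exact: Tco.
apply: (is_ideal_sum _ TT) => i /andP[ik /eqP ix]; apply: (is_idealMr _ TT).
by apply: sub_cl; right; exists i; [exact: srcx|].
Qed.

Local Notation I' := (cl (relset W (mu_plus x C))).

Let II' : is_ideal I'. Proof. exact: cl_ideal. Qed.

Lemma in_mu c : (c \in mu_plus x C) = (c \in C) && (tgt c != x) || (src c == x).
Proof. by rewrite !inE [X in X || _]andbC. Qed.

Lemma I'_supp f : (forall y s, ~~ has (mem (mu_plus x C)) s -> pcoef f y s = 0) -> I' f.
Proof.
by move=> fs; apply: (cl_supp (X := mem (mu_plus x C))) => // a aC; left; exists a.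
Qed.

Lemma av_preimage J : is_ideal J -> is_ideal (avoiding @^-1` J)%classic.
Proof.
move=> JJ; apply: is_ideal_mk; rewrite /preimage /=.
- by rewrite av0; exact: is_ideal0.
- by move=> f g Jf Jg; rewrite avD; exact: (is_idealD JJ).
- by move=> f g Jg; rewrite avM; exact: (is_idealMl _ JJ).
- by move=> f g Jg; rewrite avM; exact: (is_idealMr _ JJ).
Qed.

Lemma avd_mu y s : avoids y s -> has (mem C) s -> has (mem (mu_plus x C)) s.
Proof.
move=> /andP[_ /allP sx] /hasP [c cs cC]; apply/hasP; exists c => //.
change (c \in mu_plus x C); rewrite in_mu sx // andbT.
by have -> : c \in C := cC.
Qed.

Lemma av_arrow c :
  avoiding (arrow_elt K c) = if (src c != x) && (tgt c != x) then arrow_elt K c else 0.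
Proof.
apply: cpathP => y s; rewrite pcoef_av pcoef_arrow.
have [->|yc] := eqVneq y (src c); last by case: ifP => _; rewrite mulr0 ?pcoef_arrow ?pcoef0 // (negPf yc).
have [->|sc] := eqVneq s [:: c]; last by case: ifP => _; rewrite mulr0 ?pcoef_arrow ?pcoef0 // (negPf sc) andbF.
by rewrite /avoids /= andbT; case: ifP => _; rewrite ?mul0r ?pcoef0 // pcoef_arrow !eqxx mul1r.
Qed.

(** Away from [x] the two algebras have the same cut arrows, and the relations lost by the
    mutation involve [x]. *)
Lemma av_mutation f : I f -> I' (avoiding f).
Proof.
apply: (cl_map av_preimage avB av_ord) => {}f [[c cC ->]|[a ->]].
  rewrite av_arrow; case: ifP => [/andP[_ cx]|_]; last exact: (is_ideal0 II').
  by apply: sub_cl; left; exists c => //; rewrite in_mu cC cx.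
have [ax|ax] := eqVneq (tgt a) x; first by rewrite D_av0 //; exact: (is_ideal0 II').
have [aC|aC] := boolP (a \in C).
  by rewrite D_av //; apply: sub_cl; right; exists a.
apply: I'_supp => y s sC; rewrite pcoef_av.
have [avs|] := boolP (avoids y s); last by rewrite mul0r.
by rewrite mul1r D_cut0 //; apply: contra sC; exact: (avd_mu avs).
Qed.

(** The coefficient of the last arrow [c] in the paths that reach [x] at the end only. *)
Definition arriving c f := if tgt c == x then avoiding (rdiv c f) else 0.

Lemma gcD c f g : arriving c (f + g) = arriving c f + arriving c g.
Proof. by rewrite /arriving; case: ifP => _; rewrite ?addr0 // rdivD avD. Qed.

Lemma gcM c f g : arriving c (f * g) = avoiding f * arriving c g + cscal (pcoef g x [::]) * arriving c f.
Proof.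
rewrite /arriving; case: eqP => [cx|_]; last by rewrite !mulr0 addr0.
rewrite rdivM cx avD avM; congr (_ + _).
by apply: cpathP => y s; rewrite pcoef_av !pcoef_scal pcoef_av mulrCA.
Qed.

Lemma gc_ord n c f : ord n.+1 f -> ord n (arriving c f).
Proof.
move=> of_; rewrite /arriving; case: ifP => _; last exact: ord_zero.
by apply: av_ord; exact: ord_rdiv.
Qed.

Lemma gc_av c f : avoiding (arriving c f) = arriving c f.
Proof. by rewrite /arriving; case: ifP => _; rewrite ?av_av ?av0. Qed.

Lemma gc0 c : arriving c 0 = 0.
Proof.
rewrite /arriving; case: ifP => // _; suff -> : rdiv c (0 : L) = 0 by rewrite av0.
by apply: cpathP => y s; rewrite pcoef_rdiv !pcoef0.
Qed.

Lemma gc_z c f : arriving c f * in_vtx c = arriving c f.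
Proof.
apply: cpathP => y s; rewrite /arriving /in_vtx; case: eqP => _; last by rewrite mulr0.
rewrite pcoef_vtxr pcoef_av pcoef_rdiv; case: eqP => [_|e]; first by rewrite mul1r.
rewrite mul0r pcoef_out ?mulr0 // is_walk_rcons negb_and.
by apply/orP; right; apply/eqP => e'; case: e; rewrite e'.
Qed.

Lemma gc_D c a : src a != x -> I (arriving c (D a)).
Proof.
move=> ax; rewrite /arriving; case: eqP => cx; last exact: (is_ideal0 II).
have cC := srcx cx; suff -> : rdiv c (D a) = 0 by rewrite av0; exact: (is_ideal0 II).
apply: cpathP => y s; rewrite pcoef_rdiv pcoef0; apply/eqP; apply: contraT => /deriv_supp.
by case=> _ _; rewrite walk_end_rcons cx => e; rewrite -e eqxx in ax.
Qed.

(** The relations of the mutated algebra that end at [x] are the rows of the matrix, by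
    [D_out]; products only change the arriving parts by left multiples and by elements of [I],
    see [gcM]. *)
Lemma mutation_ker1 f : I' f -> [/\ pcoef f x [::] = 0, I (avoiding f) &
  exists h : arrow Q -> L, forall c, I (arriving c f - \sum_a h a * rel_entry a c)].
Proof.
pose P : set L := fun f => [/\ pcoef f x [::] = 0, I (avoiding f) &
  exists h : arrow Q -> L, forall c, I (arriving c f - \sum_a h a * rel_entry a c)].
move: f; apply: (cl_min (n := N.+1)).
- apply: is_ideal_mk.
  + split; [exact: pcoef0 | by rewrite av0; exact: (is_ideal0 II) |].
    exists (fun=> 0) => c; rewrite gc0 big1 ?subrr => [|a _]; last by rewrite mul0r.
    exact: (is_ideal0 II).
  + move=> f g [f0 If [h hP]] [g0 Ig [k kP]].
    split; [by rewrite pcoefD f0 g0 addr0 | by rewrite avD; exact: (is_idealD II) |].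
    exists (fun a => h a + k a) => c.
    have -> : arriving c (f + g) - \sum_a (h a + k a) * rel_entry a c =
      (arriving c f - \sum_a h a * rel_entry a c) + (arriving c g - \sum_a k a * rel_entry a c).
      rewrite gcD addrACA -opprD -big_split; congr (_ - _).
      by apply: eq_bigr => a _; rewrite mulrDl.
    exact: (is_idealD II (hP c) (kP c)).
  + move=> f g [g0 Ig [h hP]].
    split; [by rewrite pcoef_mul_nil g0 mulr0 | by rewrite avM; exact: (is_idealMl _ II) |].
    exists (fun a => avoiding f * h a) => c; rewrite gcM g0 cscal0 mul0r addr0.
    have -> : \sum_a avoiding f * h a * rel_entry a c = avoiding f * \sum_a h a * rel_entry a c.
      by rewrite mulr_sumr; apply: eq_bigr => a _; rewrite mulrA.
    by rewrite -mulrBr; exact: (is_idealMl _ II (hP c)).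
  + move=> f g [g0 Ig [h hP]].
    split; [by rewrite pcoef_mul_nil g0 mul0r | by rewrite avM; exact: (is_idealMr _ II) |].
    exists (fun a => cscal (pcoef f x [::]) * h a) => c; rewrite gcM -addrA.
    apply: (is_idealD II); first exact: (is_idealMr _ II).
    have -> : \sum_a cscal (pcoef f x [::]) * h a * rel_entry a c =
        cscal (pcoef f x [::]) * \sum_a h a * rel_entry a c.
      by rewrite mulr_sumr; apply: eq_bigr => a _; rewrite mulrA.
    by rewrite -mulrBr; exact: (is_idealMl _ II (hP c)).
- move=> _ [[b bC ->]|[b ->]].
    have bx : tgt b != x by move: bC; rewrite in_mu => /orP[/andP[]|/eqP/tgt_out].
    split; first by rewrite pcoef_arrow andbF.
      rewrite av_arrow bx andbT; case: ifP => [sx|_]; last exact: (is_ideal0 II).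
      by apply: sub_cl; left; exists b => //; move: bC; rewrite in_mu (negPf sx) orbF => /andP[].
    exists (fun=> 0) => c; rewrite big1 ?subr0 => [|a _]; last by rewrite mul0r.
    suff -> : arriving c (arrow_elt K b) = 0 by exact: (is_ideal0 II).
    rewrite /arriving; case: eqP => // cx; suff -> : rdiv c (arrow_elt K b) = 0 by rewrite av0.
    apply: cpathP => y s; rewrite pcoef0 pcoef_rdiv pcoef_arrow.
    case: (rcons s c =P [:: b]) => [/(congr1 (last b))|]; last by rewrite andbF.
    by rewrite last_rcons /= => cb; rewrite -cb cx eqxx in bx.
  split; first exact: D_nil.
    have [bx|bx] := eqVneq (tgt b) x; first by rewrite D_av0 //; exact: (is_ideal0 II).
    have [bC|bC] := boolP (b \in C); first by rewrite D_av //; exact: D_I.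
    by apply: av_supp => y s; exact: D_cut0.
  have [bx|bx] := eqVneq (src b) x; last first.
    exists (fun=> 0) => c; rewrite big1 ?subr0 => [|a _]; last by rewrite mul0r.
    exact: gc_D.
  exists (fun a => (a == b)%:R) => c; rewrite (bigD1 b) //= eqxx mul1r.
  rewrite big1 ?addr0 => [|a /negPf ->]; last by rewrite mul0r.
  suff -> : arriving c (D b) = rel_entry b c by rewrite subrr; exact: (is_ideal0 II).
  rewrite /arriving; case: eqP => [cx|/eqP cx]; last by rewrite /rel_entry (negPf cx) andbF.
  suff -> : rdiv c (D b) = rel_entry b c by exact: r_av.
  apply: cpathP => y s; rewrite {1}D_out // pcoef_rdiv pcoef_sum (bigD1 c) //=.
  rewrite pcoef_arrowr eqxx andbT big1 ?addr0 => [|d dc]; last first.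
    by rewrite pcoef_arrowr [c == d]eq_sym (negPf dc) andbF mul0r.
  case: eqP => [_|e]; rewrite ?mul1r // mul0r.
  have [->//|/r_supp [_ _ _ e' _]] := eqVneq (pcoef (rel_entry b c) y s) 0.
  by case: e.
- move=> f of_; split; first exact: of_.
    by apply: hN; apply: av_ord; apply: ordW of_.
  exists (fun=> 0) => c; rewrite big1 ?subr0 => [|a _]; last by rewrite mul0r.
  by apply: hN; exact: gc_ord.
Qed.

Lemma walk_avd y s b : is_walk y (rcons s b) -> all (fun a => src a != x) (rcons s b) ->
  avoids y s.
Proof.
elim: s y => [|a s IHs] y /=; first by rewrite /avoids /= !andbT => /eqP ->.
move=> /andP[/eqP <- w] /andP[ax /(IHs _ w)].
by rewrite /avoids /= ax => /andP[-> ->].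
Qed.

(** Modulo the arrows of the mutated cut, only the trivial path at [x], the paths avoiding
    [x], and those reaching [x] with their last arrow remain. *)
Lemma mutation_decomposition f :
  I' (f - (cscal (pcoef f x [::]) * vtx x + avoiding f + \sum_c arriving c f * arrow_elt K c)).
Proof.
apply: I'_supp => y s sC; rewrite pcoefB !pcoefD pcoef_scal pcoef_vtx pcoef_av pcoef_sum.
have s_out : all (fun b => src b != x) s.
  apply/allP => b bs; apply: contra sC => bx; apply/hasP; exists b => //.
  by change (b \in mu_plus x C); rewrite in_mu bx orbT.
have [w|w] := boolP (is_walk y s); last first.
  rewrite [pcoef f y s]pcoef_out // big1 => [|c _]; last by rewrite pcoef_out.
  case: s w {sC s_out} => [|b s] // _.
  by rewrite andbF !mulr0 !addr0 subrr.
case/lastP: s w s_out {sC} => [|s b] w s_out.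
  rewrite big1 => [|c _]; last by rewrite pcoef_arrowr_nil.
  rewrite andbT addr0 /avoids /= andbT; have [->|_] := eqVneq y x.
    by rewrite mulr1 mul0r addr0 subrr.
  by rewrite mulr0 mul1r add0r subrr.
have ws : walk_end y s = src b by move: w; rewrite is_walk_rcons => /andP[_ /eqP].
rewrite -[rcons s b == _]size_eq0 size_rcons andbF mulr0 add0r (bigD1 b) //=.
rewrite pcoef_arrowr ws !eqxx mul1r big1 ?addr0 => [|c cb]; last first.
  by rewrite pcoef_arrowr [b == c]eq_sym (negPf cb) andbF mul0r.
have := walk_avd w s_out; rewrite -cats1 avd_cat /arriving => sx; rewrite sx /=.
rewrite /avoids /= andbT ws; have -> /= : src b != x.
  by move: s_out; rewrite all_rcons => /andP[].
have [bx|bx] := eqVneq (tgt b) x; rewrite /= ?mul0r ?mul1r.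
  by rewrite add0r pcoef_av sx pcoef_rdiv cats1 mul1r subrr.
by rewrite pcoef0 addr0 subrr.
Qed.

(** By [mutation_decomposition], what is left of [f] is its avoiding part, handled by
    [av_mutation], and its arriving parts, which are combinations of mutated relations. *)
Lemma mutation_ker2 f : pcoef f x [::] = 0 -> I (avoiding f) ->
  (exists h : arrow Q -> L, forall c, I (arriving c f - \sum_a h a * rel_entry a c)) -> I' f.
Proof.
move=> f0 If [h hP]; have := mutation_decomposition f; rewrite f0 cscal0 mul0r add0r => If'.
rewrite -[f](subrK (avoiding f + \sum_c arriving c f * arrow_elt K c)); apply: (is_idealD II') => //.
apply: (is_idealD II'); first by rewrite -av_av; exact: av_mutation.
have -> : \sum_c arriving c f * arrow_elt K c =
    \sum_c avoiding (arriving c f - \sum_a h a * rel_entry a c) * arrow_elt K c +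
    \sum_a avoiding (h a) * (\sum_c rel_entry a c * arrow_elt K c).
  rewrite [X in _ + X](eq_bigr (fun a => \sum_c avoiding (h a) * rel_entry a c * arrow_elt K c)); last first.
    by move=> a _; rewrite mulr_sumr; apply: eq_bigr => c _; rewrite mulrA.
  rewrite exchange_big -big_split; apply: eq_bigr => c _ /=.
  rewrite -mulr_suml -mulrDl avB gc_av av_sum; congr (_ * _).
  by rewrite [X in _ - X](eq_bigr (fun a => avoiding (h a) * rel_entry a c)) ?subrK // => a _; rewrite avM r_av.
apply: (is_idealD II').
  apply: (is_ideal_sum _ II') => c _; apply: (is_idealMr _ II'); exact: av_mutation.
apply: (is_ideal_sum _ II') => a _; apply: (is_idealMl _ II').
have [ax|ax] := eqVneq (src a) x; last first.
  rewrite big1 => [|c _]; first exact: (is_ideal0 II').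
  by rewrite /rel_entry (negPf ax) mul0r.
by rewrite -D_out //; apply: sub_cl; right; exists a.
Qed.

End Source.

(** * Linear algebra, lifting and extensions of modules *)

Definition mk_linear (R : pzRingType) (M N : lmodType R) (f : M -> N) (lf : linear f) :
  {linear M -> N} := lhom_fun (Lhom lf).

Lemma mk_linearE (R : pzRingType) (M N : lmodType R) (f : M -> N) (lf : linear f) x :
  mk_linear lf x = f x.
Proof. by []. Qed.

Lemma linear_comb (R : pzRingType) (M N : lmodType R) (f : {linear M -> N}) (T : Type)
    (s : seq T) (c : T -> R) (F : T -> M) :
  f (\sum_(i <- s) c i *: F i) = \sum_(i <- s) c i *: f (F i).
Proof. by rewrite linear_sum; apply: eq_bigr => i _; rewrite linearZ. Qed.

Section FunctionalExtension.
Variables (K : fieldType) (V W : lmodType K) (f : {linear V -> W}) (phi : {linear V -> K^o}).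
Hypothesis ker : forall v, f v = 0 -> phi v = 0.

Local Open Scope classical_set_scope.

Let good (G : set (W * K)) : Prop :=
  [/\ forall k w c w' c', G (w, c) -> G (w', c') -> G (k *: w + w', k * c + c'),
      forall c, G (0, c) -> c = 0 & forall p, G p -> forall v, G (f v, phi v)].

(** A functional extends along a linear map that does not identify vectors it separates: a
    maximal partial functional is total. *)
Lemma functional_extension : exists psi : {linear W -> K^o}, forall v, psi (f v) = phi v.
Proof.
have [|E [[Elin E0 Egr] Emax]] := @Zorn_bigcup (W * K)%type good.
  move=> F Fgood Ftot; split.
  - move=> k w c w' c' [X FX Xw] [Y FY Yw].
    have [XY|YX] := Ftot _ _ FX FY.
      by exists Y => //; case: (Fgood _ FY) => H _ _; apply: H => //; exact: XY.
    by exists X => //; case: (Fgood _ FX) => H _ _; apply: H => //; exact: YX.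
  - by move=> c [X FX]; case: (Fgood _ FX) => _ H _; exact: H.
  - by move=> p [X FX Xp] v; exists X => //; case: (Fgood _ FX) => _ _; apply; exact: Xp.
have Egraph v : E (f v, phi v).
  apply: contrapT => nE.
  have E_0 p : ~ E p by move=> /Egr.
  apply: (Emax [set p | exists v, p = (f v, phi v)]).
    split=> [p /E_0 //|]; move=> /(_ (f v, phi v)) H; apply: nE; apply: H; by exists v.
  split.
  - move=> k _ _ _ _ [u [-> ->]] [u' [-> ->]]; exists (k *: u + u').
    by rewrite !linearP.
  - by move=> c [u [/esym u0 ->]]; exact: ker.
  - by move=> _ _ u; exists u.
have Etot w : exists c, E (w, c).
  apply: contrapT => nw.
  apply: (Emax [set p | exists k w' c, [/\ E (w', c) & p = (w' + k *: w, c)]]).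
    split=> [[w' c] Ew|]; first by exists 0, w', c; rewrite scale0r addr0.
    move=> /(_ (w, 0)) H; apply: nw; exists 0; apply: H.
    exists 1, 0, 0; rewrite scale1r add0r; split=> //.
    by have := Egraph 0; rewrite !linear0.
  split.
  - move=> k _ _ _ _ [l [u [c [Eu [-> ->]]]]] [l' [u' [c' [Eu' [-> ->]]]]].
    exists (k * l + l'), (k *: u + u'), (k * c + c'); split; first exact: Elin.
    by congr (_, _); rewrite scalerDr scalerA addrACA -scalerDl.
  - move=> c [l [u [c' [Eu [/esym/eqP uw ->]]]]].
    have [l0|l0] := eqVneq l 0.
      by move: uw Eu; rewrite l0 scale0r addr0 => /eqP -> /E0.
    exfalso; apply: nw; exists (- l^-1 * c' + 0).
    have -> : w = - l^-1 *: u + 0.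
      by move: uw; rewrite addr_eq0 => /eqP ->; rewrite scaleNr scalerN opprK scalerA mulVf // scale1r addr0.
    by apply: Elin => //; have := Egraph 0; rewrite !linear0.
  - move=> _ _ v; exists 0, (f v), (phi v); rewrite scale0r addr0.
    by split=> //; exact: Egraph.
have [psi psiP] := choice Etot.
have Euniq w c : E (w, c) -> psi w = c.
  move=> Ew; apply/eqP; rewrite -subr_eq0; apply/eqP/E0.
  have := Elin (-1) _ _ _ _ Ew (psiP w); rewrite scaleN1r addNr mulN1r addrC.
  by [].
have psil : linear (psi : W -> K^o).
  by move=> k u v; apply: Euniq; apply: Elin; exact: psiP.
by exists (mk_linear psil) => v; rewrite mk_linearE; apply: Euniq.
Qed.

End FunctionalExtension.

Section FiniteDimension.
Variable K : fieldType.
Implicit Types V W : lmodType K.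

Definition fdim V := exists n (v : 'I_n -> V), forall x, exists c : 'I_n -> K,
  x = \sum_i c i *: v i.

Lemma functional_separates V (v : V) : (forall phi : {linear V -> K^o}, phi v = 0) -> v = 0.
Proof.
move=> H; apply: contrapT => v0.
have lf : linear (fun k : K^o => k *: v) by move=> k a b; rewrite scalerDl scalerA.
have idl : linear (@idfun K^o) by [].
have [|psi psiP] := @functional_extension K K^o V (mk_linear lf) (mk_linear idl).
  move=> k; rewrite !mk_linearE => /eqP; rewrite scaler_eq0 => /orP[/eqP //|/eqP //].
have := psiP 1; rewrite !mk_linearE scale1r H => /eqP.
by rewrite eq_sym oner_eq0.
Qed.

(** A generating family of minimal size is free. *)
Lemma fdim_basis V : fdim V -> exists n (v : 'I_n -> V),
  (forall x, exists c : 'I_n -> K, x = \sum_i c i *: v i) /\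
  (forall c : 'I_n -> K, \sum_i c i *: v i = 0 -> forall i, c i = 0).
Proof.
move=> fV; pose P n := `[< exists v : 'I_n -> V, forall x, exists c : 'I_n -> K,
   x = \sum_i c i *: v i >].
have exP : exists n, P n by case: fV => n H; exists n; apply/asboolP.
case: (ex_minnP exP) => n /asboolP [v vP] nmin; exists n, v; split=> // c c0 i.
apply/eqP; apply: contraT => ci; case: n v vP nmin c c0 i ci => [|n] v vP nmin c c0 i ci.
  by case: i ci.
have /nmin : P n; last by rewrite ltnn.
apply/asboolP; exists (fun j => v (lift i j)) => x; have [d ->] := vP x.
exists (fun j => d (lift i j) - d i * (c i)^-1 * c (lift i j)).
have vi : v i = - (c i)^-1 *: \sum_j c (lift i j) *: v (lift i j).
  move: c0; rewrite (bigD1_ord i) //= => /eqP; rewrite addr_eq0 => /eqP e.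
  by rewrite scaleNr -scalerN -e scalerA mulVf // scale1r.
rewrite (bigD1_ord i) //= {1}vi scaler_sumr scaler_sumr -big_split /=.
apply: eq_bigr => j _; rewrite !scalerA -scalerDl addrC; congr (_ *: _).
by rewrite mulrN !mulNr ?mulrA.
Qed.

(** Linearity of a function on the dual, which has no vector space structure of its own. *)
Definition dual_linear V (F : lhom V K^o -> K) := forall (k : K) (f g h : lhom V K^o),
  (forall v, h v = k * f v + g v) -> F h = k * F f + F g.

Lemma dual_basis V : fdim V -> exists n (v : 'I_n -> V) (c : 'I_n -> lhom V K^o),
  forall x, x = \sum_i c i x *: v i.
Proof.
move=> /fdim_basis [n [v [vP vfree]]]; have [c cP] := choice vP.
have clin i : linear (fun x => c x i : K^o).
  move=> k x y; apply/eqP; rewrite -subr_eq0; apply/eqP; move: i.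
  apply: (vfree (fun i => c (k *: x + y) i - (k * c x i + c y i))).
  rewrite (eq_bigr (fun j => c (k *: x + y) j *: v j -
    (k *: (c x j *: v j) + c y j *: v j))) => [|j _].
    by rewrite sumrB big_split /= -scaler_sumr -!cP subrr.
  by rewrite scalerBl scalerDl scalerA.
by exists n, v, (fun i => Lhom (clin i)).
Qed.

Lemma reflexive V (F : lhom V K^o -> K) : fdim V -> dual_linear F ->
  exists v, forall f, F f = f v.
Proof.
move=> /dual_basis [n [v [c cP]]] Flin.
have F0 (f : lhom V K^o) : (forall v, f v = 0) -> F f = 0.
  move=> f0; have := Flin 1 f f f; rewrite mul1r => H.
  have : F f = F f + F f by apply: H => x; rewrite f0 mul1r addr0.
  by move/eqP; rewrite -subr_eq0 opprD addrA subrr sub0r oppr_eq0 => /eqP.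
exists (\sum_i F (c i) *: v i) => f.
have slin (s : seq 'I_n) : linear (fun x => \sum_(i <- s) f (v i) * c i x : K^o).
  move=> k x y; rewrite scaler_sumr -big_split; apply: eq_bigr => i _ /=.
  by rewrite linearP mulrDr mulrCA.
have FE (s : seq 'I_n) : F (Lhom (slin s)) = \sum_(i <- s) f (v i) * F (c i).
  elim: s => [|i s IHs]; first by rewrite big_nil F0 // => x; rewrite /= /lhom_fun /= big_nil.
  rewrite big_cons -IHs; apply: Flin => x.
  by rewrite /lhom_fun /= big_cons.
have {1}-> : f = Lhom (slin (index_enum 'I_n)).
  apply: lhomP => x; rewrite {1}[x]cP linear_sum; apply: eq_bigr => i _.
  by rewrite linearZ /= mulrC.
by rewrite FE linear_sum; apply: eq_bigr => i _; rewrite linearZ /= mulrC.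
Qed.

Lemma fdim_fin V (T : finType) (v : T -> V) :
  (forall x, exists c : T -> K, x = \sum_i c i *: v i) -> fdim V.
Proof.
move=> vP; exists #|T|, (fun i => v (enum_val i)) => x; have [c ->] := vP x.
exists (fun i => c (enum_val i)).
by rewrite [LHS](reindex (@enum_val _ T)) //; apply/onW_bij/enum_val_bij.
Qed.

Lemma fdim_surj V W (f : {linear V -> W}) : surj f -> fdim V -> fdim W.
Proof.
move=> fS [n [v vP]]; exists n, (fun i => f (v i)) => y; have [x <-] := fS y.
have [c ->] := vP x; exists c; rewrite linear_sum.
by apply: eq_bigr => i _; rewrite linearZ.
Qed.

Lemma fdim_prod V W : fdim V -> fdim W -> fdim (V * W)%type.
Proof.
move=> [n [v vP]] [m [w wP]].
apply: (@fdim_fin _ ('I_n + 'I_m)%type (fun i => match i with inl i => (v i, 0)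
  | inr j => (0, w j) end)) => -[x y].
have [[c xE] [d yE]] := (vP x, wP y).
exists (fun i => match i with inl i => c i | inr j => d j end).
rewrite big_sumType /= xE yE.
have -> : \sum_i c i *: (v i, 0 : W) = (\sum_i c i *: v i, 0).
  rewrite (big_morph (fun x : V => (x, 0 : W)) (op1 := +%R) (id1 := 0)) //.
    by apply: eq_bigr => i _; congr (_, _); rewrite /= scaler0.
  by move=> a b; congr (_, _); rewrite /= addr0.
have -> : \sum_i d i *: (0 : V, w i) = (0, \sum_i d i *: w i).
  rewrite (big_morph (fun x : W => (0 : V, x)) (op1 := +%R) (id1 := 0)) //.
    by apply: eq_bigr => i _; congr (_, _); rewrite /= scaler0.
  by move=> a b; congr (_, _); rewrite /= addr0.
by congr (_, _); rewrite /= ?addr0 ?add0r.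
Qed.

End FiniteDimension.

Section Submodule.
Variables (R : pzRingType) (M : lmodType R) (U : set M) (HU : is_submodule U).

Definition in_submod of is_submodule U : {pred M} := [pred x | `[< U x >]].

Fact in_submod_closed : submod_closed (in_submod HU).
Proof.
have [U0 UD] := HU; split; first exact/asboolP.
by move=> r x y /asboolP Ux /asboolP Uy; apply/asboolP; exact: UD.
Qed.

HB.instance Definition _ := GRing.isSubmodClosed.Build R M (in_submod HU) in_submod_closed.

Definition submod : Type := {x : M | x \in in_submod HU}.
HB.instance Definition _ := SubChoice.on submod.
HB.instance Definition _ := [SubChoice_isSubLmodule of submod by <:].

Definition submod_val (x : submod) : M := val x.
Fact submod_val_linear : linear submod_val. Proof. by []. Qed.
Definition submod_incl : {linear submod -> M} := mk_linear submod_val_linear.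

Lemma submod_inclP x : U (submod_incl x). Proof. exact: (asboolW (valP x)). Qed.
Lemma submod_incl_inj : injective submod_incl. Proof. exact: val_inj. Qed.

Definition to_submod (x : M) (Ux : U x) : submod := exist _ x (asboolT Ux).
Lemma to_submodK x (Ux : U x) : submod_incl (to_submod Ux) = x. Proof. by []. Qed.

End Submodule.

Section Lifting.
Variable R : pzRingType.
Implicit Types M N P I : lmodType R.

Lemma image_submodule M N (g : {linear M -> N}) : is_submodule [set n | exists m, g m = n]%classic.
Proof.
split; first by exists 0; rewrite linear0.
by move=> r _ _ [x <-] [y <-]; exists (r *: x + y); rewrite linearP.
Qed.

(** The map [g] becomes surjective when its target is restricted to its image, which contains
    that of [f]. *)
Lemma projective_lift P M N (g : {linear M -> N}) (f : {linear P -> N}) :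
  projective P -> (forall p, exists m, g m = f p) ->
  exists h : {linear P -> M}, forall p, g (h p) = f p.
Proof.
move=> projP fg; pose HU := image_submodule g.
have gl : linear (fun m => to_submod HU (ex_intro _ m erefl)).
  by move=> k x y; apply: submod_incl_inj; rewrite [RHS]linearP; exact: (linearP g).
have fl : linear (fun p => to_submod HU (fg p)).
  by move=> k x y; apply: submod_incl_inj; rewrite [RHS]linearP; exact: (linearP f).
have [|h hP] := projP _ _ (mk_linear gl) (mk_linear fl).
  move=> n; have [m mn] := submod_inclP n; exists m.
  by apply: submod_incl_inj; rewrite to_submodK.
by exists h => p; have := congr1 (@submod_incl _ _ _ HU) (hP p); rewrite !to_submodK.
Qed.

(** The map [f] descends to the image of [g], from which it extends. *)
Lemma injective_extend I M N (g : {linear M -> N}) (f : {linear M -> I}) :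
  injective_mod I -> (forall m, g m = 0 -> f m = 0) ->
  exists h : {linear N -> I}, forall m, h (g m) = f m.
Proof.
move=> injI fg; pose HU := image_submodule g.
have [c cP] := choice (fun n : submod HU => submod_inclP n).
have fc m n : g m = submod_incl HU n -> f (c n) = f m.
  move=> e; apply/eqP; rewrite -subr_eq0 -linearB; apply/eqP/fg.
  by rewrite linearB cP e subrr.
have fl : linear (fun n => f (c n)).
  by move=> k x y; rewrite -linearP; apply: fc; rewrite linearP !cP linearP.
have [|h hP] := injI _ _ (submod_incl HU) (mk_linear fl); first exact: submod_incl_inj.
exists h => m; rewrite -[g m](@to_submodK _ _ _ HU (g m) (ex_intro _ m erefl)) hP.
exact: fc.
Qed.

Lemma is_submodule_ker M N (f : {linear M -> N}) : is_submodule [set x | f x = 0]%classic.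
Proof.
split; first exact: linear0.
by move=> r x y; rewrite /= linearP => -> ->; rewrite scaler0 addr0.
Qed.

End Lifting.

Section Extensions.
Variables (R : pzRingType) (M N : lmodType R) (kappa : R -> M -> N).
Hypothesis kappaDl : forall a b m, kappa (a + b) m = kappa a m + kappa b m.
Hypothesis kappaDr : forall a m n, kappa a (m + n) = kappa a m + kappa a n.
Hypothesis kappa1 : forall m, kappa 1 m = 0.
Hypothesis kappaM : forall a b m, kappa (a * b) m = a *: kappa b m + kappa a (b *: m).

(** The product [N * M], for an action corrected by [kappa]; the cocycle condition, without
    which there is no action, is an argument so that the structures attach to this type. *)
Definition twisted of (forall a b m, kappa (a * b) m = a *: kappa b m + kappa a (b *: m)) :
  Type := (N * M)%type.
Local Notation E := (twisted kappaM).
HB.instance Definition _ := GRing.Zmodule.on E.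

Definition twisted_scale (a : R) (u : E) : E := (a *: u.1 + kappa a u.2, a *: u.2).

Fact twisted_scalerA a b u : twisted_scale a (twisted_scale b u) = twisted_scale (a * b) u.
Proof. by rewrite /twisted_scale /= scalerDr !scalerA kappaM addrA. Qed.
Fact twisted_scale1 : left_id 1 twisted_scale.
Proof. by move=> [n m]; rewrite /twisted_scale kappa1 addr0 !scale1r. Qed.
Fact twisted_scalerDr : right_distributive twisted_scale +%R.
Proof.
by move=> a [n m] [n' m']; rewrite /twisted_scale /= !scalerDr kappaDr addrACA.
Qed.
Fact twisted_scalerDl u : {morph twisted_scale^~ u : a b / a + b}.
Proof. by move=> a b; rewrite /twisted_scale kappaDl !scalerDl addrACA. Qed.

Definition twisted_mod : lmodType R := HB.pack E (GRing.Zmodule_isLmodule.Build R E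
  twisted_scalerA twisted_scale1 twisted_scalerDr twisted_scalerDl).

(** When there are no nontrivial extensions, every cocycle is a coboundary: split the
    extension on [N * M] in which [a] acts on [M] with the correction [kappa a]. *)
Lemma cocycle_coboundary : ext1_vanishes M N -> exists f : M -> N,
  (forall m n, f (m + n) = f m + f n) /\
  (forall a m, kappa a m = f (a *: m) - a *: f m).
Proof.
have il : linear (fun n : N => (n, 0) : twisted_mod).
  move=> a n n'; apply/pair_equal_spec; split=> /=.
    by rewrite -[kappa a 0](addrK (kappa a 0)) -kappaDr addr0 subrr addr0.
  by rewrite scaler0 addr0.
have pl : linear (fun u : twisted_mod => (u : N * M).2) by [].
move=> /(_ twisted_mod (mk_linear il) (mk_linear pl)) [].
  split.
  - by move=> n n' [].
  - move=> [n m]; split=> [|[n']]; last by move=> [_ <-].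
    by rewrite mk_linearE /= => ->; exists n.
  - by move=> m; exists (0, m).
move=> s sP; exists (fun m => (s m : N * M).1).
have s2 m : (s m : N * M).2 = m by exact: sP.
split=> [m n|a m]; first by rewrite linearD.
have -> : (s (a *: m) : N * M).1 = a *: (s m : N * M).1 + kappa a (s m : N * M).2.
  by have -> : s (a *: m) = a *: s m by exact: linearZ.
by rewrite s2 [_ + kappa a m]addrC addrK.
Qed.

End Extensions.

(** * The transpose of a presented module *)

(** A presentation of [V] by the projective modules generated by the idempotents [z j] and the
    matrix of relations [r]; an index with [z j = 0] stands for no generator. *)
Definition presents (R : pzRingType) (V : lmodType R) (T : finType) (z : T -> R)
    (r : T -> T -> R) (t : T -> V) : Prop :=
  [/\ forall j, z j *: t j = t j, forall v, exists g : T -> R, v = \sum_j g j *: t j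
    & forall g : T -> R, \sum_j g j *: t j = 0 <->
        exists h : T -> R, forall j, g j * z j = \sum_i h i * r i j].

Section Transpose.
Variables (K : comPzRingType) (A B : kalg K) (rho : {rmorphism B -> A^c}) (sigma : A -> B).
Hypothesis rhoK : forall a, rho (sigma a) = a.
Hypothesis sigmaK : forall b, sigma (rho b) = b.

Let rh (b : B) : A := rho b.

Let rhM b c : rh (b * c) = rh c * rh b. Proof. by rewrite /rh rmorphM. Qed.
Let rh_sum (T : Type) (s : seq T) (F : T -> B) : rh (\sum_(i <- s) F i) = \sum_(i <- s) rh (F i).
Proof. exact: (rmorph_sum rho). Qed.
Let rh_inj b c : rh b = rh c -> b = c.
Proof. by move=> e; rewrite -(sigmaK b) -(sigmaK c); congr sigma. Qed.
Let rhK a : rh (sigma a) = a. Proof. exact: rhoK. Qed.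

Variables (T : finType) (a y z : T -> A) (r : T -> T -> A).
Hypothesis ya : forall i, y i * a i = a i.
Hypothesis yy : forall i, y i * y i = y i.
Hypothesis zz : forall j, z j * z j = z j.
Hypothesis ry : forall i j, r i j * y i = r i j.
Hypothesis zr : forall i j, z j * r i j = r i j.
Hypothesis ra : forall j, \sum_i r i j * a i = 0.
Hypothesis syz : forall u : T -> A, (forall i, u i * y i = u i) -> \sum_i u i * a i = 0 ->
  exists v : T -> A, (forall j, v j * z j = v j) /\ forall i, u i = \sum_j v j * r i j.
Hypothesis rinj : forall v : T -> A, (forall j, v j * z j = v j) ->
  (forall i, \sum_j v j * r i j = 0) -> forall j, v j = 0.

Variables (M : lmodType A) (iota : {linear M -> A^o}).
Hypothesis iota_inj : injective iota.
Hypothesis iota_im : forall b : A, (exists m, iota m = b) <->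
  exists u : T -> A, b = \sum_i u i * a i.

Lemma rinj2 (v w : T -> A) : (forall j, v j * z j = v j) -> (forall j, w j * z j = w j) ->
  (forall i, \sum_j v j * r i j = \sum_j w j * r i j) -> forall j, v j = w j.
Proof.
move=> vz wz e j; apply/eqP; rewrite -subr_eq0; apply/eqP.
apply: (rinj (v := fun j => v j - w j)) => [k|i]; first by rewrite mulrBl vz wz.
by rewrite (eq_bigr _ (fun k _ => mulrBl _ _ _)) sumrB e subrr.
Qed.

Lemma adual_comb (P : lmodType A) (g : T -> B) (f : T -> adual rho P) x :
  ((\sum_j g j *: f j : adual rho P) : lhom P A^o) x = \sum_j (f j : lhom P A^o) x * rh (g j).
Proof.
rewrite (big_morph (fun f : adual rho P => (f : lhom P A^o) x : A)
  (op1 := +%R) (id1 := 0)) //.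
Qed.

(** The transpose of a module with the injective presentation [r] is presented by the
    transpose of [r], whatever minimal presentation it is computed from: the comparison maps
    between the two presentations are homotopy inverse to each other. *)
Lemma transpose_presents (X : lmodType B) : is_transpose rho M X ->
  exists t : T -> X, presents (fun j => sigma (z j)) (fun i j => sigma (r i j)) t.
Proof.
move=> [P1 [P0 [d1 [d0 [q [[[projP0 d0S _]
  [N [i [p [[i_inj id0 _] [projP1 pS psup] d1E]]]]] qS qK]]]]]].
have pi0l : linear (fun u : {ffun T -> A^o} => \sum_i (u i : A) * a i : A^o).
  move=> k u v; rewrite scaler_sumr -big_split; apply: eq_bigr => j _ /=.
  by rewrite !ffunE mulrDl -mulrA.
have iad0l : linear (fun x => iota (d0 x)) by move=> k u v; rewrite !linearP.
have [|G GP] := projective_lift (g := mk_linear pi0l) (f := mk_linear iad0l) projP0.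
  move=> x; have [u uE] := (iota_im (iota (d0 x))).1 (ex_intro _ _ erefl).
  exists [ffun j => u j]; rewrite !mk_linearE uE.
  by apply: eq_bigr => j _; rewrite ffunE.
pose s0 l (x : P0) : A := (G x l : A) * y l.
have s0l l : linear (s0 l : P0 -> A^o).
  by move=> k u v; rewrite /s0 linearP !ffunE mulrDl -mulrA.
have s0y l x : s0 l x * y l = s0 l x by rewrite /s0 -mulrA yy.
have s0a x : \sum_l s0 l x * a l = iota (d0 x).
  rewrite -[RHS](GP x) mk_linearE; apply: eq_bigr => l _.
  by rewrite /s0 -mulrA ya.
have s0P l c u v : s0 l (c *: u + v) = c * s0 l u + s0 l v by exact: s0l.
have s0sum l (F : T -> P0) (c : T -> A) :
    s0 l (\sum_m c m *: F m) = \sum_m c m * s0 l (F m).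
  exact: (linear_comb (mk_linear (s0l l))).
(* the comparison of [N] with the second term of the given presentation *)
have tau_ex n : exists v : T -> A, (forall j, v j * z j = v j) /\
    forall l, s0 l (i n) = \sum_j v j * r l j.
  apply: syz => [l|]; first exact: s0y.
  have -> : \sum_l s0 l (i n) * a l = iota (d0 (i n)) by exact: s0a.
  by rewrite (iffRL (id0 _)) ?linear0 //; exists n.
have [tau' tauP] := choice tau_ex.
have tauz n j : tau' n j * z j = tau' n j by case: (tauP n) => H _; exact: H.
have taur n l : s0 l (i n) = \sum_j tau' n j * r l j by case: (tauP n) => _; exact.
have taul j : linear (fun n => tau' n j : A^o).
  move=> k u v; apply: (rinj2 (v := fun j => tau' (k *: u + v) j)
     (w := fun j => k * tau' u j + tau' v j)) => [m|m|l]; first exact: tauz.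
    by rewrite mulrDl -mulrA !tauz.
  rewrite -taur linearP s0P !taur mulr_sumr -big_split; apply: eq_bigr => m _ /=.
  by rewrite mulrDl mulrA.
have /choice [p0 p0P] l : exists p0 : P0, iota (d0 p0) = a l.
  have [m mE] : exists m, iota m = a l.
    apply/iota_im; exists (fun k => (k == l)%:R).
    rewrite (bigD1 l) //= eqxx mul1r big1 ?addr0 // => k /negPf ->.
    by rewrite mul0r.
  by have [x xE] := d0S m; exists x; rewrite xE.
pose pp l := y l *: p0 l.
have ppP l : iota (d0 (pp l)) = a l by rewrite /pp !linearZ /= p0P; exact: ya.
have ypp l : y l *: pp l = pp l by rewrite /pp scalerA yy.
have rel_im j : exists n, i n = \sum_l r l j *: pp l.
  apply/id0; apply: iota_inj; rewrite linear0 !linear_comb.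
  by rewrite -[RHS](ra j); apply: eq_bigr => l _; rewrite ppP.
have /choice [n0 n0P] j : exists n1 : P1, i (p n1) = \sum_l r l j *: pp l.
  by have [n nE] := rel_im j; have [x xE] := pS n; exists x; rewrite xE.
pose n1 j := z j *: n0 j.
have n1P j : i (p (n1 j)) = \sum_l r l j *: pp l.
  rewrite /n1 !linearZ /= n0P scaler_sumr; apply: eq_bigr => l _.
  by rewrite scalerA zr.
have zn1 j : z j *: n1 j = n1 j by rewrite /n1 scalerA zz.
(* the homotopy *)
have hl : linear (fun x => \sum_l s0 l x *: pp l - x).
  move=> k u v; rewrite scalerBr scaler_sumr opprD addrACA -big_split; congr (_ + _).
  by apply: eq_bigr => l _; rewrite s0P scalerDl scalerA.
have ipl : linear (fun x => i (p x)) by move=> k u v; rewrite !linearP.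
have [|s sP] := projective_lift (g := mk_linear ipl) (f := mk_linear hl) projP0.
  move=> x; have [n nE] : exists n, i n = \sum_l s0 l x *: pp l - x.
    apply/id0; apply: iota_inj; rewrite linear0 !linearB !linear_comb -s0a.
    apply/eqP; rewrite subr_eq0; apply/eqP; apply: eq_bigr => l _.
    by rewrite ppP.
  by have [m mE] := pS n; exists m; rewrite !mk_linearE mE.
have {}sP x : i (p (s x)) = \sum_l s0 l x *: pp l - x by exact: sP.
have xil : linear (fun n => \sum_j tau' n j *: n1 j - s (i n)).
  move=> k u v; have -> : s (i (k *: u + v)) = k *: s (i u) + s (i v) by rewrite !linearP.
  rewrite scalerBr scaler_sumr opprD addrACA -big_split; congr (_ + _).
  by apply: eq_bigr => l _; rewrite [tau' _ _]taul scalerDl scalerA.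
pose xi := mk_linear xil.
have xiP n : p (xi n) = n.
  apply: i_inj; rewrite mk_linearE !linearB !linear_comb sP opprB addrCA -[RHS]addr0.
  congr (_ + _); apply/eqP; rewrite subr_eq0; apply/eqP.
  rewrite (eq_bigr (fun j => \sum_l (tau' n j * r l j) *: pp l)) => [|j _]; last first.
    by rewrite n1P scaler_sumr; apply: eq_bigr => l _; rewrite scalerA.
  rewrite exchange_big /=; apply: eq_bigr => l _.
  by rewrite -scaler_suml taur.
have xip x : x = \sum_j tau' (p x) j *: n1 j - s (d1 x).
  have [n xE] : exists n, xi n = x.
    apply: (psup [set x | exists n, xi n = x]%classic) => [|{}x]; first exact: image_submodule.
    exists (xi (p x)), (x - xi (p x)); split; first by exists (p x).
      by rewrite linearB xiP subrr.
    by rewrite addrC subrK.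
  have nE : n = p x by rewrite -xE xiP.
  by rewrite -[LHS]xE mk_linearE nE -d1E.
have tl j : linear (fun x => tau' (p x) j : A^o).
  by move=> k u v; rewrite linearP; exact: taul.
pose th j : adual rho P1 := Lhom (tl j).
have thE j x : (th j : lhom P1 A^o) x = tau' (p x) j by [].
have d1P j : d1 (n1 j) = \sum_l r l j *: pp l by rewrite d1E n1P.
exists (fun j => q (th j)); split.
- move=> j; rewrite -linearZ; congr (q _); apply: lhomP => x.
  by rewrite -[LHS]/((th j : lhom P1 A^o) x * (rho (sigma (z j)) : A)) rhoK; exact: tauz.
- move=> v; have [h <-] := qS v; exists (fun j => sigma ((h : lhom P1 A^o) (n1 j))).
  rewrite -linear_comb; apply/eqP; rewrite -subr_eq0 -linearB; apply/eqP/qK.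
  have hsl : linear (fun x => - (h : lhom P1 A^o) (s x) : A^o).
    move=> k u w; have -> : (h : lhom P1 A^o) (s (k *: u + w)) =
      k * (h : lhom P1 A^o) (s u) + (h : lhom P1 A^o) (s w) by rewrite !linearP.
    by rewrite opprD -mulrN.
  exists (Lhom hsl) => x.
  have hx : (h : lhom P1 A^o) x =
     \sum_j tau' (p x) j * (h : lhom P1 A^o) (n1 j) - (h : lhom P1 A^o) (s (d1 x)).
    by rewrite {1}[x]xip linearB linear_comb.
  transitivity ((h : lhom P1 A^o) x - \sum_j tau' (p x) j * (h : lhom P1 A^o) (n1 j)).
    congr (_ - _); rewrite [LHS]adual_comb; apply: eq_bigr => j _.
    by rewrite thE rhK.
  by rewrite hx addrAC subrr add0r.
have s0id : exists s' : T -> T -> A, (forall m j, s' m j * z j = s' m j) /\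
    forall m l, s0 l (pp m) = (l == m)%:R * y l + \sum_j s' m j * r l j.
  have H m : exists v : T -> A, (forall j, v j * z j = v j) /\
      forall l, s0 l (pp m) - (l == m)%:R * y l = \sum_j v j * r l j.
    apply: syz => [l|]; first by rewrite mulrBl s0y -mulrA yy.
    rewrite (eq_bigr _ (fun l _ => mulrBl _ _ _)) sumrB s0a ppP (bigD1 m) //= eqxx mul1r ya.
    by rewrite big1 ?addr0 ?subrr // => l /negPf ->; rewrite !mul0r.
  have [s' s'P] := choice H; exists s'; split=> m l; first by case: (s'P m) => H' _; exact: H'.
  by case: (s'P m) => _ <-; rewrite addrC subrK.
have [s' [s'z s'P]] := s0id.
have taun k j : tau' (p (n1 k)) j = (j == k)%:R * z k + \sum_m r m k * s' m j.
  move: j; apply: rinj2 => [j|j|l]; first exact: tauz.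
    rewrite mulrDl mulr_suml; congr (_ + _).
      by have [->|_] := eqVneq j k; rewrite ?mul0r // mul1r zz.
    by apply: eq_bigr => m _; rewrite -mulrA s'z.
  rewrite -taur n1P s0sum (eq_bigr (fun m => r m k * ((l == m)%:R * y l) +
      r m k * \sum_j s' m j * r l j)) => [|m _]; last by rewrite s'P mulrDr.
  rewrite big_split /= (bigD1 l) //= eqxx mul1r ry big1 ?addr0 => [|m]; last first.
    by rewrite eq_sym => /negPf ->; rewrite mul0r mulr0.
  have -> : \sum_j ((j == k)%:R * z k + \sum_m r m k * s' m j) * r l j =
      r l k + \sum_j (\sum_m r m k * s' m j) * r l j.
    rewrite -[r l k in RHS]zr (eq_bigr _ (fun j _ => mulrDl _ _ _)) big_split /=.
    rewrite (bigD1 k) //= eqxx mul1r [X in _ + X + _]big1 ?addr0 // => j /negPf ->.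
    by rewrite !mul0r.
  congr (_ + _); rewrite (eq_bigr (fun m => \sum_j r m k * s' m j * r l j)) => [|m _].
    by rewrite exchange_big; apply: eq_bigr => j _; rewrite mulr_suml.
  by rewrite mulr_sumr; apply: eq_bigr => j _; rewrite mulrA.
move=> g; split.
  rewrite -linear_comb => /qK [h0 h0P].
  have {}h0P x : \sum_j tau' (p x) j * rh (g j) = h0 (d1 x).
    by rewrite -h0P [RHS]adual_comb; apply: eq_bigr => j _; rewrite thE.
  exists (fun m => sigma ((h0 (pp m) : A) - \sum_j s' m j * rh (g j))) => k.
  apply: rh_inj; rewrite rhM rhK rh_sum.
  rewrite (eq_bigr (fun m => r m k * (h0 (pp m) : A) - r m k * \sum_j s' m j * rh (g j))) => [|m _].
    rewrite sumrB; have := h0P (n1 k); rewrite d1P linear_comb => <-.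
    rewrite (eq_bigr (fun j => (j == k)%:R * z k * rh (g j) + \sum_m r m k * s' m j * rh (g j))).
      rewrite big_split /= (bigD1 k) //= eqxx mul1r big1 ?addr0 => [|j /negPf ->]; last by rewrite !mul0r.
      rewrite exchange_big /= -addrA -sumrB big1 ?addr0 // => m _.
      by apply/eqP; rewrite subr_eq0 mulr_sumr; apply/eqP/eq_bigr => j _; rewrite mulrA.
    by move=> j _; rewrite taun mulrDl mulr_suml.
  by rewrite rhM !rhK mulrBr.
move=> [h hP]; rewrite -linear_comb; apply/qK.
have hl0 : linear (fun x => \sum_m s0 m x * rh (h m) : A^o).
  move=> k u v; rewrite scaler_sumr -big_split; apply: eq_bigr => m _ /=.
  by rewrite s0P mulrDl -mulrA.
exists (Lhom hl0) => x; rewrite [LHS]adual_comb.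
rewrite -[RHS]/(\sum_m s0 m (d1 x) * rh (h m)).
transitivity (\sum_j tau' (p x) j * (z j * rh (g j))).
  by apply: eq_bigr => j _; rewrite thE mulrA tauz.
rewrite (eq_bigr (fun j => \sum_m tau' (p x) j * r m j * rh (h m))) => [|j _].
  rewrite exchange_big; apply: eq_bigr => m _ /=.
  by rewrite -mulr_suml d1E taur.
have := congr1 rh (hP j); rewrite rhM rhK rh_sum => ->.
by rewrite mulr_sumr; apply: eq_bigr => m _; rewrite rhM rhK mulrA.
Qed.

End Transpose.

(** * Isomorphisms of algebras, and finite-dimensional quotients *)

Section AlgebraIsomorphisms.
Variable K : comPzRingType.
Implicit Types A B C L : kalg K.

Lemma alg_iso_kernel L A B (p : {rmorphism L -> A}) (q : {rmorphism L -> B}) :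
  (forall a, exists l, p l = a) -> (forall b, exists l, q l = b) ->
  (forall k, p (kscal L k) = kscal A k) -> (forall k, q (kscal L k) = kscal B k) ->
  (forall l, p l = 0 <-> q l = 0) -> alg_iso A B.
Proof.
move=> pS qS pk qk ker; have [s sP] := choice pS.
have key l l' : p l = p l' <-> q l = q l'.
  split=> /eqP; rewrite -subr_eq0 -rmorphB => /eqP /ker.
    by rewrite rmorphB => /eqP; rewrite subr_eq0 => /eqP.
  by rewrite rmorphB => /eqP; rewrite subr_eq0 => /eqP.
have qs l : q (s (p l)) = q l by apply/key; rewrite sP.
have fB : zmod_morphism (q \o s).
  by move=> a b; rewrite /= -rmorphB; apply/key; rewrite rmorphB !sP.
have fM : monoid_morphism (q \o s).
  split=> [|a b] /=; first by rewrite -(rmorph1 q); apply/key; rewrite sP rmorph1.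
  by rewrite -rmorphM; apply/key; rewrite rmorphM !sP.
pose f : {rmorphism A -> B} := HB.pack (q \o s) (GRing.isZmodMorphism.Build _ _ _ fB)
  (GRing.isMonoidMorphism.Build _ _ _ fM).
exists f; split=> [k|]; first by rewrite /= -pk qs qk.
have [t tP] := choice qS; exists (p \o t) => a /=.
  by rewrite -[RHS]sP; apply/key; rewrite tP.
by rewrite qs tP.
Qed.

Lemma alg_iso_sym A B : alg_iso A B -> alg_iso B A.
Proof.
move=> [f [fk [g fK gK]]]; apply: (@alg_iso_kernel A B A f idfun) => //.
- by move=> b; exists (g b).
- by move=> a; exists a.
- by move=> a; split=> /= [fa|->]; [rewrite -(fK a) fa -(rmorph0 f) fK | rewrite rmorph0].
Qed.

Lemma alg_iso_trans A B C : alg_iso A B -> alg_iso B C -> alg_iso A C.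
Proof.
move=> [f [fk fb]] [g [gk gb]]; exists (g \o f); split; last exact: bij_comp.
by move=> k /=; rewrite fk gk.
Qed.

Lemma endo_alg_iso A (M N : lmodType A) : mod_iso M N ->
  alg_iso (endo_alg M) (endo_alg N).
Proof.
move=> [f [g fK gK]].
have gl : linear g by move=> k u v; apply: (can_inj fK); rewrite linearP !gK.
have cl (h : lhom M M) : linear (fun n => f (h (g n))).
  by move=> k u v; rewrite gl !linearP.
pose c (h : endo_alg M) : endo_alg N := Lhom (cl h).
have cl' (h : lhom N N) : linear (fun n => g (h (f n))).
  by move=> k u v; rewrite !linearP gl.
have cB : zmod_morphism c by move=> h k; apply: lhomP => n; exact: linearB.
have cM : monoid_morphism c.
  split=> [|h k]; apply: lhomP => n; first exact: gK.
  by rewrite -[RHS]/(f ((k : lhom M M) (g (f ((h : lhom M M) (g n)))))) fK.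
pose cr : {rmorphism endo_alg M -> endo_alg N} := HB.pack c
  (GRing.isZmodMorphism.Build _ _ _ cB) (GRing.isMonoidMorphism.Build _ _ _ cM).
exists cr; split.
  by move=> k; apply: lhomP => n; rewrite -[LHS]/(f (kscal A k *: g n)) linearZ gK.
exists (fun h : endo_alg N => Lhom (cl' h) : endo_alg M) => h; apply: lhomP => n.
  by rewrite -[LHS]/(g (f ((h : lhom M M) (g (f n))))) !fK.
by rewrite -[LHS]/(f (g ((h : lhom N N) (f (g n))))) !gK.
Qed.

End AlgebraIsomorphisms.

(** A decreasing sequence of subspaces of a finite-dimensional space that meet in zero reaches
    zero.  The induction removes one spanning vector: once [U n] meets the span of the others
    in zero, it is at most a line. *)
Lemma decreasing_subspaces (K : fieldType) (V : lmodType K) m (v : 'I_m -> V)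
    (U : nat -> set V) :
  (forall n, is_submodule (U n)) ->
  (forall n u, U n u -> exists c : 'I_m -> K, u = \sum_i c i *: v i) ->
  (forall m n u, (m <= n)%N -> U n u -> U m u) ->
  (forall u, (forall n, U n u) -> u = 0) -> exists n, forall u, U n u -> u = 0.
Proof.
elim: m v U => [|m IHm] v U subU spanU decU U0.
  by exists 0%N => u /spanU [c ->]; rewrite big_ord0.
pose span' : set V := fun u => exists c : 'I_m -> K, u = \sum_i c i *: v (lift ord_max i).
have [||||N NP] := IHm (fun i => v (lift ord_max i)) (fun n => (U n `&` span')%classic).
- move=> n; have [Un0 UnD] := subU n; split.
    by split=> //; exists (fun=> 0); rewrite big1 // => i _; rewrite scale0r.
  move=> k x y [Ux [c xE]] [Uy [d yE]]; split; first exact: UnD.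
  exists (fun i => k * c i + d i); rewrite xE yE scaler_sumr -big_split.
  by apply: eq_bigr => i _; rewrite scalerDl scalerA.
- by move=> n u [].
- by move=> i j u ij [/(decU _ _ _ ij) Uu su].
- by move=> u Uu; apply: U0 => n; case: (Uu n).
have [N0|/existsNP [u /not_implyP [Uu u0]]] := pselect (forall u, U N u -> u = 0).
  by exists N.
have [n nu] : exists n, ~ U n u by apply/existsNP => H; apply: u0; exact: U0.
exists (maxn n N) => w Uw; apply: contrapT => w0; apply: nu.
have UNw : U N w by apply: decU Uw; exact: leq_maxr.
have {}Uw : U n w by apply: decU Uw; exact: leq_maxl.
have [[c uE] [d wE]] := (spanU _ _ Uu, spanU _ _ UNw).
have d0 : d ord_max != 0.
  apply/eqP => d0; apply: w0; apply: NP; split=> //.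
  exists (fun i => d (lift ord_max i)); rewrite {1}wE (bigD1_ord ord_max) //= d0.
  by rewrite scale0r add0r.
have e : - c ord_max *: w + d ord_max *: u = 0.
  apply: NP; split.
    have [UN0 UND] := subU N; apply: (UND _ _ _ UNw); rewrite -[_ *: u]addr0; exact: (UND _ _ _ Uu UN0).
  exists (fun i => - c ord_max * d (lift ord_max i) + d ord_max * c (lift ord_max i)).
  rewrite {1}wE {1}uE !(bigD1_ord ord_max (P := predT)) //= !scalerDr !scalerA.
  rewrite addrACA -scalerDl mulNr mulrC addNr scale0r add0r !scaler_sumr -big_split.
  by apply: eq_bigr => i _; rewrite scalerDl !scalerA.
have -> : u = (d ord_max)^-1 * c ord_max *: w + 0.
  move/eqP: e; rewrite addrC addr_eq0 scaleNr opprK => /eqP e.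
  by rewrite -scalerA -e scalerA mulVf // scale1r addr0.
by have [Un0 UnD] := subU n; exact: (UnD _ _ _ Uw Un0).
Qed.

(** A finite-dimensional quotient by a closed ideal is a quotient by an ideal containing a
    power of the radical. *)
Lemma radical_nilpotent (K : fieldType) (Q : quiver) (R : kalg K)
    (pi : {rmorphism cpath K Q -> R}) (S : set (cpath K Q)) :
  (forall b, exists f, pi f = b) -> (forall k, pi (cscal k) = kscal R k) ->
  (forall f, pi f = 0 <-> cl S f) -> finite_dimensional R ->
  exists N, forall f, ord N f -> cl S f.
Proof.
move=> piS pik ker [n [v vP]].
pose U m : set (restr_scal R^o) := fun u => exists f, ord m f /\ pi f = u.
have [||||N NP] := @decreasing_subspaces K (restr_scal R^o) n v U.
- move=> m; split; first by exists 0; split; [exact: ord_zero | exact: rmorph0].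
  move=> k _ _ [f [of_ <-]] [g [og <-]]; exists (cscal k * f + g).
  split; first by apply: ordD => //; exact: ordMl.
  by rewrite rmorphD rmorphM pik.
- by move=> m u _; exact: vP.
- by move=> i j u ij [f [of_ <-]]; exists f; split=> //; exact: ordW of_.
- move=> u Uu; have [f fu] := piS u; rewrite -fu; apply/ker/cl_closed => m.
  have [g [og gu]] := Uu m; exists (f - g); last by rewrite subKr.
  by apply/ker; rewrite rmorphB fu gu subrr.
by exists N => f of_; apply/ker/NP; exists f.
Qed.

(** * The endomorphism algebra of the mutated module *)

Section Core.
Variables (K : fieldType) (Q : quiver) (W : cpath K Q) (C : {set arrow Q}) (x : vertex Q).
Local Notation L := (cpath K Q).
Hypothesis oW : ord 2 W.
Hypothesis homW : forall y s, pcoef W y s != 0 -> count (mem C) s = 1%N.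
Hypothesis minW : min_rel W C.
Hypothesis srcx : forall a : arrow Q, tgt a = x -> a \in C.

Variables (R : kalg K) (pi : {rmorphism L -> R}).
Hypothesis piS : forall b, exists f, pi f = b.
Hypothesis pik : forall k, pi (cscal k) = kscal R k.
Hypothesis piker : forall f, pi f = 0 <-> cl (relset W C) f.
Hypothesis fdR : finite_dimensional R.

Let T : finType := arrow Q.
(** The images in [R] of the idempotents, arrows and relations at the source. *)
Definition cor_e : R := pi (vtx x).
Definition cor_a i : R := pi (out_arrow K x i).
Definition cor_y i : R := pi (out_vtx K x i).
Definition cor_z j : R := pi (in_vtx K x j).
Definition cor_r i j : R := pi (rel_entry W x i j).

Local Notation e_ := cor_e.
Local Notation a_ := cor_a.
Local Notation y_ := cor_y.
Local Notation z_ := cor_z.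
Local Notation r_ := cor_r.

Let pi_eq f g : cl (relset W C) (f - g) -> pi f = pi g.
Proof. by move/piker/eqP; rewrite rmorphB subr_eq0 => /eqP. Qed.

Lemma cor_zz j : z_ j * z_ j = z_ j.
Proof. by rewrite -rmorphM z_idem. Qed.

Lemma cor_yy i : y_ i * y_ i = y_ i.
Proof.
rewrite -rmorphM; congr (pi _); apply: cpathP => v s; rewrite /out_vtx.
case: ifP => _; last by rewrite mulr0.
by rewrite pcoef_vtxl pcoef_vtx; case: eqP; rewrite ?mul1r ?mul0r.
Qed.

Lemma cor_ay i : a_ i * y_ i = a_ i.
Proof.
rewrite -rmorphM; congr (pi _); apply: cpathP => v s; rewrite /out_vtx /out_arrow.
case: ifP => _; last by rewrite mulr0.
rewrite pcoef_vtxr pcoef_arrow; case: (v =P _) => [->|]; last by rewrite mulr0.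
by case: (s =P _) => [->|]; rewrite ?mulr0 // /walk_end /= eqxx mulr1.
Qed.

Lemma cor_yr i j : y_ i * r_ i j = r_ i j.
Proof. by rewrite -rmorphM (yv_r oW homW minW srcx). Qed.

Lemma cor_rz i j : r_ i j * z_ j = r_ i j.
Proof. by rewrite -rmorphM (r_z oW homW minW srcx). Qed.

Lemma cor_ar j : \sum_i a_ i * r_ i j = 0.
Proof.
have [jx|jx] := eqVneq (tgt j) x.
  rewrite (eq_bigr (fun i => pi (out_arrow K x i * rel_entry W x i j))) => [|i _]; last by rewrite rmorphM.
  by rewrite -rmorph_sum -(D_in oW homW) //; apply/piker; exact: D_I.
by apply: big1 => i _; rewrite /cor_r /rel_entry (negPf jx) andbF rmorph0 mulr0.
Qed.

Lemma cor_ea i : e_ * a_ i = a_ i.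
Proof.
rewrite -rmorphM; congr (pi _); apply: cpathP => v s; rewrite pcoef_vtxl /out_arrow.
case: (src i =P x) => [ix|_]; last by rewrite pcoef0 mulr0.
by rewrite pcoef_arrow ix; case: eqP; rewrite ?mul1r ?mulr0.
Qed.

Lemma cor_ee : e_ * e_ = e_.
Proof.
rewrite -rmorphM; congr (pi _); apply: cpathP => v s.
by rewrite pcoef_vtxl pcoef_vtx; case: eqP; rewrite ?mul1r ?mul0r.
Qed.

Lemma cor_ye i : y_ i * e_ = 0.
Proof.
rewrite -rmorphM -(rmorph0 pi); congr (pi _); apply: cpathP => v s.
rewrite pcoef0 pcoef_vtxr /out_vtx; case: (src i =P x) => [ix|_]; last by rewrite pcoef0 mulr0.
rewrite pcoef_vtx; case: (v =P tgt i) => [vi|]; last by rewrite mulr0.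
case: (s =P [::]) => [->|]; last by rewrite mulr0.
by rewrite /walk_end /= vi (negPf (tgt_out oW homW minW srcx ix)) mul0r.
Qed.

Lemma cor_ez j : e_ * z_ j = 0.
Proof.
rewrite -rmorphM -(rmorph0 pi); congr (pi _); apply: cpathP => v s.
rewrite pcoef0 pcoef_vtxl /in_vtx; case: (tgt j =P x) => [ix|_]; last by rewrite pcoef0 mulr0.
rewrite pcoef_vtx; case: (v =P x) => [->|]; last by rewrite mul0r.
by rewrite [x == _]eq_sym (negPf (src_in oW homW minW srcx ix)) mulr0.
Qed.

(** The corner at the source: [R e] is a line. *)
Lemma cor_line b : exists k, b * e_ = kscal R k * e_.
Proof.
have [f <-] := piS b; exists (pcoef f x [::]); rewrite -pik -!rmorphM; apply: pi_eq.
exact: vtx_x_r.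
Qed.

(** The paths starting at [x] are sorted by their first arrow; of those ending at [x], only
    the trivial one survives in [R], by [vtx_x_r]. *)
Lemma cor_dec b : exists k (u : T -> R), [/\ b * e_ = kscal R k * e_,
  forall i, y_ i * u i = u i & e_ * b = kscal R k * e_ + \sum_i a_ i * u i].
Proof.
have [f <-] := piS b; exists (pcoef f x [::]), (fun i => y_ i * pi (ldiv i f)); split.
- by rewrite -pik -!rmorphM; apply: pi_eq; exact: vtx_x_r.
- by move=> i; rewrite mulrA cor_yy.
rewrite (eq_bigr (fun i => pi (out_arrow K x i * ldiv i f))) => [|i _]; last first.
  by rewrite mulrA cor_ay rmorphM.
rewrite -pik -!rmorphM -rmorph_sum -rmorphD; congr (pi _); apply: cpathP => v s.
rewrite pcoef_vtxl pcoefD pcoef_scal pcoef_vtx pcoef_sum; case: s => [|b' s].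
  rewrite big1 => [|i _]; last by rewrite /out_arrow; case: ifP; rewrite ?pcoef_arrowl_nil // mul0r pcoef0.
  by case: (v =P x) => [->|]; rewrite ?mul0r ?mulr0 ?addr0 // mul1r mulr1.
rewrite andbF mulr0 add0r (bigD1 b') //= big1 ?addr0 => [|i ib]; last first.
  rewrite /out_arrow; case: ifP => _; last by rewrite mul0r pcoef0.
  by rewrite pcoef_arrowl [b' == i]eq_sym (negPf ib) andbF mul0r.
have [ve|ve] := eqVneq v (src b'); last first.
  rewrite pcoef_out /= 1?eq_sym ?(negPf ve) // mulr0 /out_arrow; case: ifP => _; last by rewrite mul0r pcoef0.
  by rewrite pcoef_arrowl (negPf ve) mul0r.
rewrite ve /out_arrow; case: eqP => _; last by rewrite !mul0r pcoef0.
by rewrite pcoef_arrowl !eqxx !mul1r pcoef_ldiv eqxx mul1r.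
Qed.

Lemma cor_e_neq0 : e_ != 0.
Proof.
have [N hN] := radical_nilpotent piS pik piker fdR.
apply/eqP => /piker /(I_at_source oW homW minW srcx hN) [].
by rewrite pcoef_vtx !eqxx => /eqP; rewrite oner_eq0.
Qed.

Lemma cor_syz (u : T -> R) : (forall i, y_ i * u i = u i) -> \sum_i a_ i * u i = 0 ->
  exists v : T -> R, (forall j, z_ j * v j = v j) /\ forall i, u i = \sum_j r_ i j * v j.
Proof.
have [N hN] := radical_nilpotent piS pik piker fdR.
move=> uy ua; have [f fu] := choice (fun i => piS (u i)).
have [|v vP] := relations_at_source oW homW minW srcx hN (u := f).
  apply/piker; rewrite rmorph_sum -[RHS]ua; apply: eq_bigr => i _.
  by rewrite rmorphM fu.
exists (fun j => z_ j * pi (v j)); split=> [j|i]; first by rewrite mulrA cor_zz.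
rewrite -uy -fu -rmorphM (pi_eq (vP i)) rmorph_sum; apply: eq_bigr => j _.
by rewrite rmorphM mulrA cor_rz.
Qed.

(** What remains of the bound on the global dimension: a projection of [R ^ T] onto the
    syzygies of the relations. *)
Definition syzygy_projection := exists rho : T -> T -> R,
  (forall i k, \sum_j r_ i j * rho j k = 0) /\
  (forall v : T -> R, (forall j, z_ j * v j = v j) -> (forall i, \sum_j r_ i j * v j = 0) ->
     forall j, \sum_k rho j k * v k = v j).

(** Minimality of the relations and the projection on their syzygies leave no syzygies, by
    [relations_independent]. *)
Lemma cor_rinj : syzygy_projection ->
  forall v : T -> R, (forall j, z_ j * v j = v j) ->
    (forall i, \sum_j r_ i j * v j = 0) -> forall j, v j = 0.
Proof.
have [N hN] := radical_nilpotent piS pik piker fdR.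
move=> [rho [rrho rhov]] v vz rv j.
have [g gP] := choice (fun p : T * T => piS (rho p.1 p.2)).
have [f fP] := choice (fun i => piS (v i)).
pose rho' i k : L := in_vtx K x i * g (i, k) * in_vtx K x k.
have pirho' i k : pi (rho' i k) = z_ i * rho i k * z_ k by rewrite !rmorphM gP.
have zf i : pi (in_vtx K x i * f i) = v i by rewrite rmorphM fP vz.
rewrite -zf; apply/piker.
refine (relations_independent oW homW minW srcx hN (rho := rho') _ _ _
  (v := fun i => in_vtx K x i * f i) _ _ j).
- by move=> i k; rewrite /rho' -!mulrA z_idem 2!mulrA z_idem !mulrA.
- move=> i k; apply/piker; rewrite rmorph_sum -[RHS](mul0r (z_ k)) -[X in X * _](rrho i k) mulr_suml.
  by apply: eq_bigr => l _; rewrite rmorphM pirho' !mulrA cor_rz.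
- move=> w zw rw i; apply/piker; rewrite rmorphB; apply/eqP; rewrite subr_eq0; apply/eqP.
  have zw' k : z_ k * pi (w k) = pi (w k) by rewrite -rmorphM zw.
  rewrite rmorph_sum -[RHS]zw' -(rhov (fun k => pi (w k)) zw') ?mulr_sumr => [|l].
    by apply: eq_bigr => k _; rewrite rmorphM pirho' -!mulrA zw'.
  rewrite -[RHS](iffRL (piker _) (rw l)) rmorph_sum.
  by apply: eq_bigr => k _; rewrite rmorphM.
- by move=> i; rewrite mulrA z_idem.
- move=> i; apply/piker; rewrite rmorph_sum -[RHS](rv i).
  by apply: eq_bigr => k _; rewrite rmorphM zf.
Qed.

Hypothesis H2 : syzygy_projection.
Hypothesis H3 : forall w : T -> R, (forall i, w i * y_ i = w i) ->
  (forall j, \sum_i w i * r_ i j = 0) -> exists b, forall i, w i = b * a_ i.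

Variables (V U : lmodType R) (t : T -> V) (u0 : U).
Hypothesis tP : presents cor_z cor_r t.
Hypothesis eu0 : e_ *: u0 = 0.
Hypothesis Ugen : forall u, exists b, u = b *: u0.
Hypothesis Ufree : forall b, b *: u0 = 0 -> b * (1 - e_) = 0.

Let sumdelta (M : lmodType R) (F : T -> M) j : \sum_k (k == j)%:R *: F k = F j.
Proof.
rewrite (bigD1 j) //= eqxx scale1r big1 ?addr0 // => k /negPf ->.
by rewrite scale0r.
Qed.

Let kC k b c : b * (kscal R k * c) = kscal R k * (b * c).
Proof. by rewrite mulrA -kscalC mulrA. Qed.

Let sumdeltaR (F : T -> R) j : \sum_k (k == j)%:R * F k = F j.
Proof. exact: (@sumdelta R^o). Qed.

Lemma rel_t i : \sum_j r_ i j *: t j = 0.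
Proof.
have [_ _ relP] := tP; apply: (relP (r_ i)).2; exists (fun l => (l == i)%:R) => j.
by rewrite cor_rz (sumdeltaR (fun l => r_ l j)).
Qed.

(** If the generators [t j] vanish, the identity factors through the matrix [r] up to rows
    killed by [r].  By [H3] these rows come from the line [R e] and vanish at the other
    vertices, so the relation [\sum_i a i * r i j = 0] forces all [a i] to be zero. *)
Lemma presented_neq0 : (exists i, a_ i <> 0) -> exists v : V, v <> 0.
Proof.
move=> [i0 ai0]; apply: contrapT => V0.
have {}V0 (v : V) : v = 0 by apply: contrapT => v0; apply: V0; exists v.
have [_ _ relP] := tP.
have /choice [H HP] j : exists h : T -> R, forall k, (k == j)%:R * z_ k = \sum_i h i * r_ i k.
  by apply: (relP (fun k => (k == j)%:R)).1; exact: (etrans (sumdelta t j) (V0 _)).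
pose w i l := (i == l)%:R * y_ l - \sum_j r_ i j * H j l * y_ l.
have wy i l : w i l * y_ l = w i l.
  rewrite /w mulrBl -mulrA cor_yy mulr_suml; congr (_ - _).
  by apply: eq_bigr => j _; rewrite -[LHS]mulrA cor_yy.
have wr i k : \sum_l w i l * r_ l k = 0.
  rewrite (eq_bigr _ (fun l _ => mulrBl _ _ _)) sumrB.
  rewrite (eq_bigr (fun l => (l == i)%:R * r_ l k)) => [|l _]; last first.
    by rewrite -mulrA cor_yr eq_sym.
  rewrite (sumdeltaR (fun l => r_ l k)).
  rewrite [X in _ - X](eq_bigr (fun l => \sum_j r_ i j * (H j l * r_ l k))) => [|l _]; last first.
    by rewrite mulr_suml; apply: eq_bigr => j _; rewrite -!mulrA cor_yr.
  rewrite exchange_big /= (eq_bigr (fun j => r_ i j * ((k == j)%:R * z_ k))) => [|j _]; last first.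
    by rewrite HP mulr_sumr.
  rewrite (bigD1 k) //= eqxx mul1r cor_rz big1 ?addr0 ?subrr // => j.
  by rewrite eq_sym => /negPf ->; rewrite mul0r mulr0.
have w0 i l : w i l = 0.
  have [b bP] := H3 (wy i) (wr i); have [c cP] := cor_line b.
  have -> : w i l = y_ i * w i l.
    rewrite /w mulrBr mulr_sumr; congr (_ - _).
      by have [->|_] := eqVneq i l; rewrite ?mul0r ?mulr0 // mul1r cor_yy.
    by apply: eq_bigr => j _; rewrite !mulrA cor_yr.
  by rewrite bP -cor_ea !mulrA -[_ * b * e_]mulrA cP mulrA -kscalC -[_ * y_ i * e_]mulrA cor_ye mulr0 mul0r.
apply: ai0; rewrite -[LHS]cor_ay -[LHS](sumdeltaR (fun i => a_ i * y_ i0) i0).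
rewrite (eq_bigr (fun i => \sum_j a_ i * r_ i j * (H j i0 * y_ i0))) => [|i _].
  rewrite exchange_big big1 // => j _ /=.
  by rewrite -mulr_suml cor_ar mul0r.
transitivity (a_ i * ((i == i0)%:R * y_ i0)).
  by case: (i == i0); rewrite ?mul1r ?mul0r ?mulr0.
have /eqP := w0 i i0; rewrite subr_eq0 => /eqP ->.
by rewrite mulr_sumr; apply: eq_bigr => j _; rewrite !mulrA.
Qed.

(** Endomorphisms of the new summand are scalars: lifted to the presentation, an endomorphism
    differs by a homotopy from a scalar, which is read off on the line [R e]. *)
Lemma presented_endo (phi : {linear V -> V}) : exists k, forall v, phi v = kscal R k *: v.
Proof.
have [zt genP relP] := tP; have [g0 g0P] := choice (fun j => genP (phi (t j))).
pose g j k := z_ j * g0 j k * z_ k.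
have gP j : phi (t j) = \sum_k g j k *: t k.
  rewrite -{1}zt linearZ /= g0P scaler_sumr; apply: eq_bigr => k _.
  by rewrite -{1}zt !scalerA.
have zg j k : z_ j * g j k = g j k by rewrite /g !mulrA cor_zz.
have gz j k : g j k * z_ k = g j k by rewrite /g -!mulrA cor_zz.
have /choice [h0 h0P] i : exists h : T -> R, forall k,
    (\sum_j r_ i j * g j k) * z_ k = \sum_l h l * r_ l k.
  apply: (relP (fun k => \sum_j r_ i j * g j k)).1.
  have phi0 : \sum_j r_ i j *: phi (t j) = 0 by rewrite -linear_comb rel_t linear0.
  rewrite -[RHS]phi0.
  rewrite [RHS](eq_bigr (fun j => \sum_k (r_ i j * g j k) *: t k)) => [|j _].
    by rewrite [RHS]exchange_big /=; apply: eq_bigr => k _; rewrite scaler_suml.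
  by rewrite gP scaler_sumr; apply: eq_bigr => k _; rewrite scalerA.
pose h i l := y_ i * h0 i l * y_ l.
have hP i k : \sum_j r_ i j * g j k = \sum_l h i l * r_ l k.
  transitivity (y_ i * ((\sum_j r_ i j * g j k) * z_ k)).
    rewrite mulr_suml mulr_sumr; apply: eq_bigr => j _.
    by rewrite -[_ * g j k * _]mulrA gz mulrA cor_yr.
  by rewrite h0P mulr_sumr; apply: eq_bigr => l _; rewrite /h -!mulrA cor_yr.
have hy i l : h i l * y_ l = h i l by rewrite /h -!mulrA cor_yy.
have yh i l : y_ i * h i l = h i l by rewrite /h !mulrA cor_yy.
have [b bP] : exists b, forall l, \sum_i a_ i * h i l = b * a_ l.
  apply: H3 => [l|k].
    by rewrite mulr_suml; apply: eq_bigr => i _; rewrite -mulrA hy.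
  rewrite (eq_bigr (fun l => \sum_i a_ i * (h i l * r_ l k))) => [|l _]; last first.
    by rewrite mulr_suml; apply: eq_bigr => i _; rewrite mulrA.
  rewrite exchange_big /= (eq_bigr (fun i => \sum_j a_ i * r_ i j * g j k)) => [|i _].
    by rewrite exchange_big big1 // => j _; rewrite -mulr_suml cor_ar mul0r.
  by rewrite -mulr_sumr -hP mulr_sumr; apply: eq_bigr => j _; rewrite mulrA.
have [k kP] := cor_line b; exists k.
have {}bP l : \sum_i a_ i * h i l = kscal R k * a_ l.
  by rewrite bP -cor_ea !mulrA kP.
have /choice [s sP] l : exists s : T -> R, (forall j, z_ j * s j = s j) /\
    forall i, h i l - kscal R k * ((i == l)%:R * y_ l) = \sum_j r_ i j * s j.
  apply: cor_syz => [i|].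
    rewrite mulrBr yh kC; congr (_ - _ * _).
    by have [->|_] := eqVneq i l; rewrite ?mul0r ?mulr0 // mul1r cor_yy.
  rewrite (eq_bigr (fun i => a_ i * h i l - kscal R k * ((i == l)%:R * (a_ i * y_ l)))) => [|i _].
    by rewrite sumrB bP -mulr_sumr (sumdeltaR (fun i => a_ i * y_ l)) cor_ay subrr.
  rewrite mulrBr kC; congr (_ - _ * _).
  by case: (i == l); rewrite ?mul1r ?mul0r ?mulr0.
have gE j m : g j m = kscal R k * ((j == m)%:R * z_ m) + \sum_l s l j * r_ l m.
  apply/eqP; rewrite -subr_eq0; apply/eqP; move: j.
  apply: (cor_rinj H2) => [j|i].
    rewrite mulrBr mulrDr zg kC; congr (_ - (_ * _ + _)).
      by have [->|_] := eqVneq j m; rewrite ?mul0r ?mulr0 // mul1r cor_zz.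
    by rewrite mulr_sumr; apply: eq_bigr => l _; case: (sP l) => H _; rewrite mulrA H.
  rewrite (eq_bigr (fun j => r_ i j * g j m -
    (kscal R k * ((j == m)%:R * (r_ i j * z_ m)) + \sum_l r_ i j * s l j * r_ l m))); last first.
    move=> j _; rewrite mulrBr mulrDr kC mulr_sumr; congr (_ - (_ * _ + _)).
      by case: (j == m); rewrite ?mul1r ?mul0r ?mulr0.
    by apply: eq_bigr => l _; rewrite mulrA.
  rewrite sumrB big_split /= -mulr_sumr (sumdeltaR (fun j => r_ i j * z_ m)) cor_rz.
  rewrite hP exchange_big /= (eq_bigr (fun l => h i l * r_ l m)) => [|l _]; last by [].
  rewrite [X in _ - (_ + X)](eq_bigr (fun l =>
     h i l * r_ l m - kscal R k * ((l == i)%:R * r_ l m))) => [|l _]; last first.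
    case: (sP l) => _ /(_ i) e; rewrite -mulr_suml -e mulrBl -!mulrA cor_yr.
    by rewrite eq_sym.
  rewrite sumrB -mulr_sumr (sumdeltaR (fun l => r_ l m)).
  by rewrite [kscal R k * _ + _]addrC subrK subrr.
move=> v; have [c ->] := genP v.
rewrite linear_comb scaler_sumr; apply: eq_bigr => j _.
rewrite gP scalerA kscalC -scalerA; congr (_ *: _).
rewrite (eq_bigr (fun m => kscal R k *: ((m == j)%:R *: t m) +
  \sum_l (s l j * r_ l m) *: t m)) => [|m _].
  rewrite big_split /= -scaler_sumr sumdelta exchange_big /= big1 ?addr0 // => l _.
  rewrite (eq_bigr (fun m => s l j *: (r_ l m *: t m))) => [|m _]; last by rewrite scalerA.
  by rewrite -scaler_sumr rel_t scaler0.
rewrite gE scalerDl scaler_suml; congr (_ + _).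
by rewrite -!scalerA zt eq_sym.
Qed.

(** A map from [V] to [R * (1 - e)] is a column killed by the matrix [r], which is injective. *)
Lemma presented_hom0 (psi : {linear V -> U}) v : psi v = 0.
Proof.
have [zt genP relP] := tP.
have [b0 b0P] := choice (fun j => Ugen (psi (t j))).
pose b j := z_ j * b0 j * (1 - e_).
have bP j : psi (t j) = b j *: u0.
  by rewrite -{1}zt linearZ /= b0P /b scalerA mulrBr mulr1 scalerBl -[(_ * e_) *: _]scalerA eu0 scaler0 subr0.
have b_0 : forall j, b j = 0.
  apply: (cor_rinj H2) => [j|i]; first by rewrite /b !mulrA cor_zz.
  have -> : \sum_j r_ i j * b j = (\sum_j r_ i j * b j) * (1 - e_).
    rewrite mulr_suml; apply: eq_bigr => j _; rewrite /b -!mulrA; congr (_ * (_ * (_ * _))).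
    by rewrite mulrBl mul1r mulrBr mulr1 cor_ee subrr subr0.
  apply: Ufree; rewrite scaler_suml -[RHS](linear0 psi) -[X in psi X](rel_t i) linear_comb.
  by apply: eq_bigr => j _; rewrite bP scalerA.
have [c ->] := genP v; rewrite linear_comb big1 // => j _.
by rewrite bP b_0 scale0r scaler0.
Qed.

Variables (B : kalg K) (piB : {rmorphism L -> B}).
Hypothesis piBS : forall b, exists f, piB f = b.
Hypothesis piBk : forall k, piB (cscal k) = kscal B k.
Hypothesis piBker : forall f, piB f = 0 <-> cl (relset W (mu_plus x C)) f.

(** The endomorphism of [V * U] attached to an element of the path algebra: a scalar on [V], on
    [U] right multiplication by the paths avoiding [x], and from [U] to [V] the paths reaching
    [x] with their last arrow [c], which acts as the generator [t c]. *)
Theorem core_endo_alg : (exists i, a_ i <> 0) -> alg_iso (endo_alg (V * U)%type) B.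
Proof.
move=> /presented_neq0 [v0 v00]; have [zt genP relP] := tP.
have [N hN] := radical_nilpotent piS pik piker fdR.
have ce2 : (1 - e_) * (1 - e_) = 1 - e_.
  by rewrite mulrBl mul1r mulrBr mulr1 cor_ee subrr subr0.
have [b0 b0P] := choice Ugen; pose iota u := b0 u * (1 - e_).
have iotaP u : iota u *: u0 = u.
  by rewrite /iota mulrBr mulr1 scalerBl -scalerA eu0 scaler0 subr0 -b0P.
have iota_co u : iota u * (1 - e_) = iota u by rewrite /iota -mulrA ce2.
have Ufree2 b c : b *: u0 = c *: u0 -> b * (1 - e_) = c * (1 - e_).
  move=> bc; apply/eqP; rewrite -subr_eq0 -mulrBl; apply/eqP/Ufree.
  by rewrite scalerBl bc subrr.
have iotaE b : iota (b *: u0) = b * (1 - e_).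
  by rewrite -iota_co; apply: Ufree2; rewrite iotaP.
have iota_lin k u w : iota (k *: u + w) = k * iota u + iota w.
  rewrite -[LHS]iota_co (@Ufree2 _ (k * iota u + iota w)).
    by rewrite mulrDl -mulrA !iota_co.
  by rewrite iotaP scalerDl -scalerA !iotaP.
pose chi f : K := pcoef f x [::].
pose om f : R := pi (avoiding x f).
pose nu f : V := \sum_c pi (arriving x c f) *: t c.
have Phil f : linear (fun p : V * U =>
    (kscal R (chi f) *: p.1 + iota p.2 *: nu f, (iota p.2 * om f) *: u0) : V * U).
  move=> k [v u] [w u']; congr (_, _) => /=.
    rewrite iota_lin !scalerDr !scalerDl addrACA !scalerA kscalC.
    by rewrite -!scalerA.
  by rewrite iota_lin mulrDl scalerDl !scalerA mulrA.
pose Phi f : endo_alg (V * U)%type := Lhom (Phil f).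
have PhiE f p : (Phi f : lhom _ _) p =
  (kscal R (chi f) *: p.1 + iota p.2 *: nu f, (iota p.2 * om f) *: u0) by [].
have chiB f g : chi (f - g) = chi f - chi g by exact: pcoefB.
have omB f g : om (f - g) = om f - om g by rewrite /om avB rmorphB.
have gcB c f g : arriving x c (f - g) = arriving x c f - arriving x c g.
  by apply/eqP; rewrite -subr_eq opprK -gcD subrK.
have nuB f g : nu (f - g) = nu f - nu g.
  by rewrite /nu -sumrB; apply: eq_bigr => c _; rewrite gcB rmorphB scalerBl.
have om_co f : om f * (1 - e_) = om f.
  rewrite mulrBr mulr1 -rmorphM; suff -> : avoiding x f * vtx x = 0 by rewrite rmorph0 subr0.
  apply: cpathP => y s; rewrite pcoef_vtxr pcoef_av pcoef0; case: eqP => [e|]; last by rewrite mul0r.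
  rewrite mul1r; suff -> : avoids x y s = false by rewrite mul0r.
  apply/negbTE; rewrite /avoids negb_and negbK; case/lastP: s e => [|s a] e; first by rewrite (e : y = x) eqxx.
  by rewrite all_rcons -(walk_end_rcons y s a) e eqxx orbT.
have co_av f : (1 - e_) * pi (avoiding x f) = pi (avoiding x f).
  rewrite mulrBl mul1r -rmorphM; suff -> : vtx x * avoiding x f = 0 by rewrite rmorph0 subr0.
  apply: cpathP => y s; rewrite pcoef_vtxl pcoef_av pcoef0 /avoids.
  by case: eqP; rewrite ?mul0r ?mulr0.
have co_nu f : (1 - e_) *: nu f = nu f.
  rewrite /nu scaler_sumr; apply: eq_bigr => c _; rewrite scalerA.
  by rewrite -gc_av co_av.
have gc_zero c f : (tgt c = x -> forall y s, pcoef f y (rcons s c) = 0) -> arriving x c f = 0.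
  move=> H; rewrite /arriving; case: eqP => // cx; suff -> : rdiv c f = 0 by rewrite av0.
  by apply: cpathP => y s; rewrite pcoef_rdiv pcoef0 H.
have gc_sum c (F : T -> L) : arriving x c (\sum_b F b) = \sum_b arriving x c (F b).
  by apply: (big_morph (arriving x c)) => [f g|]; [exact: gcD | exact: gc0].
have av_cscal k : avoiding x (cscal k) = cscal k * (1 - vtx x) :> L.
  apply: cpathP => y s; rewrite pcoef_av pcoef_scal pcoef_cscal pcoefB pcoef_one pcoef_vtx.
  case: s => [|a s]; last by rewrite andbF subr0 !mulr0.
  by rewrite /avoids /= !andbT mulr1; case: eqP; rewrite ?subrr ?subr0 ?mulr0 ?mul0r ?mulr1 ?mul1r.
have PhiB : zmod_morphism Phi.
  move=> f g; apply: lhomP => -[v u]; rewrite -[RHS]/((Phi f : lhom _ _) (v, u) - (Phi g : lhom _ _) (v, u)).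
  rewrite !PhiE /= chiB omB nuB (raddfB (kscal R)) scalerBl scalerBr mulrBr scalerBl.
  by congr (_, _); rewrite /= opprD addrACA.
have PhiM : monoid_morphism Phi.
  split=> [|f g]; apply: lhomP => -[v u].
    rewrite PhiE /chi /om /nu pcoef_one eqxx rmorph1 scale1r big1 => [|c _].
      rewrite scaler0 addr0 /=; congr (_, _).
      have -> : pi (avoiding x 1) = 1 - e_.
        by rewrite -[in avoiding x 1]cscal1 av_cscal cscal1 mul1r rmorphB rmorph1.
      by rewrite iota_co iotaP.
    rewrite gc_zero ?rmorph0 ?scale0r // => _ y s.
    by rewrite pcoef_one -size_eq0 size_rcons.
  rewrite -[RHS]/((Phi g : lhom _ _) ((Phi f : lhom _ _) (v, u))) !PhiE /=.
  have -> : chi (f * g) = chi g * chi f by rewrite /chi pcoef_mul_nil mulrC.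
  have -> : om (f * g) = om f * om g by rewrite /om avM rmorphM.
  have -> : nu (f * g) = om f *: nu g + kscal R (chi g) *: nu f.
    rewrite /nu !scaler_sumr -big_split; apply: eq_bigr => c _ /=.
    by rewrite gcM rmorphD !rmorphM pik scalerDl !scalerA.
  congr (_, _).
    rewrite iotaE -[_ * om f * _]mulrA om_co !scalerDr !scalerA -addrA rmorphM.
    by rewrite -[iota u * kscal R _]kscalC [X in _ + X]addrC.
  by rewrite iotaE -[_ * om f * _]mulrA om_co mulrA.
pose Phir : {rmorphism cpath_alg K Q -> endo_alg (V * U)%type} := HB.pack Phi
  (GRing.isZmodMorphism.Build _ _ _ PhiB) (GRing.isMonoidMorphism.Build _ _ _ PhiM).
apply: (@alg_iso_kernel _ (cpath_alg K Q) _ _ Phir piB) => //.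
(* an endomorphism is a scalar on [V] and is determined on [U] by the image of [u0], whose
   components provide the parts of a preimage *)
- move=> theta; pose th : {linear (V * U)%type -> (V * U)%type} := lhom_fun (theta : lhom _ _).
  have inl_lin : linear (fun v : V => (v, 0 : U)).
    by move=> k v w; congr (_, _); rewrite /= scaler0 addr0.
  have phil : linear (fun v => (th (v, 0)).1).
    by move=> k v w; rewrite inl_lin linearP.
  have psil : linear (fun v => (th (v, 0)).2).
    by move=> k v w; rewrite inl_lin linearP.
  have [k kP] := presented_endo (mk_linear phil).
  have th1 v : th (v, 0) = (kscal R k *: v, 0).
    by rewrite [LHS]surjective_pairing; congr (_, _); [exact: kP | exact: (presented_hom0 (mk_linear psil))].
  set n0 := (th (0, u0)).1; set m0 := (th (0, u0)).2.
  have eth : e_ *: th (0, u0) = 0.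
    rewrite -linearZ /=; have -> : e_ *: ((0, u0) : V * U) = 0; last exact: linear0.
    by congr (_, _); rewrite /= ?scaler0.
  have en0 : e_ *: n0 = 0 by rewrite -[LHS]/(e_ *: th (0, u0)).1 eth.
  have em0 : e_ *: m0 = 0 by rewrite -[LHS]/(e_ *: th (0, u0)).2 eth.
  have [w wE] := piS (iota m0).
  have ew : e_ * iota m0 = 0.
    by rewrite -iota_co mulrA; apply: Ufree; rewrite -scalerA iotaP.
  have [g0 g0E] := genP n0.
  have [g gE] := choice (fun c => piS (g0 c)).
  pose arr c : L := if tgt c == x then arrow_elt K c else 0.
  exists (cscal k * vtx x + avoiding x w + \sum_c avoiding x (g c) * arr c).
  have gc_arr c b : arriving x c (arr b) = (c == b)%:R * in_vtx K x c.
    rewrite /arriving /arr /in_vtx; case: (tgt c =P x) => [cx|_]; last by rewrite mulr0.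
    case: (tgt b =P x) => [bx|bx]; last first.
      have [cb|_] := eqVneq c b; first by case: bx; rewrite -cb.
      by rewrite mul0r (_ : rdiv c 0 = 0) ?av0 //; apply: cpathP => y s; rewrite pcoef_rdiv !pcoef0.
    apply: cpathP => y s; rewrite pcoef_av pcoef_rdiv pcoef_arrow.
    have -> : (rcons s c == [:: b]) = (s == [::]) && (c == b).
      by rewrite -[[:: b]]/(rcons [::] b) eqseq_rcons.
    have [<-|_] := eqVneq c b; last by rewrite mul0r !andbF mulr0 pcoef0.
    rewrite mul1r pcoef_vtx andbT /avoids; case: (y =P src c) => [->|]; last by rewrite mulr0.
    rewrite (src_in oW homW minW srcx cx) /=.
    by case: s => [|a s]; rewrite ?mulr0 ?mulr1.
  have av_arr c : avoiding x (arr c) = 0.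
    rewrite /arr; case: eqP => [cx|_]; last exact: av0.
    by rewrite av_arrow cx eqxx andbF.
  have arr_nil c : pcoef (arr c) x [::] = 0.
    by rewrite /arr; case: ifP => _; rewrite ?pcoef_arrow ?andbF ?pcoef0.
  have av_vtx : avoiding x (cscal k * vtx x) = 0.
    apply: cpathP => y s; rewrite pcoef_av pcoef_scal pcoef_vtx pcoef0 /avoids.
    by case: (y =P x); rewrite ?mul0r ?mulr0.
  set f := (cscal k * vtx x + _ + _); change (Phi f = theta).
  have fchi : chi f = k.
    rewrite /chi /f !pcoefD pcoef_scal pcoef_vtx !eqxx mulr1 pcoef_av /avoids eqxx mul0r addr0.
    rewrite pcoef_sum big1 ?addr0 // => c _.
    by rewrite pcoef_mul_nil arr_nil mulr0.
  have fom : om f = iota m0.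
    rewrite /om /f !avD av_vtx add0r av_av av_sum big1 ?addr0 => [|c _].
      have := pi_eq (av_corner W srcx w); rewrite !rmorphM rmorphB rmorph1 wE => <-.
      by rewrite mulrBl mul1r ew subr0 iota_co.
    by rewrite avM av_arr mulr0.
  have fnu : nu f = n0.
    have -> : n0 = (1 - e_) *: n0 by rewrite scalerBl scale1r en0 subr0.
    rewrite g0E scaler_sumr; apply: eq_bigr => c _.
    have -> : arriving x c f = avoiding x (g c) * in_vtx K x c.
      rewrite /f !gcD gc_sum gc_zero ?add0r => [|cx y s]; last first.
        by rewrite pcoef_scal pcoef_vtx -size_eq0 size_rcons andbF mulr0.
      rewrite gc_zero ?add0r => [|cx y s]; last first.
        by rewrite pcoef_av /avoids all_rcons cx eqxx andbF mul0r.
      rewrite (bigD1 c) //= gcM gc_arr eqxx mul1r av_av arr_nil cscal0 mul0r addr0.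
      rewrite big1 ?addr0 // => b /negPf bc.
      by rewrite gcM gc_arr eq_sym bc mul0r mulr0 arr_nil cscal0 mul0r addr0.
    have := pi_eq (av_corner W srcx (g c)); rewrite !rmorphM rmorphB rmorph1 gE => <-.
    rewrite -[X in _ = _ *: (_ *: X)]zt !scalerA -!mulrA; congr ((_ * (_ * _)) *: _).
    by rewrite mulrBl mul1r cor_ez subr0.
  apply: lhomP => -[v u].
  have -> : (v, u) = iota u *: (0, u0) + (v, 0) :> (V * U)%type.
    by congr (_, _); rewrite /= ?scaler0 ?addr0 ?add0r ?iotaP.
  rewrite -[RHS]/(th (iota u *: (0, u0) + (v, 0))) [RHS]linearP th1.
  rewrite PhiE fchi fom fnu; congr (_, _) => /=.
    by rewrite scaler0 add0r addr0 iotaP addrC.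
  by rewrite -/m0 !addr0 iotaP -{2}(iotaP m0) scalerA.
- move=> k; apply: lhomP => -[v u]; rewrite -[LHS]/((Phi (cscal k) : lhom _ _) (v, u)) PhiE.
  have -> : chi (cscal k) = k by rewrite /chi pcoef_cscal eqxx mulr1.
  have -> : nu (cscal k) = 0.
    rewrite /nu big1 // => c _; rewrite gc_zero ?rmorph0 ?scale0r // => _ y s.
    by rewrite pcoef_cscal -size_eq0 size_rcons mulr0.
  rewrite /om av_cscal rmorphM pik rmorphB rmorph1 mulrA -kscalC -mulrA iota_co.
  by rewrite /= scaler0 addr0 -scalerA iotaP.
- move=> f; rewrite piBker -[Phir f]/(Phi f); split=> [Phi0|].
    have P0 p : (kscal R (chi f) *: p.1 + iota p.2 *: nu f, (iota p.2 * om f) *: u0) = 0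
      by rewrite -PhiE Phi0.
    have iota1 : iota u0 = 1 - e_ by rewrite -[u0]scale1r iotaE mul1r.
    have chi0 : chi f = 0.
      apply: contrapT => /eqP c0; apply: v00.
      have /(congr1 fst) /= := P0 (v0, 0); rewrite -[in iota 0](scale0r u0) iotaE mul0r scale0r addr0.
      move=> /(congr1 (fun v => kscal R (chi f)^-1 *: v)).
      by rewrite scalerA -rmorphM mulVf // rmorph1 scale1r scaler0.
    have nu0 : nu f = 0.
      by have /(congr1 fst) /= := P0 (0, u0); rewrite scaler0 add0r iota1 co_nu.
    have om0 : om f = 0.
      have /(congr1 snd) /= := P0 (0, u0); rewrite iota1 co_av => /Ufree.
      by rewrite om_co.
    apply: (mutation_ker2 oW homW minW srcx) => //; first exact/piker.
    have [h hP] := (relP (fun c => pi (arriving x c f))).1 nu0.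
    have [h' h'P] := choice (fun i => piS (h i)); exists h' => c; apply/piker.
    rewrite rmorphB -(gc_z x c f) rmorphM hP rmorph_sum; apply/eqP; rewrite subr_eq0; apply/eqP.
    by apply: eq_bigr => i _; rewrite rmorphM h'P.
  move=> /(mutation_ker1 oW homW minW srcx hN) [chi0 om0 [h hP]].
  apply: lhomP => -[v u]; rewrite PhiE (chi0 : chi f = 0) (iffRL (piker _) om0 : om f = 0).
  have -> : nu f = 0.
    apply/(relP (fun c => pi (arriving x c f))); exists (fun i => pi (h i)) => c.
    rewrite -rmorphM gc_z (pi_eq (hP c)) rmorph_sum.
    by apply: eq_bigr => i _; rewrite rmorphM.
  by rewrite rmorph0 scale0r scaler0 addr0 mulr0 scale0r.
Qed.

End Core.

(** * Duality and the syzygies of the relations *)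

Section Duality.
Variables (K : fieldType) (R : kalg K).
Local Notation Rop := (op_alg R).

(** Elements of a dual module are linear maps behind several definitions; they are handled
    through their values. *)
Definition dval (N : lmodType Rop) (f : D_right N) (n : N) : K :=
  (f : lhom (restr_scal N) K^o) n.

Section Evaluation.
Variable N : lmodType Rop.
Implicit Types (f g : D_right N) (n : N).

Lemma dvalP f g : (forall n, dval f n = dval g n) -> f = g.
Proof. by move=> fg; apply: lhomP. Qed.
Lemma dvalD f n m : dval f (n + m) = dval f n + dval f m.
Proof. exact: (linearD (lhom_fun (f : lhom (restr_scal N) K^o))). Qed.
Lemma dvalB f n m : dval f (n - m) = dval f n - dval f m.
Proof. exact: (linearB (lhom_fun (f : lhom (restr_scal N) K^o))). Qed.
Lemma dval0 f : dval f 0 = 0.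
Proof. exact: (linear0 (lhom_fun (f : lhom (restr_scal N) K^o))). Qed.
Lemma dval_sum f (T : Type) (s : seq T) (F : T -> N) :
  dval f (\sum_(i <- s) F i) = \sum_(i <- s) dval f (F i).
Proof. by apply: (big_morph (dval f)); [exact: dvalD | exact: dval0]. Qed.
Lemma dvalk f k n : dval f (kscal Rop k *: n) = k * dval f n.
Proof. exact: (linearZ_LR (lhom_fun (f : lhom (restr_scal N) K^o)) k (n : restr_scal N)). Qed.
Lemma dval_act b f n : dval (b *: f) n = dval f ((b : Rop) *: n).
Proof. by []. Qed.
Lemma dvalDf f g n : dval (f + g) n = dval f n + dval g n.
Proof. by []. Qed.
Lemma dvalNf f n : dval (- f) n = - dval f n.
Proof. by []. Qed.
Lemma dval0f n : dval (0 : D_right N) n = 0.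
Proof. by []. Qed.

Lemma dval_mk (phi : N -> K) : (forall n m, phi (n + m) = phi n + phi m) ->
  (forall k n, phi (kscal Rop k *: n) = k * phi n) -> exists f, forall n, dval f n = phi n.
Proof.
move=> phiD phik.
have phil : linear (phi : restr_scal N -> K^o) by move=> k n m; rewrite phiD [phi _]phik.
by exists (Lhom phil).
Qed.

Lemma dval_separates n : (forall f, dval f n = 0) -> n = 0.
Proof.
move=> H; apply: (functional_separates (V := restr_scal N)) => phi.
have phil : linear (phi : restr_scal N -> K^o) by exact: linearP.
exact: (H (Lhom phil)).
Qed.

End Evaluation.

Lemma dval_extend (N N' : lmodType Rop) (h : {linear N -> N'}) (f : D_right N) :
  (forall n, h n = 0 -> dval f n = 0) -> exists g : D_right N', forall n, dval g (h n) = dval f n.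
Proof.
move=> H; have hl : linear (h : restr_scal N -> restr_scal N') by move=> k; exact: (linearP h).
have fl : linear (dval f : restr_scal N -> K^o) by exact: linearP.
have [|psi psiP] := @functional_extension K _ _ (mk_linear hl) (mk_linear fl); first exact: H.
have psil : linear (psi : restr_scal N' -> K^o) by exact: linearP.
by exists (Lhom psil).
Qed.

Lemma dmap_fun (N N' : lmodType Rop) (h : {linear N -> N'}) (f : D_right N') :
  exists g : D_right N, forall n, dval g n = dval f (h n).
Proof.
apply: dval_mk => [n m|k n]; first by rewrite linearD dvalD.
by rewrite linearZ dvalk.
Qed.

Lemma dmap_ex (N N' : lmodType Rop) (h : {linear N -> N'}) :
  exists d : {linear D_right N' -> D_right N}, forall f n, dval (d f) n = dval f (h n).
Proof.
have [d dP] := choice (dmap_fun h).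
have dl : linear d.
  by move=> b f g; apply: dvalP => n; rewrite !dvalDf !dval_act !dP !dvalDf !dval_act linearZ.
by exists (mk_linear dl).
Qed.

Definition dmap (N N' : lmodType Rop) (h : {linear N -> N'}) :
  {linear D_right N' -> D_right N} := sval (cid (dmap_ex h)).
Lemma dmapE (N N' : lmodType Rop) (h : {linear N -> N'}) f n :
  dval (dmap h f) n = dval f (h n).
Proof. exact: (svalP (cid (dmap_ex h))). Qed.

(** The dual of a free right module is injective: a map into it amounts to a family of
    functionals, and functionals extend. *)
Lemma dual_free_injective (I : finType) : injective_mod (D_right {ffun I -> Rop^o}).
Proof.
move=> M N g f gI; pose F := {ffun I -> Rop^o}.
pose eps i : F := [ffun j => (j == i)%:R].
have epsE (u : F) : u = \sum_i (u i : Rop) *: eps i.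
  apply/ffunP => j; rewrite sum_ffunE (bigD1 j) //= !ffunE eqxx big1 ?addr0 => [|i ij].
    by rewrite -[RHS]/((u j : Rop) * 1) mulr1.
  by rewrite !ffunE eq_sym (negPf ij) scaler0.
have gl : linear (g : restr_scal M -> restr_scal N) by move=> k; exact: (linearP g).
have /choice [psi psiP] i : exists psi : {linear restr_scal N -> K^o},
    forall m : M, psi (g m) = dval (f m) (eps i).
  have fl : linear (fun m : restr_scal M => dval (f m) (eps i) : K^o).
    move=> k m m'; rewrite [f _](linearP f) dvalDf dval_act; congr (_ + _).
    exact: dvalk.
  apply: (functional_extension (f := mk_linear gl) (phi := mk_linear fl)) => m.
  rewrite !mk_linearE => gm; have -> : m = 0 by apply: gI; rewrite linear0.
  by rewrite [f _](linear0 f).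
have psiD i n n' : psi i (n + n') = psi i n + psi i n' by exact: linearD.
have /choice [h hP] (n : N) : exists h : D_right F, forall u : F,
    dval h u = \sum_i psi i ((u i : R) *: n).
  apply: dval_mk => [u v|k u].
    rewrite -big_split; apply: eq_bigr => i _ /=.
    by rewrite ffunE scalerDl psiD.
  rewrite mulr_sumr; apply: eq_bigr => i _.
  have -> : ((kscal Rop k *: u) i : R) = kscal R k * (u i : R) by rewrite ffunE kscalC.
  rewrite -scalerA.
  exact: (linearZ_LR (psi i)).
have hl : linear h.
  move=> b n n'; apply: dvalP => u; rewrite dvalDf dval_act !hP -big_split.
  apply: eq_bigr => i _ /=; rewrite scalerDr psiD scalerA; congr (_ + _).
  by rewrite ffunE.
exists (mk_linear hl) => m; apply: dvalP => u; rewrite hP {2}[u]epsE dval_sum.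
apply: eq_bigr => i _; rewrite -[LHS]/(psi i ((u i : R) *: g m)) -linearZ psiP.
by rewrite linearZ dval_act.
Qed.

End Duality.

Section FreeRightModules.
Variables (K : fieldType) (R : kalg K).
Local Notation Rop := (op_alg R).
Local Notation F I := {ffun I -> Rop^o}.

Fact rmx_linear (I J : finType) (m : J -> I -> R) :
  linear (fun u : F I => [ffun j => \sum_i m j i * (u i : R)] : F J).
Proof.
move=> b u v; apply/ffunP => j; rewrite !ffunE.
transitivity ((\sum_i m j i * (u i : R)) * b + \sum_i m j i * (v i : R)); last by [].
rewrite mulr_suml -big_split; apply: eq_bigr => i _ /=.
by rewrite !ffunE mulrDr -mulrA.
Qed.

(** Left multiplication by a matrix, as a map of free right modules. *)
Definition rmx (I J : finType) (m : J -> I -> R) : {linear F I -> F J} :=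
  mk_linear (rmx_linear m).

Lemma rmxE (I J : finType) (m : J -> I -> R) u j : (rmx m u j : R) = \sum_i m j i * (u i : R).
Proof. by rewrite mk_linearE ffunE. Qed.

Lemma fdim_free (I : finType) : finite_dimensional R -> fdim (restr_scal (F I)).
Proof.
move=> [n [v vP]].
apply: (@fdim_fin K (restr_scal (F I)) (I * 'I_n)%type
  (fun p => [ffun i => (i == p.1)%:R * v p.2] : F I)) => u.
have [c cP] := choice (fun i => vP (u i)); exists (fun p => c p.1 p.2).
pose ev i (w : restr_scal (F I)) : R := (w : F I) i.
have evD i w w' : ev i (w + w') = ev i w + ev i w' by rewrite /ev [LHS]ffunE.
have evZ i k w : ev i (k *: w) = kscal R k * ev i w.
  by rewrite kscalC /ev [LHS]ffunE.
have ev0 i : ev i 0 = 0 by rewrite /ev [LHS]ffunE.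
set w := (X in _ = X); suff H i : ev i u = ev i w by apply/ffunP; exact: H.
rewrite /w (big_morph (ev i) (evD i) (ev0 i)) (eq_bigr (fun p => kscal R (c p.1 p.2) * ((i == p.1)%:R * v p.2))) => [|p _]; last first.
  by rewrite evZ /ev ffunE.
rewrite -(pair_bigA _ (fun j l => kscal R (c j l) * ((i == j)%:R * v l))) /=.
rewrite (bigD1 i) //= [X in _ + X]big1 ?addr0 => [|j ji].
  by rewrite [LHS]cP; apply: eq_bigr => l _; rewrite eqxx mul1r.
by apply: big1 => l _; rewrite eq_sym (negPf ji) mul0r mulr0.
Qed.

End FreeRightModules.

Section SyzygyProjection.
Variables (K : fieldType) (R : kalg K) (T : finType) (a y z : T -> R) (r : T -> T -> R).
Local Notation Rop := (op_alg R).
Local Notation F I := {ffun I -> Rop^o}.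
Hypothesis ay : forall i, a i * y i = a i.
Hypothesis yy : forall i, y i * y i = y i.
Hypothesis zz : forall j, z j * z j = z j.
Hypothesis yr : forall i j, y i * r i j = r i j.
Hypothesis rz : forall i j, r i j * z j = r i j.
Hypothesis ar : forall j, \sum_i a i * r i j = 0.
Hypothesis syz : forall u : T -> R, (forall i, y i * u i = u i) -> \sum_i a i * u i = 0 ->
  exists v : T -> R, (forall j, z j * v j = v j) /\ forall i, u i = \sum_j r i j * v j.
Hypothesis fdR : finite_dimensional R.

Let dmx (m : T -> R) : T -> T -> R := fun j k => (j == k)%:R * m j.

Let dmxE m (u : F T) j : (rmx (dmx m) u j : R) = m j * (u j : R).
Proof.
rewrite rmxE /dmx (bigD1 j) //= eqxx mul1r big1 ?addr0 // => k kj.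
by rewrite eq_sym (negPf kj) !mul0r.
Qed.

Let Zm := rmx (dmx z).
Let Ym := rmx (dmx y).
Let Rm := rmx r.
Let Am : {linear F T -> F unit} := rmx (fun _ => a).

Let RmZ v : Rm (Zm v) = Rm v.
Proof.
by apply/ffunP => i; rewrite [LHS]rmxE [RHS]rmxE; apply: eq_bigr => j _; rewrite dmxE mulrA rz.
Qed.
Let YmR v : Ym (Rm v) = Rm v.
Proof.
apply/ffunP => i; rewrite [LHS]dmxE [RHS]rmxE rmxE mulr_sumr.
by apply: eq_bigr => j _; rewrite mulrA yr.
Qed.
Let AmR v : Am (Rm v) = 0.
Proof.
apply/ffunP => i; rewrite [RHS]ffunE [LHS]rmxE.
rewrite (eq_bigr (fun i => \sum_j a i * r i j * (v j : R))) => [|l _].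
  by rewrite exchange_big big1 // => j _; rewrite -mulr_suml ar mul0r.
by rewrite rmxE mulr_sumr; apply: eq_bigr => j _; rewrite mulrA.
Qed.
Let AmY u : Am (Ym u) = Am u.
Proof.
by apply/ffunP => i; rewrite [LHS]rmxE [RHS]rmxE; apply: eq_bigr => j _; rewrite dmxE mulrA ay.
Qed.
Let ZmZ v : Zm (Zm v) = Zm v.
Proof. by apply/ffunP => j; rewrite ![in LHS]dmxE [RHS]dmxE mulrA zz. Qed.
Let YmY v : Ym (Ym v) = Ym v.
Proof. by apply/ffunP => j; rewrite ![in LHS]dmxE [RHS]dmxE mulrA yy. Qed.

(* the syzygies of the relations *)
Let Kr : set (F T) := [set v | Zm v = v /\ Rm v = 0]%classic.
Let HKr : is_submodule Kr.
Proof.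
split; first by split; exact: linear0.
move=> b u v [Zu Ru] [Zv Rv]; split; rewrite linearP; first by rewrite Zu Zv.
by rewrite Ru Rv scaler0 addr0.
Qed.
Let inc := submod_incl HKr.

Let syzm u : Am u = 0 -> exists v, Ym u = Rm v.
Proof.
move=> Au; have [||v [_ vP]] := @syz (fun i => Ym u i); first by move=> i; rewrite dmxE mulrA yy.
  by rewrite -[LHS](rmxE (fun _ : unit => a) (Ym u) tt) -/Am AmY Au ffunE.
exists [ffun j => v j]; apply/ffunP => i; rewrite [LHS]vP rmxE.
by apply: eq_bigr => j _; rewrite ffunE.
Qed.

(** The dual [M] of the module of syzygies is the cokernel of the last map of the injective
    complex [D(R) -> D(R^T) -> D(R^T)].  A projective resolution of [M] of length two maps to
    this complex, and the maps can be corrected, from left to right, so that the last one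
    factors through [M]: this splits the inclusion of the syzygies. *)
Lemma syzygy_section : gldim_le R 2 -> exists s : {linear D_right (submod HKr) -> D_right (F T)},
  forall m k, dval (s m) (inc k) = dval m k.
Proof.
pose M := D_right (submod HKr).
move=> /(_ M) [N1 [P0 [i0 [p0 [projP0 [i0_inj i0p0 p0S]
  [N2 [P1 [i1 [p1 [projP1 [i1_inj i1p1 p1S] projN2]]]]]]]]]].
have p0i0 n : p0 (i0 n) = 0 by apply/i0p0; exists n.
have p1i1 n : p1 (i1 n) = 0 by apply/i1p1; exists n.
have [|l0 l0P] := projective_lift (g := dmap inc) (f := p0) projP0.
  move=> p; have [|g gP] := dval_extend (h := inc) (f := p0 p).
    by move=> n n0; have -> : n = 0; [apply: submod_incl_inj; rewrite n0 linear0 | exact: dval0].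
  by exists g; apply: dvalP => k; rewrite dmapE gP.
pose l0' p := dmap Zm (l0 p).
have l0'K p k : dval (l0' p) (inc k) = dval (p0 p) k.
  by rewrite dmapE (proj1 (submod_inclP k)) -l0P dmapE.
have l0'R p v : Rm v = 0 -> dval (l0' (i0 p)) v = 0.
  move=> Rv; have Kv : Kr (Zm v) by split; rewrite ?ZmZ // RmZ.
  by rewrite dmapE -(to_submodK HKr Kv) -dmapE l0P p0i0.
have l0'l : linear (fun q => l0' (i0 (p1 q))) by move=> b u v; rewrite /l0' !linearP.
have [|l1 l1P] := projective_lift (g := dmap Rm) (f := mk_linear l0'l) projP1.
  move=> q; have [|g gP] := dval_extend (h := Rm) (f := l0' (i0 (p1 q))).
    by move=> v; exact: l0'R.
  by exists g; apply: dvalP => k; rewrite dmapE gP.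
pose l1' q := dmap Ym (l1 q).
have l1'R q v : dval (l1' q) (Rm v) = dval (l0' (i0 (p1 q))) v.
  by rewrite dmapE YmR -dmapE l1P.
have l1'l : linear (fun n => l1' (i1 n)) by move=> b u v; rewrite /l1' !linearP.
have [|l2 l2P] := projective_lift (g := dmap Am) (f := mk_linear l1'l) projN2.
  move=> n; have [|g gP] := dval_extend (h := Am) (f := l1' (i1 n)).
    move=> u /syzm [v uv]; rewrite /l1' dmapE -YmY -dmapE -/(l1' _) uv l1'R p1i1.
    by rewrite linear0 /l0' linear0 linear0.
  by exists g; apply: dvalP => k; rewrite dmapE gP.
have [|m2 m2P] := injective_extend (g := i1) (f := l2) (@dual_free_injective K R unit).
  by move=> n n0; have -> : n = 0; [apply: i1_inj; rewrite n0 linear0 | exact: linear0].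
have l1l : linear (fun q => l1' q - dmap Am (m2 q)).
  by move=> b u v; rewrite /l1' !linearP scalerBr ?scalerN ?opprD addrACA.
have ipl : linear (fun q => i0 (p1 q)) by move=> b u v; rewrite !linearP.
have [|m1 m1P] := injective_extend (g := mk_linear ipl) (f := mk_linear l1l)
    (@dual_free_injective K R T).
  move=> q; rewrite mk_linearE => q0.
  have [n <-] : exists n, i1 n = q by apply/i1p1; apply: i0_inj; rewrite q0 linear0.
  by rewrite mk_linearE m2P l2P subrr.
pose l00 p := l0' p - dmap Rm (m1 p).
have l00i n : l00 (i0 n) = 0.
  have [q <-] := p1S n; apply: dvalP => v; rewrite dvalDf dvalNf dmapE.
  have -> : m1 (i0 (p1 q)) = l1' q - dmap Am (m2 q) by exact: m1P.
  by rewrite dvalDf dvalNf dmapE AmR dval0 subr0 l1'R subrr.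
have l00l : linear l00.
  by move=> b u v; rewrite /l00 /l0' !linearP scalerBr ?scalerN ?opprD addrACA.
have l00D p q : p0 p = p0 q -> l00 p = l00 q.
  move=> pq; have [n nE] : exists n, i0 n = p - q by apply/i0p0; rewrite linearB pq subrr.
  apply/eqP; rewrite -subr_eq0 -(linearB (mk_linear l00l) p q) -nE.
  by apply/eqP; exact: l00i.
have [c cP] := choice p0S.
have sl : linear (fun m => l00 (c m)).
  by move=> b u v; rewrite -l00l; apply: l00D; rewrite linearP !cP.
exists (mk_linear sl) => m k; rewrite mk_linearE dvalDf dvalNf l0'K dmapE cP.
by rewrite (proj2 (submod_inclP k)) dval0 subr0.
Qed.

(** By double duality, the section of duals of free modules is given by a matrix. *)
Lemma syzygy_projection_gldim : gldim_le R 2 -> exists rho : T -> T -> R,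
  (forall i k, \sum_j r i j * rho j k = 0) /\
  (forall v : T -> R, (forall j, z j * v j = v j) -> (forall i, \sum_j r i j * v j = 0) ->
     forall j, \sum_k rho j k * v k = v j).
Proof.
move=> /syzygy_section [s sP].
have /choice [rho rhoP] (v : F T) : exists v' : F T,
    forall f : D_right (F T), dval (s (dmap inc f)) v = dval f v'.
  apply: (reflexive (F := fun f => dval (s (dmap inc (f : D_right (F T)))) v)
    (fdim_free T fdR)) => k f g h hE.
  have -> : h = kscal R k *: (f : D_right (F T)) + (g : D_right (F T)).
    apply: lhomP => u; rewrite hE.
    rewrite -[RHS]/(dval (f : D_right (F T)) (kscal Rop k *: u) + dval (g : D_right (F T)) u).
    by rewrite dvalk.
  rewrite !linearP dvalDf dval_act; congr (_ + _); exact: dvalk.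
pose eps k : F T := [ffun j => (j == k)%:R].
have rhoR v : Rm (rho v) = 0.
  apply: dval_separates => f; rewrite -dmapE -rhoP.
  have -> : dmap inc (dmap Rm f) = 0.
    by apply: dvalP => k; rewrite !dmapE (proj2 (submod_inclP k)) dval0.
  by rewrite linear0.
exists (fun j k => rho (eps k) j); split=> [i k|v zv rv j].
  by have := congr1 (fun g : F T => g i : R) (rhoR (eps k)); rewrite [LHS]rmxE ffunE.
pose u : F T := [ffun j => v j].
have Ku : Kr u.
  split; apply/ffunP => i; first by rewrite [LHS]dmxE ffunE zv.
  by rewrite [LHS]rmxE [RHS]ffunE -[RHS](rv i); apply: eq_bigr => l _; rewrite ffunE.
have uE : u = \sum_k (v k : Rop) *: eps k.
  apply/ffunP => i; rewrite sum_ffunE (bigD1 i) //= !ffunE eqxx big1 ?addr0 => [|k ki].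
    by rewrite -[RHS]/(1 * v i) mul1r.
  by rewrite !ffunE eq_sym (negPf ki) scaler0.
have : u = \sum_k (v k : Rop) *: rho (eps k).
  apply/eqP; rewrite -subr_eq0; apply/eqP/dval_separates => f.
  rewrite dvalB dval_sum -(to_submodK HKr Ku) -[X in X - _]dmapE -sP to_submodK.
  apply/eqP; rewrite subr_eq0; apply/eqP; rewrite {1}uE dval_sum.
  by apply: eq_bigr => k _; rewrite -!dval_act -rhoP !linearZ.
move=> /(congr1 (fun g : F T => g j : R)); rewrite sum_ffunE ffunE => ->.
by apply: eq_bigr => k _; rewrite ffunE.
Qed.

End SyzygyProjection.

(** * The simple module at the source *)

Section Complement.
Variables (K : fieldType) (R : kalg K) (e : R) (chi : R -> K).
Hypothesis be : forall b, b * e = kscal R (chi b) * e.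
Hypothesis ee : e * e = e.
Hypothesis chi_e : chi e = 1.
Hypothesis chi_co : chi (1 - e) = 0.
Variables (S U : lmodType R).
Hypothesis S_line : exists s : S, s <> 0 /\ forall v : S, exists k, v = kscal R k *: s.
Hypothesis S_act : forall b (v : S), b *: v = kscal R (chi b) *: v.

(** Cancellation: since [1 - e] kills [S], it is sent into [U], and it generates [U]. *)
Lemma complement_generator : mod_iso R^o (S * U)%type -> exists u0 : U,
  [/\ e *: u0 = 0, forall u, exists b, u = b *: u0
    & forall b, b *: u0 = 0 -> b * (1 - e) = 0].
Proof.
move=> [phi [g gK phiK]].
have ce2 : (1 - e) * (1 - e) = 1 - e.
  by rewrite mulrBl mul1r mulrBr mulr1 ee subrr subr0.
have phiM (b c : R) : phi (b * c) = b *: phi c by exact: linearZ.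
have co : phi (1 - e) = (0, (phi (1 - e)).2).
  rewrite [LHS]surjective_pairing; congr (_, _).
  by rewrite -[in LHS]ce2 phiM /= S_act chi_co rmorph0 scale0r.
set u0 := (phi (1 - e)).2 in co.
have phiE b : phi (b * (1 - e)) = (0, b *: u0).
  by rewrite phiM co; congr (_, _); rewrite /= scaler0.
exists u0; split.
- have : phi (e * (1 - e)) = 0 by rewrite mulrBr mulr1 ee subrr linear0.
  by rewrite phiE => -[].
- move=> u; exists (g (0, u) : R); set b : R := g (0, u).
  have bE : phi b = (0, u) by exact: phiK.
  have phib (c : R) : phi c = kscal R (chi c) *: phi e + (0, c *: u0).
    by rewrite -phiE -phiM -be -linearD -mulrDr addrC subrK mulr1.
  have [c0|c0] := eqVneq (chi b) 0.
    by move: bE; rewrite phib c0 rmorph0 scale0r add0r => -[].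
  have s1 : (phi e).1 = 0.
    have := congr1 fst bE; rewrite phib /= addr0 => /(congr1 (fun v => kscal R (chi b)^-1 *: v)).
    by rewrite scalerA -rmorphM mulVf // rmorph1 scale1r scaler0.
  have [s [s0 _]] := S_line; case: s0.
  by have := congr1 fst (phiK (s, 0)); rewrite phib /= s1 scaler0 addr0.
- move=> b bu; apply: (can_inj gK); rewrite linear0 phiE bu //.
Qed.

End Complement.

Section SourceAlgebra.
Variables (K : fieldType) (R : kalg K) (T : finType) (e : R) (a y z : T -> R)
  (r : T -> T -> R) (chi : R -> K).
Hypothesis be : forall b, b * e = kscal R (chi b) * e.
Hypothesis eb : forall b, exists u : T -> R, (forall i, y i * u i = u i) /\
  e * b = kscal R (chi b) * e + \sum_i a i * u i.
Hypothesis e_neq0 : e <> 0.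
Hypothesis ee : e * e = e.
Hypothesis ea : forall i, e * a i = a i.
Hypothesis ay : forall i, a i * y i = a i.
Hypothesis yy : forall i, y i * y i = y i.
Hypothesis ye : forall i, y i * e = 0.
Hypothesis syz : forall u : T -> R, (forall i, y i * u i = u i) -> \sum_i a i * u i = 0 ->
  exists v : T -> R, (forall j, z j * v j = v j) /\ forall i, u i = \sum_j r i j * v j.
Hypothesis fdR : finite_dimensional R.

Lemma scal_e_inj k l : kscal R k * e = kscal R l * e -> k = l.
Proof.
move=> kl; apply/eqP; rewrite -subr_eq0; apply: contraT => kl0; case: e_neq0.
rewrite -[e]mul1r -(rmorph1 (kscal R)) -(mulVf kl0) rmorphM -mulrA.
by rewrite rmorphB mulrBl kl subrr mulr0.
Qed.

Lemma chi_uniq b k : b * e = kscal R k * e -> chi b = k.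
Proof. by rewrite be => /scal_e_inj. Qed.

Lemma chiD b c : chi (b + c) = chi b + chi c.
Proof. by apply: chi_uniq; rewrite mulrDl (be b) (be c) rmorphD mulrDl. Qed.
Lemma chiB b c : chi (b - c) = chi b - chi c.
Proof. by apply: chi_uniq; rewrite mulrBl (be b) (be c) rmorphB mulrBl. Qed.
Lemma chiM b c : chi (b * c) = chi b * chi c.
Proof. by apply: chi_uniq; rewrite -mulrA (be c) mulrA -kscalC -mulrA (be b) mulrA -rmorphM mulrC. Qed.
Lemma chi_scal k : chi (kscal R k) = k. Proof. exact: chi_uniq. Qed.
Lemma chi1 : chi 1 = 1. Proof. by apply: chi_uniq; rewrite rmorph1. Qed.
Lemma chi_e : chi e = 1. Proof. by apply: chi_uniq; rewrite rmorph1 mul1r ee. Qed.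
Lemma chi_co : chi (1 - e) = 0. Proof. by rewrite chiB chi1 chi_e subrr. Qed.
Lemma chi_a i : chi (a i) = 0.
Proof. by apply: chi_uniq; rewrite -ay -mulrA ye mulr0 rmorph0 mul0r. Qed.

Variables (S : lmodType R).
Hypothesis S_line : exists s : S, s <> 0 /\ forall v : S, exists k, v = kscal R k *: s.
Hypothesis S_act : forall b (v : S), b *: v = kscal R (chi b) *: v.

Lemma S_coord : exists (s : S) (c : S -> K), [/\ s <> 0, forall v, v = kscal R (c v) *: s,
  forall k, c (kscal R k *: s) = k & forall k v w, c (kscal R k *: v + w) = k * c v + c w].
Proof.
have [s [s0 sP]] := S_line; have [c cP] := choice sP.
have sinj k l : kscal R k *: s = kscal R l *: s -> k = l.
  move=> kl; apply/eqP; rewrite -subr_eq0; apply: contraT => kl0; case: s0.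
  rewrite -[s]scale1r -(rmorph1 (kscal R)) -(mulVf kl0) rmorphM -scalerA.
  by rewrite rmorphB scalerBl kl subrr scaler0.
exists s, c; split=> // [k|k v w]; apply: sinj; first by rewrite -cP.
by rewrite -cP rmorphD scalerDl rmorphM -scalerA -!cP.
Qed.

(** If no arrow leaves the source, the simple projective module is injective. *)
Lemma arrows_neq0 : ~ injective_mod S -> exists i, a i <> 0.
Proof.
move=> ninj; apply: contrapT => a0; apply: ninj.
have ebs b : e * b = kscal R (chi b) * e.
  have [u [_ ->]] := eb b; rewrite big1 ?addr0 // => i _.
  suff -> : a i = 0 by rewrite mul0r.
  by apply: contrapT => ai; apply: a0; exists i.
move=> M N g f gI; have [s [c [s0 cE cs clin]]] := S_coord.
have gl : linear (g : restr_scal M -> restr_scal N).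
  by move=> k u v; exact: (linearP g).
have fl : linear (fun m : restr_scal M => c (f m) : K^o).
  by move=> k u v; rewrite -clin -[in RHS]linearP.
have [|psi psiP] := @functional_extension K _ _ (mk_linear gl) (mk_linear fl).
  move=> v; rewrite !mk_linearE => gv; have -> : v = 0 by apply: gI; rewrite linear0.
  by rewrite linear0; have := cs 0; rewrite rmorph0 scale0r.
have hl : linear (fun n : N => kscal R (psi (e *: n : restr_scal N)) *: s).
  move=> b u v; have -> : e *: (b *: u + v) = kscal R (chi b) *: (e *: u) + e *: v.
    by rewrite scalerDr !scalerA ebs.
  rewrite (linearP psi (chi b) (e *: u) (e *: v)) rmorphD scalerDl; congr (_ + _).
  by rewrite [b *: _]S_act scalerA; congr (_ *: _); exact: (rmorphM (kscal R)).
exists (mk_linear hl) => m; rewrite mk_linearE -linearZ.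
have -> : psi (g (e *: m)) = c (f (e *: m)) by exact: psiP.
by rewrite -cE linearZ /= S_act chi_e rmorph1 scale1r.
Qed.

Lemma fdim_op : fdim (restr_scal ((op_alg R)^o)).
Proof.
have [n [v vP]] := fdR; exists n, v => b; have [c cE] := vP b; exists c.
rewrite [LHS]cE; apply: eq_bigr => i _.
by rewrite -[RHS]/(v i * kscal R (c i)) kscalC.
Qed.

Lemma rad_coef : exists u : R -> T -> R, forall b, (forall i, y i * u b i = u b i) /\
  e * b = kscal R (chi b) * e + \sum_i a i * u b i.
Proof. by have [u uP] := choice eb; exists u. Qed.

Section Derivation.
Variables (w : T -> R).
Hypothesis wr : forall j, \sum_i w i * r i j = 0.

Lemma w_wd (u v : T -> R) : (forall i, y i * u i = u i) -> (forall i, y i * v i = v i) ->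
  \sum_i a i * u i = \sum_i a i * v i -> \sum_i w i * u i = \sum_i w i * v i.
Proof.
move=> yu yv uv.
have [||s [_ sP]] := @syz (fun i => u i - v i); first by move=> i; rewrite mulrBr yu yv.
  by rewrite (eq_bigr _ (fun i _ => mulrBr _ _ _)) sumrB uv subrr.
apply/eqP; rewrite -subr_eq0 -sumrB; apply/eqP.
rewrite (eq_bigr (fun i => \sum_j w i * r i j * s j)) => [|i _].
  by rewrite exchange_big big1 // => j _; rewrite -mulr_suml wr mul0r.
by rewrite -mulrBr sP mulr_sumr; apply: eq_bigr => j _; rewrite mulrA.
Qed.

(** A family [w] killed by the relations defines a right linear map on the radical of [e R],
    sending [a i] to [w i]; precomposed with the projection of [R] on that radical, it is a
    derivation. *)
Lemma derivation : exists delta : R -> R,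
  [/\ forall b c, delta (b + c) = delta b + delta c,
      forall b c, delta (b * c) = kscal R (chi b) * delta c + delta b * c,
      forall k, delta (kscal R k) = 0 & forall i, delta (a i) = w i * y i].
Proof.
have [u uP] := rad_coef; exists (fun b => \sum_i w i * u b i).
have yu b i : y i * u b i = u b i by case: (uP b) => H _; exact: H.
have eu b : e * b - kscal R (chi b) * e = \sum_i a i * u b i.
  by case: (uP b) => _ ->; rewrite addrC addKr.
split=> [b c|b c|k|i].
- rewrite -big_split /= -[RHS](eq_bigr _ (fun i _ => mulrDr _ _ _)).
  apply: w_wd => [i|i|]; rewrite ?mulrDr ?yu //.
  rewrite (eq_bigr _ (fun i _ => mulrDr _ _ _)) big_split /= -!eu.
  by rewrite mulrDr chiD rmorphD mulrDl opprD addrACA.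
- transitivity (\sum_i w i * (kscal R (chi b) * u c i + u b i * c)).
    apply: w_wd => [i|i|]; rewrite ?yu //.
      by rewrite mulrDr !mulrA -kscalC -[_ * y i * _]mulrA !yu.
    rewrite [RHS](eq_bigr (fun i => kscal R (chi b) * (a i * u c i) + a i * u b i * c)) => [|i _].
      rewrite big_split /= -mulr_sumr -mulr_suml -!eu.
      rewrite mulrBr mulrBl chiM rmorphM !mulrA addrC.
      by rewrite addrA subrK.
    by rewrite mulrDr !mulrA kscalC.
  rewrite (eq_bigr (fun i => kscal R (chi b) * (w i * u c i) + w i * u b i * c)) => [|i _].
    by rewrite big_split /= -mulr_sumr -mulr_suml.
  by rewrite mulrDr !mulrA kscalC.
- transitivity (\sum_i w i * 0); last by rewrite big1 // => i _; rewrite mulr0.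
  apply: w_wd => [i|i|]; rewrite ?yu ?mulr0 // -eu chi_scal kscalC subrr big1 // => i _.
  by rewrite mulr0.
- transitivity (\sum_l w l * ((l == i)%:R * y i)).
    apply: w_wd => [l|l|]; rewrite ?yu //.
      by have [->|_] := eqVneq l i; rewrite ?mul0r ?mulr0 // mul1r yy.
    rewrite -eu ea chi_a rmorph0 mul0r subr0 (bigD1 i) //= eqxx mul1r ay.
    by rewrite big1 ?addr0 // => l /negPf ->; rewrite mul0r mulr0.
  rewrite (bigD1 i) //= eqxx mul1r big1 ?addr0 // => l /negPf ->.
  by rewrite mul0r mulr0.
Qed.

End Derivation.

(** The vanishing of [Ext^1(DR, S)] makes the derivation inner. *)
Lemma extension_tilting : ext1_vanishes (dual_regular R) S ->
  forall w : T -> R, (forall i, w i * y i = w i) ->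
    (forall j, \sum_i w i * r i j = 0) -> exists b, forall i, w i = b * a i.
Proof.
move=> ext w wy /derivation [delta [deltaD deltaM deltak deltaa]].
have [s [c [s0 cE cs clin]]] := S_coord.
pose DR : lmodType R := dual_regular R.
have evk (f : DR) k (u : R) : dval f (kscal R k * u) = k * dval f u.
  by rewrite kscalC; exact: (dvalk f k u).
have eva b (f : DR) (u : R) : dval (b *: f) u = dval f (u * b) by exact: dval_act.
pose kappa b (f : DR) := kscal R (dval f (delta b)) *: s.
have kDl b d f : kappa (b + d) f = kappa b f + kappa d f.
  by rewrite /kappa deltaD [dval f _]dvalD rmorphD scalerDl.
have kDr b f g : kappa b (f + g) = kappa b f + kappa b g.
  by rewrite /kappa dvalDf rmorphD scalerDl.
have k1 f : kappa 1 f = 0.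
  have d1 : delta 1 = 0 by rewrite -(rmorph1 (kscal R)) deltak.
  by rewrite /kappa d1 [dval f _]dval0 rmorph0 scale0r.
have kM b d f : kappa (b * d) f = b *: kappa d f + kappa b (d *: f).
  rewrite /kappa deltaM [dval f _]dvalD evk eva rmorphD scalerDl; congr (_ + _).
  by rewrite [b *: _]S_act scalerA -rmorphM.
have [F [FD Fk]] := cocycle_coboundary kDl kDr k1 kM ext.
have cD v v' : c (v + v') = c v + c v'.
  by have := clin 1 v v'; rewrite rmorph1 scale1r mul1r.
have cZ k v : c (kscal R k *: v) = k * c v by rewrite {1}[v]cE scalerA -rmorphM cs.
have FZ k f : F (kscal R k *: f) = kscal R k *: F f.
  have := Fk (kscal R k) f; rewrite /kappa deltak [dval f _]dval0.
  by rewrite rmorph0 scale0r => /eqP; rewrite eq_sym subr_eq0 => /eqP.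
have [|b1 b1P] := reflexive (F := fun f : lhom (restr_scal ((op_alg R)^o)) K^o => c (F f)) fdim_op.
  move=> k f g h hE; rewrite -cZ -FZ -cD -FD; congr (c (F _)).
  apply: (@dvalP K R ((op_alg R)^o)) => u; rewrite dvalDf dval_act.
  by rewrite -[X in X + _](esym (dvalk _ _ _)); exact: hE.
pose b0 : R := b1.
have b0P (f : DR) : c (F f) = dval f b0 by exact: b1P.
have db b : delta b = b0 * b - kscal R (chi b) * b0.
  apply/eqP; rewrite -subr_eq0; apply/eqP.
  apply: (@dval_separates K R ((op_alg R)^o)) => f.
  have H : dval f (delta b) = dval f (b0 * b) - chi b * dval f b0.
    have := congr1 c (Fk b f); rewrite /kappa cs => ->.
    have -> : F (b *: f) - b *: F f = F (b *: f) + kscal R (- chi b) *: F f.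
      by rewrite S_act rmorphN scaleNr.
    by rewrite cD cZ mulNr b0P b0P eva.
  by rewrite dvalB [X in _ - X]dvalB H evk subrr.
by exists b0 => i; rewrite -wy -deltaa db chi_a rmorph0 mul0r subr0.
Qed.

End SourceAlgebra.

(** * The cosyzygy of the simple module *)

Section CosyzygyDual.
Variables (K : fieldType) (R : kalg K) (T : finType) (e : R) (a y : T -> R) (chi : R -> K).
Hypothesis be : forall b, b * e = kscal R (chi b) * e.
Hypothesis eb : forall b, exists u : T -> R, (forall i, y i * u i = u i) /\
  e * b = kscal R (chi b) * e + \sum_i a i * u i.
Hypothesis e_neq0 : e <> 0.
Hypothesis ee : e * e = e.
Hypothesis ea : forall i, e * a i = a i.
Hypothesis ay : forall i, a i * y i = a i.
Hypothesis ye : forall i, y i * e = 0.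
Hypothesis fdR : finite_dimensional R.

Variables (S X : lmodType R).
Hypothesis S_line : exists s : S, s <> 0 /\ forall v : S, exists k, v = kscal R k *: s.
Hypothesis S_act : forall b (v : S), b *: v = kscal R (chi b) *: v.

Let chi_e : chi e = 1. Proof. exact: chi_e. Qed.
Let chiM b c : chi (b * c) = chi b * chi c. Proof. exact: chiM. Qed.
Let chi_a i : chi (a i) = 0. Proof. exact: (chi_a be e_neq0 ay ye). Qed.
Let chiD b c : chi (b + c) = chi b + chi c. Proof. exact: chiD. Qed.

(** The injective envelope of [S] is [D(e R)], so the dual of the cosyzygy of [S] is the
    radical of [e R]. *)
Lemma cosyzygy_dual : is_cosyzygy S X -> exists iota : {linear D_left X -> (op_alg R)^o},
  injective iota /\ forall b : R, (exists m, iota m = b) <-> exists u : T -> R, b = \sum_i a i * u i.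
Proof.
move=> [I0 [i [q [[injI0 i_inj ess] [_ iq qS]]]]].
have [s [c [s0 cE cs clin]]] := S_coord S_line.
have il : linear (i : restr_scal S -> restr_scal I0) by move=> k; exact: (linearP i).
have cl : linear (c : restr_scal S -> K^o) by move=> k v w; exact: clin.
have [|eps0 eps0P] := @functional_extension K _ _ (mk_linear il) (mk_linear cl).
  move=> v; rewrite !mk_linearE => iv; have -> : v = 0 by apply: i_inj; rewrite linear0.
  exact: (linear0 (mk_linear cl)).
have {}eps0P v : eps0 (i v) = c v by exact: eps0P.
(* a functional on the envelope that extends the coordinate of [S] *)
pose eps (v : I0) : K := eps0 (e *: v).
have epsD v w : eps (v + w) = eps v + eps w by rewrite /eps scalerDr; exact: linearD.
have epsB v w : eps (v - w) = eps v - eps w by rewrite /eps scalerBr; exact: linearB.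
have epsk k v : eps (kscal R k *: v) = k * eps v.
  by rewrite /eps scalerA -kscalC -scalerA; exact: (linearZ_LR eps0).
have eps_e v : eps (e *: v) = eps v by rewrite /eps scalerA ee.
have cZ k v : c (kscal R k *: v) = k * c v by rewrite {1}[v]cE scalerA -rmorphM cs.
have epsi b v : eps (b *: i v) = chi b * c v.
  by rewrite /eps scalerA -linearZ eps0P S_act chiM chi_e mul1r cZ.
have cs1 : c s = 1 by rewrite -[s]scale1r -(rmorph1 (kscal R)) cs.
pose DR : lmodType R := dual_regular R.
have dvalk' (f : DR) k (u : R) : dval f (kscal R k * u : R) = k * dval f u.
  by rewrite kscalC; exact: (dvalk f k u).
have /choice [beta betaP] (v : I0) : exists f : DR, forall u : R, dval f u = eps (u *: v).
  apply: (@dval_mk K R ((op_alg R)^o) (fun u : R => eps (u *: v))) => [u w|k u].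
    by rewrite scalerDl epsD.
  by rewrite -epsk scalerA kscalC.
have betal : linear beta.
  move=> b v w; apply: dvalP => u; rewrite dvalDf dval_act !betaP scalerDr epsD.
  by rewrite scalerA.
(* [beta] embeds the envelope in [D R], as it does not vanish on the socle [S] *)
have beta_inj v : beta v = 0 -> v = 0.
  apply: (ess [set v | beta v = 0]%classic) => [|{}v].
    exact: (is_submodule_ker (mk_linear betal)).
  move=> /(congr1 (fun f : DR => dval f (1 : R))); rewrite betaP epsi dval0f.
  by rewrite (chi1 be e_neq0) mul1r => c0; rewrite [v]cE c0 rmorph0 scale0r.
have idl : linear (@idfun I0) by [].
have [|r0 r0P] := injective_extend (g := mk_linear betal) (f := mk_linear idl) injI0.
  by move=> v; rewrite !mk_linearE => /beta_inj.
have {}r0P v : r0 (beta v) = v by exact: r0P.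
(* the image of [beta] is [D (e R)]: the part of a functional on [e R] killed by the
   retraction [r0] would otherwise have [beta (i s)] among its multiples *)
have betar (f : DR) : (forall u : R, dval f (e * u) = dval f u) -> beta (r0 f) = f.
  move=> fe; apply/eqP; rewrite -subr_eq0; apply/eqP; set psi := _ - f.
  have rpsi : r0 psi = 0 by rewrite linearB r0P subrr.
  have epsi' (u : R) : dval psi (e * u) = dval psi u.
    by rewrite !dvalDf !dvalNf fe !betaP -scalerA eps_e.
  apply: dvalP => u; rewrite dval0f; apply: contrapT => /eqP psiu; case: s0.
  have E : (e * u) *: psi = kscal R (dval psi u) *: beta (i s).
    apply: dvalP => w; rewrite !dval_act betaP epsi.
    rewrite -[LHS]/(dval psi ((w : R) * (e * u))) -epsi' mulrA mulrA -[e * w * e]mulrA be.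
    have -> : e * (kscal R (chi w) * e) * u = kscal R (chi w) * (e * u).
      by rewrite [e * (_ * _)]mulrA -kscalC -[_ * e * e]mulrA ee mulrA.
    rewrite dvalk' epsi' cs1 mulr1.
    rewrite -[X in _ = chi X]/((w : R) * kscal R (dval psi u)).
    by rewrite chiM (chi_scal be e_neq0).
  have := congr1 r0 E; rewrite !linearZ /= rpsi scaler0 r0P => /esym is0.
  apply: i_inj; rewrite linear0 -[i s]scale1r -(rmorph1 (kscal R)) -(mulVf psiu).
  by rewrite rmorphM -scalerA is0 scaler0.
have sep (u u' : R) : e * u = u -> e * u' = u' -> (forall v, eps (u *: v) = eps (u' *: v)) -> u = u'.
  move=> eu eu' H; apply/eqP; rewrite -subr_eq0; apply/eqP.
  apply: (@dval_separates K R ((op_alg R)^o)) => f.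
  have [||fe feP] := @dval_mk K R ((op_alg R)^o) (fun u : R => dval f (e * u)).
  - by move=> n m; rewrite mulrDr dvalD.
  - move=> k n; rewrite -dvalk; congr (dval f _).
    by rewrite -[LHS]/(e * ((n : R) * kscal R k)) mulrA.
  have fee (w : R) : dval fe (e * w) = dval fe w by rewrite !feP mulrA ee.
  have -> : dval f (u - u') = dval fe (u - u') by rewrite feP mulrBr eu eu'.
  by rewrite dvalB -(betar fe fee) !betaP H subrr.
pose xv (xi : D_left X) (v : I0) : K := (xi : lhom (restr_scal X) K^o) (q v).
(* a functional on [X] is one on the envelope, and so an evaluation at an element of [e R] *)
have /choice [iota0 iotaP] (xi : D_left X) : exists u : R, e * u = u /\
    forall v, xv xi v = eps (u *: v).
  have [|u uP] := reflexive
    (F := fun f : lhom (restr_scal ((op_alg R)^o)) K^o => xv xi (r0 (f : DR))) (fdim_op fdR).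
    move=> k f g h hE; have -> : h = kscal R k *: (f : DR) + (g : DR) :> DR.
      apply: dvalP => u; rewrite dvalDf dval_act.
      by rewrite -[dval f (_ *: _)]/(dval f (kscal (op_alg R) k *: u)) dvalk; exact: hE.
    rewrite linearP /xv linearP; exact: (linearP (lhom_fun (xi : lhom (restr_scal X) K^o)) k).
  exists (e * u); split=> [|v]; first by rewrite mulrA ee.
  rewrite -[in LHS](r0P v) uP -[RHS]eps_e.
  by rewrite -[LHS]/(dval (beta v) u) betaP scalerA mulrA ee -scalerA eps_e.
have iotal : linear (iota0 : D_left X -> (op_alg R)^o).
  move=> b xi xi'; have [ee1 P1] := iotaP xi; have [ee2 P2] := iotaP xi'.
  have [ee3 P3] := iotaP (b *: xi + xi').
  apply: sep => //.
    by rewrite -[X in e * X]/(iota0 xi * b + iota0 xi' : R) mulrDr mulrA ee1 ee2.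
  move=> v; rewrite -P3 -[X in eps (X *: v)]/(iota0 xi * b + iota0 xi' : R).
  by rewrite scalerDl epsD -scalerA -P1 -P2 /xv linearZ.
exists (mk_linear iotal); split.
  move=> xi xi' ii; apply: lhomP => x; have [v <-] := qS x.
  rewrite -/(xv xi v) -/(xv xi' v); have [_ ->] := iotaP xi; have [_ ->] := iotaP xi'.
  by congr (eps (_ *: v)).
move=> b; split=> [[xi <-]|[u bE]].
  have [e1 P1] := iotaP xi; have [u [_ uE]] := eb (iota0 xi); exists u.
  rewrite mk_linearE -e1 uE; have -> : chi (iota0 xi) = 0.
    have := P1 (i s); rewrite epsi -[s in c s]scale1r -(rmorph1 (kscal R)) cs mulr1 => <-.
    have q0 : q (i s) = 0 by apply/iq; exists s.
    by rewrite /xv q0; exact: (linear0 (lhom_fun (xi : lhom (restr_scal X) K^o))).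
  by rewrite rmorph0 mul0r add0r.
have eb' : e * b = b by rewrite bE mulr_sumr; apply: eq_bigr => l _; rewrite mulrA ea.
have chi0 : chi b = 0.
  have chi_0 : chi 0 = 0 by have := chiD 0 0; rewrite addr0 => /eqP; rewrite -subr_eq subrr eq_sym => /eqP.
  rewrite bE (big_morph chi chiD chi_0) big1 // => l _.
  by rewrite chiM chi_a mul0r.
have [t tP] := choice qS.
have xiE v : eps (b *: v) = eps (b *: t (q v)).
  apply/eqP; rewrite -subr_eq0 -epsB -scalerBr; apply/eqP.
  have [s' <-] : exists s', i s' = v - t (q v) by apply/iq; rewrite linearB tP subrr.
  by rewrite epsi chi0 mul0r.
have xil : linear (fun x : restr_scal X => eps (b *: t x) : K^o).
  move=> k x x'; have -> : k *: x + x' = q (kscal R k *: t x + t x').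
    by rewrite linearP !tP.
  by rewrite -xiE scalerDr epsD scalerA -kscalC -scalerA epsk.
exists (Lhom xil : D_left X); rewrite mk_linearE.
have [e1 P1] := iotaP (Lhom xil : D_left X).
by apply: sep => // v; rewrite -P1 xiE.
Qed.

End CosyzygyDual.

(** * Tilting at a source *)

Section SourceTilting.
Variables (K : fieldType) (Q : quiver) (W : cpath K Q) (C : {set arrow Q}) (x : vertex Q).
Hypothesis oW : ord 2 W.
Hypothesis homW : forall y s, pcoef W y s != 0 -> count (mem C) s = 1%N.
Hypothesis minW : min_rel W C.
Hypothesis srcx : forall a : arrow Q, tgt a = x -> a \in C.
Variables (R : kalg K) (pi : {rmorphism cpath K Q -> R}).
Hypothesis piS : forall b, exists f, pi f = b.
Hypothesis pik : forall k, pi (cscal k) = kscal R k.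
Hypothesis piker : forall f, pi f = 0 <-> cl (relset W C) f.
Hypothesis fdR : finite_dimensional R.
Variables (B : kalg K) (piB : {rmorphism cpath K Q -> B}).
Hypothesis piBS : forall b, exists f, piB f = b.
Hypothesis piBk : forall k, piB (cscal k) = kscal B k.
Hypothesis piBker : forall f, piB f = 0 <-> cl (relset W (mu_plus x C)) f.

Local Notation e_ := (cor_e x pi).
Local Notation a_ := (cor_a x pi).
Local Notation y_ := (cor_y x pi).

(** The line [R e] defines a character, through which [R] acts on the simple module at [x]. *)
Lemma character_at : exists chi : R -> K,
  (forall b, b * e_ = kscal R (chi b) * e_) /\
  (forall b, exists u : arrow Q -> R, (forall i, y_ i * u i = u i) /\
    e_ * b = kscal R (chi b) * e_ + \sum_i a_ i * u i).
Proof.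
have [chi chiP] := choice (cor_dec srcx piS pik piker); exists chi.
by split=> b; have [u [H1 H2 H3]] := chiP b => //; exists u.
Qed.

(** The new summand [Y] has the relations at the source as its presentation, and the other one
    is [R * (1 - e)]; the hypotheses on [S] provide what [core_endo_alg] asks for. *)
Theorem source_tilting (S U T X Y : lmodType R) : gldim_le R 2 ->
  (exists s : S, s <> 0 /\ forall v : S, exists k, v = kscal R k *: s) ->
  (forall v : S, e_ *: v = v) ->
  ~ injective_mod S -> ext1_vanishes (dual_regular R) S -> mod_iso R^o (S * U)%type ->
  is_cosyzygy S X -> is_tau_inv X Y -> mod_iso T (Y * U)%type -> alg_iso (endo_alg T) B.
Proof.
move=> gl S_line S_e ninj ext isoR cosyz tauX isoT.
have [chi [be eb]] := character_at.
have S_act b (v : S) : b *: v = kscal R (chi b) *: v.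
  by rewrite -{1}[v]S_e scalerA be -scalerA S_e.
have e_neq0 : e_ <> 0 by apply/eqP; exact: (cor_e_neq0 oW homW minW srcx piS pik piker fdR).
have ee := cor_ee x pi; have ea := cor_ea x pi; have ay := cor_ay x pi.
have yy := cor_yy x pi; have zz := cor_zz x pi.
have ye := cor_ye oW homW minW srcx pi.
have yr := cor_yr oW homW minW srcx pi; have rz := cor_rz oW homW minW srcx pi.
have ar := cor_ar x oW homW piker.
have syz := cor_syz oW homW minW srcx piS pik piker fdR.
have H2 : syzygy_projection W x pi by exact: (syzygy_projection_gldim ay yy zz yr rz ar syz fdR gl).
have rinj := cor_rinj oW homW minW srcx piS pik piker fdR H2.
have H3 := extension_tilting be eb e_neq0 ea ay yy ye syz fdR S_line S_act ext.
have a0 := arrows_neq0 be eb e_neq0 ee S_line S_act ninj.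
have [u0 [eu0 Ugen Ufree]] := complement_generator be ee (chi_co be e_neq0 ee) S_line S_act isoR.
have [iota [iota_inj iota_im]] :=
  cosyzygy_dual be eb e_neq0 ee ea ay ye fdR S_line S_act cosyz.
have [t tP] := @transpose_presents K (op_alg R) R (@to_op_op K R) (fun b => b) (fun _ => erefl)
  (fun _ => erefl) _ (a_ : _ -> op_alg R) y_ (cor_z x pi) (cor_r W x pi) ay yy zz yr rz ar syz
  rinj _ iota iota_inj iota_im Y tauX.
apply: alg_iso_trans (endo_alg_iso isoT) _.
exact: (core_endo_alg oW homW minW srcx piS pik piker fdR H2 H3 tP eu0 Ugen Ufree
  piBS piBk piBker a0).
Qed.

End SourceTilting.

(** * The simple module at a sink *)

Section SinkAlgebra.
Variables (K : fieldType) (A : kalg K) (T : finType) (e : A) (a y z : T -> A)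
  (r : T -> T -> A) (chi : A -> K).
Hypothesis eb : forall b, e * b = kscal A (chi b) * e.
Hypothesis be : forall b, exists u : T -> A, (forall i, u i * y i = u i) /\
  b * e = kscal A (chi b) * e + \sum_i u i * a i.
Hypothesis e_neq0 : e <> 0.
Hypothesis ee : e * e = e.
Hypothesis ae : forall i, a i * e = a i.
Hypothesis ya : forall i, y i * a i = a i.
Hypothesis yy : forall i, y i * y i = y i.
Hypothesis ry : forall i j, r i j * y i = r i j.
Hypothesis zr : forall i j, z j * r i j = r i j.
Hypothesis ey : forall i, e * y i = 0.
Hypothesis ra : forall j, \sum_i r i j * a i = 0.
Hypothesis syz : forall u : T -> A, (forall i, u i * y i = u i) -> \sum_i u i * a i = 0 ->
  exists v : T -> A, (forall j, v j * z j = v j) /\ forall i, u i = \sum_j v j * r i j.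

Variables (S : lmodType A).
Hypothesis S_line : exists s : S, s <> 0 /\ forall v : S, exists k, v = kscal A k *: s.
Hypothesis S_act : forall b (v : S), b *: v = kscal A (chi b) *: v.

Let ebop (b : op_alg A) : b * (e : op_alg A) = kscal (op_alg A) (chi b) * (e : op_alg A).
Proof. by rewrite -[RHS]kscalC; exact: eb. Qed.
Let beop (b : op_alg A) : exists u : T -> op_alg A, (forall i, (y i : op_alg A) * u i = u i) /\
  (e : op_alg A) * b = kscal (op_alg A) (chi b) * (e : op_alg A) + \sum_i (a i : op_alg A) * u i.
Proof.
have [u [uy uE]] := be b; exists u; split=> //; rewrite kscalC; exact: uE.
Qed.

Let chi_e : chi e = 1. Proof. exact: (chi_e ebop e_neq0 ee). Qed.
Let chiM b c : chi (b * c) = chi b * chi c.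
Proof. by rewrite mulrC; exact: (chiM ebop e_neq0). Qed.
Let chi_a i : chi (a i) = 0. Proof. exact: (chi_a ebop e_neq0 ya ey). Qed.

Lemma line_zero (s : S) k : s <> 0 -> kscal A k *: s = 0 -> k = 0.
Proof.
move=> s0 ks; apply/eqP; apply: contraT => k0; case: s0.
by rewrite -[s]scale1r -(rmorph1 (kscal A)) -(mulVf k0) rmorphM -scalerA ks scaler0.
Qed.

Lemma S_e (v : S) : e *: v = v.
Proof. by rewrite S_act chi_e rmorph1 scale1r. Qed.
Lemma S_a i (v : S) : a i *: v = 0.
Proof. by rewrite S_act chi_a rmorph0 scale0r. Qed.

(** The coefficient of an element of [A e] on [e] is seen on [S]. *)
Lemma kills_line (s : S) b : s <> 0 -> (b * e) *: s = 0 -> exists u : T -> A,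
  (forall i, u i * y i = u i) /\ b * e = \sum_i u i * a i.
Proof.
move=> s0 bs; have [u [uy uE]] := be b; exists u; split=> //.
suff c0 : chi b = 0 by rewrite uE c0 rmorph0 mul0r add0r.
by move: bs; rewrite -scalerA S_e S_act; exact: line_zero.
Qed.

(** A projective module onto [S] maps to [A e], the projective cover of [S]. *)
Lemma lift_to_cover (s : S) (P : lmodType A) (p : {linear P -> S}) :
  s <> 0 -> projective P -> exists g : {linear P -> A^o},
    (forall x, (g x : A) * e = g x) /\ forall x, (g x : A) *: s = p x.
Proof.
move=> s0 projP.
have hl : linear (fun b : A^o => (b : A) *: s).
  by move=> k u v; rewrite scalerDl scalerA.
have [x|g gP] := projective_lift (g := mk_linear hl) (f := p) projP.
  have [s' [s'0 s'P]] := S_line; have [[k sE] [l pE]] := (s'P s, s'P (p x)).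
  have k0 : k != 0 by apply/eqP => k0; apply: s0; rewrite sE k0 rmorph0 scale0r.
  exists (kscal A (l / k)); rewrite mk_linearE sE scalerA -rmorphM divfK //.
have gl : linear (fun x => (g x : A) * e : A^o).
  by move=> k u v; rewrite linearP mulrDl -mulrA.
exists (mk_linear gl); split=> x; first by rewrite mk_linearE -mulrA ee.
by rewrite mk_linearE -scalerA S_e -gP.
Qed.

(** The image of the generator is a scalar multiple of [e], by [eb], and the scalar is seen on
    [S]. *)
Lemma lift_gen (s : S) (P : lmodType A) (p : {linear P -> S}) (g : {linear P -> A^o}) q :
  s <> 0 -> (forall x, (g x : A) * e = g x) -> (forall x, (g x : A) *: s = p x) ->
  e *: q = q -> p q = s -> g q = e.
Proof.
move=> s0 ge gs eq ps; have gq : (g q : A) = kscal A (chi (g q)) * e.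
  by rewrite -{1}eq linearZ; exact: eb.
have {}ps : kscal A (chi (g q) - 1) *: s = 0.
  rewrite rmorphB rmorph1 scalerBl scale1r -{2}ps -gs gq -scalerA S_e.
  have -> : chi (kscal A (chi (g q)) * e) = chi (g q) by rewrite -gq.
  exact: subrr.
have : chi (g q) - 1 = 0 by exact: line_zero ps.
by move/eqP; rewrite subr_eq0 => /eqP k1; rewrite gq k1 rmorph1 mul1r.
Qed.

Lemma simple_generator (s : S) (P : lmodType A) (p : {linear P -> S}) : surj p ->
  exists q, e *: q = q /\ p q = s.
Proof.
move=> pS; have [q qE] := pS s; exists (e *: q).
by rewrite scalerA ee linearZ /= qE S_e.
Qed.

Let deltaE (F : T -> A) l : \sum_i (i == l)%:R * F i = F l.
Proof.
rewrite (bigD1 l) //= eqxx mul1r big1 ?addr0 // => i /negPf ->.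
by rewrite mul0r.
Qed.

(** The comparison maps between the given projective resolution of [S] and the complex
    [A^T -> A^T -> A] with matrices [r] and [a] are homotopic to the identity, and the
    homotopy corrects the identity to a projection on the syzygies of the rows of [r]. *)
Lemma syzygy_projection_pdim : pdim_le 2 S -> exists rho : T -> T -> A,
  (forall i k, \sum_j rho j k * r i j = 0) /\
  (forall v : T -> A, (forall j, v j * z j = v j) -> (forall i, \sum_j v j * r i j = 0) ->
     forall j, \sum_k v k * rho j k = v j).
Proof.
move=> [N1 [P0 [i0 [p0 [projP0 [i0_inj i0p0 p0S]
  [P2 [P1 [i1 [p1 [projP1 [i1_inj i1p1 p1S] projP2]]]]]]]]]].
have [s [s0 _]] := S_line.
have [q0 [eq0 pq0]] := simple_generator s p0S.
have /choice [n1 n1P] i : exists q1 : P1, i0 (p1 q1) = a i *: q0.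
  have [n nE] : exists n, i0 n = a i *: q0 by apply/i0p0; rewrite linearZ /= pq0 S_a.
  by have [q1 q1E] := p1S n; exists q1; rewrite q1E.
pose q1 i := y i *: n1 i.
have q1P i : i0 (p1 (q1 i)) = a i *: q0 by rewrite !linearZ /= n1P scalerA ya.
have /choice [n2 n2P] j : exists q2 : P2, i1 q2 = \sum_i r i j *: q1 i.
  apply/i1p1; apply: i0_inj; rewrite linear0 !linear_comb.
  rewrite (eq_bigr (fun i => (r i j * a i) *: q0)) => [|i _]; last by rewrite q1P scalerA.
  by rewrite -scaler_suml ra scale0r.
pose q2 j := z j *: n2 j.
have q2P j : i1 (q2 j) = \sum_i r i j *: q1 i.
  rewrite linearZ /= n2P scaler_sumr; apply: eq_bigr => i _.
  by rewrite scalerA zr.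
have [g0 [g0e g0s]] := lift_to_cover p0 s0 projP0.
have g0q : g0 q0 = e by exact: (lift_gen s0 g0e g0s eq0 pq0).
(* the lift in degree one *)
have al : linear (fun u : {ffun T -> A^o} => \sum_i (u i : A) * a i : A^o).
  move=> k u v; rewrite scaler_sumr -big_split; apply: eq_bigr => i _ /=.
  by rewrite !ffunE mulrDl -mulrA.
have d1l : linear (fun p => g0 (i0 (p1 p))) by move=> k u v; rewrite !linearP.
have [p|G1 G1P] := projective_lift (g := mk_linear al) (f := mk_linear d1l) projP1.
  have [|u [_ uE]] := @kills_line s (g0 (i0 (p1 p))) s0.
    by rewrite g0e g0s; apply/i0p0; exists (p1 p).
  exists [ffun i => u i]; rewrite !mk_linearE -g0e uE.
  by apply: eq_bigr => i _; rewrite ffunE.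
have {}G1P p : \sum_i (G1 p i : A) * a i = g0 (i0 (p1 p)) by exact: G1P.
pose g1 p i : A := (G1 p i : A) * y i.
have g1y p i : g1 p i * y i = g1 p i by rewrite /g1 -mulrA yy.
have g1a p : \sum_i g1 p i * a i = g0 (i0 (p1 p)).
  by rewrite -G1P; apply: eq_bigr => i _; rewrite /g1 -mulrA ya.
have g1l i : linear (fun p => g1 p i : A^o).
  by move=> k u v; rewrite /g1 linearP !ffunE mulrDl -mulrA.
have /choice [h hP] l : exists v : T -> A, (forall j, v j * z j = v j) /\
    forall i, (i == l)%:R * y i - g1 (q1 l) i = \sum_j v j * r i j.
  apply: syz => [i|]; first by rewrite mulrBl g1y -mulrA yy.
  rewrite (eq_bigr (fun i => (i == l)%:R * a i - g1 (q1 l) i * a i)) => [|i _]; last first.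
    by rewrite mulrBl -mulrA ya.
  rewrite sumrB deltaE g1a q1P.
  have -> : g0 (a l *: q0) = a l * e by rewrite linearZ g0q.
  by rewrite ae subrr.
(* the lift in degree two *)
have rl : linear (fun v : {ffun T -> A^o} => [ffun i => \sum_j (v j : A) * r i j] : {ffun T -> A^o}).
  move=> k u v; apply/ffunP => i; rewrite !ffunE.
  rewrite scaler_sumr -big_split; apply: eq_bigr => j _ /=.
  by rewrite !ffunE mulrDl -mulrA.
have d2l : linear (fun p => [ffun i => g1 (i1 p) i] : {ffun T -> A^o}).
  by move=> k u v; apply/ffunP => i; rewrite !ffunE linearP [LHS]g1l.
have [p|G2 G2P] := projective_lift (g := mk_linear rl) (f := mk_linear d2l) projP2.
  have [||v [_ vE]] := @syz (fun i => g1 (i1 p) i).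
  - by move=> i; exact: g1y.
  - by rewrite g1a (iffRL (i1p1 _)) ?linear0 //; exists p.
  exists [ffun j => v j]; apply/ffunP => i; rewrite !mk_linearE !ffunE vE.
  by apply: eq_bigr => j _; rewrite ffunE.
pose g2 p j : A := (G2 p j : A) * z j.
have g2r p i : \sum_j g2 p j * r i j = g1 (i1 p) i.
  have /ffunP/(_ i) := G2P p; rewrite !mk_linearE !ffunE => <-.
  by apply: eq_bigr => j _; rewrite /g2 -mulrA zr.
have g2l j : linear (fun p => g2 p j : A^o).
  by move=> k u v; rewrite /g2 linearP !ffunE mulrDl -mulrA.
exists (fun j k => (j == k)%:R * z k - g2 (q2 k) j - \sum_i r i k * h i j); split.
  move=> i k; rewrite (eq_bigr (fun j => (j == k)%:R * r i j - g2 (q2 k) j * r i j -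
     \sum_l r l k * (h l j * r i j))) => [|j _]; last first.
    rewrite !mulrBl mulr_suml; congr (_ - _ - _).
      by have [->|_] := eqVneq j k; rewrite ?mul0r // mul1r mul1r zr.
    by apply: eq_bigr => l _; rewrite mulrA.
  rewrite !sumrB deltaE g2r q2P exchange_big /=.
  rewrite [X in _ - _ - X](eq_bigr (fun l => (l == i)%:R * (r l k * y i) - r l k * g1 (q1 l) i)); last first.
    move=> l _; rewrite -mulr_sumr; have [_ <-] := hP l.
    rewrite mulrBr eq_sym; congr (_ - _).
    by case: (l == i); rewrite ?mul1r // !mul0r mulr0.
  rewrite sumrB deltaE ry.
  have -> : g1 (\sum_l r l k *: q1 l) i = \sum_l r l k * g1 (q1 l) i.
    exact: (linear_comb (mk_linear (g1l i))).
  exact: subrr.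
move=> v vz vr j.
have v0 : \sum_k v k *: q2 k = 0.
  apply: i1_inj; rewrite linear0 linear_comb.
  rewrite (eq_bigr (fun k => \sum_i (v k * r i k) *: q1 i)) => [|k _].
    rewrite exchange_big big1 // => i _.
    by rewrite -scaler_suml vr scale0r.
  by rewrite q2P scaler_sumr; apply: eq_bigr => i _; rewrite scalerA.
rewrite (eq_bigr (fun k => (k == j)%:R * v k - v k * g2 (q2 k) j - \sum_i v k * r i k * h i j)).
  rewrite !sumrB deltaE.
  have -> : \sum_k v k * g2 (q2 k) j = 0.
    have := linear_comb (mk_linear (g2l j)) (index_enum T) v q2.
    by rewrite v0 linear0 => /esym.
  rewrite exchange_big [X in _ - X]big1 ?subr0 // => i _.
  by rewrite -mulr_suml vr mul0r.
move=> k _; rewrite !mulrBr mulr_sumr eq_sym; congr (_ - _ - _).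
  by case: (k == j); rewrite ?mul1r ?mulr1 ?vz // !mul0r mulr0.
by apply: eq_bigr => i _; rewrite mulrA.
Qed.

(** The vanishing of [Ext^1(S, A)] makes the derivation inner. *)
Lemma extension_cotilting : ext1_vanishes S A^o ->
  forall w : T -> A, (forall i, y i * w i = w i) ->
    (forall j, \sum_i r i j * w i = 0) -> exists b, forall i, w i = a i * b.
Proof.
move=> ext w yw rw.
have [delta [deltaD deltaM deltak deltaa]] :=
  @derivation K (op_alg A) T e a y z r chi ebop beop e_neq0 ae ya yy ey syz w rw.
have dM (b c : A) : delta (b * c) = (delta b : A) * kscal A (chi c) + b * delta c.
  exact: (deltaM c b).
have [s [c [s0 cE cs clin]]] := S_coord S_line.
have cD v v' : c (v + v') = c v + c v'.
  by have := clin 1 v v'; rewrite rmorph1 scale1r mul1r.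
have cZ k v : c (kscal A k *: v) = k * c v by rewrite {1}[v]cE scalerA -rmorphM cs.
pose kappa (b : A) (v : S) : A^o := kscal A (c v) * delta b.
have kDl b d v : kappa (b + d) v = kappa b v + kappa d v by rewrite /kappa deltaD mulrDr.
have kDr b v v' : kappa b (v + v') = kappa b v + kappa b v'.
  by rewrite /kappa cD rmorphD mulrDl.
have k1 v : kappa 1 v = 0.
  by have d1 := deltak 1; rewrite rmorph1 in d1; rewrite /kappa [delta _]d1 mulr0.
have kM b d v : kappa (b * d) v = b *: kappa d v + kappa b (d *: v).
  rewrite /kappa dM mulrDr addrC; congr (_ + _).
    by rewrite mulrA kscalC -mulrA.
  by rewrite mulrA -[LHS]kscalC mulrA S_act cZ rmorphM.
have [F [FD Fk]] := cocycle_coboundary kDl kDr k1 kM ext.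
have cs1 : c s = 1 by rewrite -[s]scale1r -(rmorph1 (kscal A)) cs.
have F0 : F 0 = 0 by have := FD 0 0; rewrite addr0 => /eqP; rewrite -subr_eq subrr eq_sym => /eqP.
exists (- (F s : A)) => i.
have := Fk (a i) s; rewrite S_a F0 sub0r /kappa cs1 rmorph1 mul1r [delta _]deltaa.
by rewrite -[X in X = _ -> _]/(y i * w i : A) yw mulrN.
Qed.

(** A projective cover of [S] is isomorphic to [A e], so the syzygy of [S] is the radical of
    [A e]. *)
Lemma syzygy_ideal (X : lmodType A) : is_syzygy S X -> exists iota : {linear X -> A^o},
  injective iota /\ forall b : A, (exists m, iota m = b) <-> exists u : T -> A, b = \sum_i u i * a i.
Proof.
move=> [P [i [p [[projP pS psup] [i_inj ip _]]]]].
have [s [s0 sP]] := S_line.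
have [q [eq pq]] := simple_generator s pS.
have [g [ge gs]] := lift_to_cover p s0 projP.
have gq : g q = e by exact: (lift_gen s0 ge gs eq pq).
have genP x : exists b : A, x = b *: q.
  apply: (psup [set x | exists b : A, x = b *: q]%classic) => [|{}x].
    split; first by exists 0; rewrite scale0r.
    by move=> k _ _ [b ->] [c ->]; exists (k * b + c); rewrite scalerDl scalerA.
  have [k kE] := sP (p x); exists (kscal A k *: q), (x - kscal A k *: q); split.
  - by exists (kscal A k).
  - by rewrite linearB linearZ /= pq kE subrr.
  - by rewrite addrC subrK.
have gl : linear (fun x => g (i x)) by move=> k u v; rewrite !linearP.
exists (mk_linear gl); split.
  move=> x x' /eqP; rewrite -subr_eq0 -linearB mk_linearE => /eqP gx.
  apply/eqP; rewrite -subr_eq0; apply/eqP; apply: i_inj; rewrite linear0.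
  have [b bE] := genP (i (x - x')).
  have be0 : b * e = 0 by rewrite -gx bE linearZ gq.
  by rewrite bE -eq scalerA be0 scale0r.
move=> b; split=> [[x <-]|[u bE]].
  rewrite mk_linearE -ge; have [|u [_ uE]] := @kills_line s (g (i x)) s0; last by exists u.
  by rewrite ge gs; apply/ip; exists x.
have bE' : b * e = b by rewrite bE mulr_suml; apply: eq_bigr => j _; rewrite -mulrA ae.
have /ip [x xE] : p (b *: q) = 0.
  rewrite linearZ /= pq bE scaler_suml big1 // => j _.
  by rewrite -scalerA S_a scaler0.
by exists x; rewrite mk_linearE xE linearZ gq -[RHS]bE'.
Qed.

(** If no arrow ends at the sink, the simple injective module is projective. *)
Lemma sink_arrows_neq0 : ~ projective S -> exists i, a i <> 0.
Proof.
move=> nproj; apply: contrapT => a0; apply: nproj => M N g f gS.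
have bes b : b * e = kscal A (chi b) * e.
  have [u [_ ->]] := be b; rewrite big1 ?addr0 // => i _.
  suff -> : a i = 0 by rewrite mulr0.
  by apply: contrapT => ai; apply: a0; exists i.
have [s [c [s0 cE cs clin]]] := S_coord S_line.
have [m mE] := gS (f s).
have hl : linear (fun v => kscal A (c v) *: (e *: m)).
  move=> b u v; have -> : b *: u = kscal A (chi b) *: u by exact: S_act.
  rewrite clin rmorphD scalerDl mulrC rmorphM -scalerA; congr (_ + _).
  rewrite [RHS]scalerA -kscalC -scalerA; congr (_ *: _).
  by rewrite !scalerA (bes b).
exists (mk_linear hl) => v; rewrite mk_linearE !linearZ /= mE -linearZ S_e.
by rewrite -linearZ /= -cE.
Qed.

End SinkAlgebra.

(** * Dual modules and their endomorphisms *)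

Lemma mod_iso_bij (R : pzRingType) (M N : lmodType R) (f : {linear M -> N}) :
  injective f -> surj f -> mod_iso M N.
Proof.
move=> fI fS; have [g gP] := choice fS.
by exists f, g => [x|y]; [apply: fI; rewrite gP | exact: gP].
Qed.

Lemma mod_iso_trans (R : pzRingType) (M N P : lmodType R) :
  mod_iso M N -> mod_iso N P -> mod_iso M P.
Proof. by move=> [f fb] [g gb]; exists (g \o f); exact: bij_comp. Qed.

Lemma mod_iso_prod (R : pzRingType) (M N U : lmodType R) :
  mod_iso M N -> mod_iso (M * U)%type (N * U)%type.
Proof.
move=> [f [g fK gK]].
have fl : linear (fun p : M * U => (f p.1, p.2)).
  by move=> k p q; congr (_, _); rewrite /= linearP.
by exists (mk_linear fl), (fun p => (g p.1, p.2)) => -[m u]; rewrite mk_linearE /= ?fK ?gK.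
Qed.

Lemma alg_iso_op (K : comPzRingType) (A B : kalg K) :
  alg_iso A (op_alg B) -> alg_iso (op_alg A) B.
Proof.
move=> [f [fk fb]].
have fB : zmod_morphism (f : op_alg A -> B) by move=> a b; exact: (rmorphB f a b).
have fM : monoid_morphism (f : op_alg A -> B).
  by split=> [|a b]; [exact: (rmorph1 f) | exact: (rmorphM f b a)].
pose g : {rmorphism op_alg A -> B} := HB.pack (f : op_alg A -> B)
  (GRing.isZmodMorphism.Build _ _ _ fB) (GRing.isMonoidMorphism.Build _ _ _ fM).
by exists g; split=> // k; exact: fk.
Qed.

Section Duality.
Variables (K : fieldType) (A : kalg K).
Local Notation Aop := (op_alg A).

Lemma endoB (R : kalg K) (M : lmodType R) (f g : endo_alg M) v :
  ((f - g : endo_alg M) : lhom M M) v = (f : lhom M M) v - (g : lhom M M) v.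
Proof. by []. Qed.

(** By reflexivity, the linear maps between dual modules are the dual maps. *)
Lemma endo_dual (M : lmodType Aop) : fdim (restr_scal M) ->
  alg_iso (op_alg (endo_alg M)) (endo_alg (D_right M)).
Proof.
move=> fM; pose phi (f : op_alg (endo_alg M)) : endo_alg (D_right M) :=
  Lhom (linearP (dmap (lhom_fun (f : lhom M M)))).
have phiE f x n : dval ((phi f : lhom _ _) x) n = dval x ((f : lhom M M) n).
  exact: dmapE.
have phiB : zmod_morphism phi.
  move=> f g; apply: lhomP => x; rewrite [RHS]endoB; apply: dvalP => n.
  rewrite dvalDf dvalNf [LHS]phiE [X in dval x X](endoB (f : endo_alg M) g) dvalB.
  by congr (_ - _); exact/esym/phiE.
have phiM : monoid_morphism phi.
  split=> [|f g]; apply: lhomP => x; apply: dvalP => n; first exact: phiE.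
  transitivity (dval x ((f : lhom M M) ((g : lhom M M) n))); first exact: phiE.
  apply/esym; rewrite -[LHS]/(dval ((phi g : lhom _ _) ((phi f : lhom _ _) x)) n).
  by rewrite [LHS]phiE [LHS]phiE.
pose phir : {rmorphism op_alg (endo_alg M) -> endo_alg (D_right M)} := HB.pack phi
  (GRing.isZmodMorphism.Build _ _ _ phiB) (GRing.isMonoidMorphism.Build _ _ _ phiM).
exists phir; split=> [k|].
  apply: lhomP => x; apply: dvalP => n; rewrite [LHS]phiE.
  by rewrite -[RHS]/(dval x ((kscal A k : Aop) *: n)).
have /choice [psi psiP] (th : endo_alg (D_right M)) : exists f : lhom M M,
    forall x n, dval x (f n) = dval ((th : lhom _ _) x) n.
  have /choice [f fP] (n : M) : exists m : M,
      forall x : D_right M, dval x m = dval ((th : lhom _ _) x) n.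
    have [|m mP] := reflexive (F := fun x : lhom (restr_scal M) K^o =>
        dval ((th : lhom _ _) (x : D_right M)) n) fM.
      move=> k f g h hE; have -> : h = kscal A k *: (f : D_right M) + (g : D_right M) :> D_right M.
        apply: dvalP => u; rewrite dvalDf dval_act.
        by rewrite -[dval f (_ *: _)]/(dval (f : D_right M) (kscal Aop k *: u)) dvalk; exact: hE.
      by rewrite linearP dvalDf dval_act; congr (_ + _); exact: dvalk.
    by exists m => x; exact/esym/mP.
  have fl : linear f.
    move=> b n m; apply/eqP; rewrite -subr_eq0; apply/eqP; apply: dval_separates => x.
    by rewrite dvalB dvalD fP -dval_act !fP linearZ dvalD dval_act subrr.
  by exists (Lhom fl).
exists psi => [f|th]; apply: lhomP => x.
  apply/eqP; rewrite -subr_eq0; apply/eqP; apply: dval_separates => u.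
  by rewrite dvalB psiP [dval ((_ : lhom _ _) u) x]phiE subrr.
by apply: dvalP => n; rewrite [LHS]phiE psiP.
Qed.

Lemma fdim_op_regular : finite_dimensional A -> finite_dimensional Aop.
Proof.
move=> [n [v vP]]; exists n, v => b; have [c cE] := vP b; exists c.
by rewrite [LHS]cE; apply: eq_bigr => i _; rewrite kscalC.
Qed.

Lemma fdim_D_right (N : lmodType Aop) : fdim (restr_scal N) -> fdim (restr_scal (D_right N)).
Proof.
move=> /dual_basis [n [v [c cP]]].
exists n, (fun i => c i : D_right N) => f; exists (fun i => dval f (v i)).
suff H u : dval (f : D_right N) u = dval (\sum_i kscal A (dval f (v i)) *: (c i : D_right N)) u.
  exact: dvalP H.
have -> : dval (\sum_i kscal A (dval f (v i)) *: (c i : D_right N)) u =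
    \sum_i dval (kscal A (dval f (v i)) *: (c i : D_right N)) u.
  by apply: (big_morph (fun g : D_right N => dval g u)).
rewrite {1}[u]cP (dval_sum f); apply: eq_bigr => i _.
rewrite dval_act -[dval f (v i)]/(dval f (v i)).
by rewrite [LHS](dvalk f) mulrC; exact/esym/(dvalk (c i : D_right N) _ u).
Qed.

(** The same interface for the duals of left modules. *)
Definition lval (M : lmodType A) (f : D_left M) (v : M) : K :=
  (f : lhom (restr_scal M) K^o) v.

Section LeftEvaluation.
Variable M : lmodType A.
Implicit Types (f g : D_left M) (v : M).

Lemma lvalP f g : (forall v, lval f v = lval g v) -> f = g.
Proof. by move=> fg; apply: lhomP. Qed.
Lemma lvalD f v w : lval f (v + w) = lval f v + lval f w.
Proof. exact: (linearD (lhom_fun (f : lhom (restr_scal M) K^o))). Qed.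
Lemma lvalk f k v : lval f (kscal A k *: v) = k * lval f v.
Proof. exact: (linearZ_LR (lhom_fun (f : lhom (restr_scal M) K^o)) k (v : restr_scal M)). Qed.
Lemma lval_act (b : Aop) f v : lval (b *: f) v = lval f ((b : A) *: v).
Proof. by []. Qed.
Lemma lvalDf f g v : lval (f + g) v = lval f v + lval g v.
Proof. by []. Qed.

Lemma lval_mk (phi : M -> K) : (forall v w, phi (v + w) = phi v + phi w) ->
  (forall k v, phi (kscal A k *: v) = k * phi v) -> exists f, forall v, lval f v = phi v.
Proof.
move=> phiD phik.
have phil : linear (phi : restr_scal M -> K^o) by move=> k v w; rewrite phiD [phi _]phik.
by exists (Lhom phil).
Qed.

Lemma lval_separates v : (forall f, lval f v = 0) -> v = 0.
Proof.
move=> H; apply: (functional_separates (V := restr_scal M)) => phi.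
have phil : linear (phi : restr_scal M -> K^o) by exact: linearP.
exact: (H (Lhom phil)).
Qed.

End LeftEvaluation.

Lemma fdim_D_left (M : lmodType A) : fdim (restr_scal M) -> fdim (restr_scal (D_left M)).
Proof.
move=> /dual_basis [n [v [c cP]]].
exists n, (fun i => c i : D_left M) => f; exists (fun i => lval f (v i)).
suff H u : lval (f : D_left M) u = lval (\sum_i kscal Aop (lval f (v i)) *: (c i : D_left M)) u.
  exact: lvalP H.
have -> : lval (\sum_i kscal Aop (lval f (v i)) *: (c i : D_left M)) u =
    \sum_i lval (kscal Aop (lval f (v i)) *: (c i : D_left M)) u.
  by apply: (big_morph (fun g : D_left M => lval g u)).
rewrite {1}[u]cP; have -> : lval f (\sum_i c i u *: v i) = \sum_i c i u * lval f (v i).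
  have f0 : lval f 0 = 0 by have := lvalk f 0 0; rewrite scaler0 mul0r.
  by rewrite (big_morph (lval f) (lvalD f) f0); apply: eq_bigr => i _; exact: (lvalk f).
by apply: eq_bigr => i _; rewrite lval_act mulrC; exact/esym/(lvalk (c i : D_left M) _ u).
Qed.

Lemma line_dual (S : lmodType A) :
  (exists s : S, s <> 0 /\ forall v : S, exists k, v = kscal A k *: s) ->
  exists f : D_left S, f <> 0 /\ forall g : D_left S, exists k, g = kscal Aop k *: f.
Proof.
move=> /S_coord [s [c [s0 cE cs clin]]].
have [v w|k v|f fP] := @lval_mk S c.
- by have := clin 1 v w; rewrite rmorph1 scale1r mul1r.
- by rewrite {1}[v]cE scalerA -rmorphM cs.
exists f; split=> [f0|g].
  have := fP s; rewrite f0 -[s in c s]scale1r -(rmorph1 (kscal A)) cs => /esym/eqP.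
  by rewrite -[lval 0 s]/(0) oner_eq0.
exists (lval g s); apply: lvalP => v.
by rewrite lval_act (lvalk f) fP {1}[v]cE lvalk mulrC.
Qed.

Section DualComplement.
Hypothesis fdA : finite_dimensional A.
Variables S U : lmodType A.
Hypothesis isoD : mod_iso (dual_regular A) (S * U)%type.

Let fA : fdim (restr_scal (Aop^o)). Proof. exact: fdim_op. Qed.

(** The dual of [D A = S * U], identified with [A] by double duality. *)
Lemma dual_complement : mod_iso Aop^o (D_left S * D_left U)%type.
Proof.
have [phi [g gK phiK]] := isoD.
have gl : linear g by move=> k u v; apply: (can_inj gK); rewrite linearP !phiK.
have gD u v : g (u + v) = g u + g v by exact: (linearD (mk_linear gl)).
have gZ b u : g (b *: u) = b *: g u by exact: (linearZ_LR (mk_linear gl)).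
have /choice [F FP] (a : Aop^o) : exists p : D_left S * D_left U,
    forall s u, lval p.1 s + lval p.2 u = dval (g (s, u)) a.
  have [|k s|f fP] := @lval_mk S (fun s => dval (g (s, 0)) a).
  - by move=> s s'; rewrite -dvalDf -gD; congr (dval (g (_, _)) a); rewrite /= addr0.
  - rewrite -dvalk -dval_act -gZ; congr (dval (g (_, _)) a); exact/esym/scaler0.
  have [|k u|f' f'P] := @lval_mk U (fun u => dval (g (0, u)) a).
  - by move=> u u'; rewrite -dvalDf -gD; congr (dval (g (_, _)) a); rewrite /= addr0.
  - rewrite -dvalk -dval_act -gZ; congr (dval (g (_, _)) a); exact/esym/scaler0.
  exists (f, f') => s u; rewrite /= fP f'P -dvalDf -gD.
  by congr (dval (g (_, _)) a); rewrite /= ?addr0 ?add0r.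
have pairP (p p' : D_left S * D_left U) :
    (forall s u, lval p.1 s + lval p.2 u = lval p'.1 s + lval p'.2 u) -> p = p'.
  case: p p' => [p1 p2] [q1 q2] /= H.
  have l0 (M : lmodType A) (f : D_left M) : lval f 0 = 0.
    by have := lvalk f 0 0; rewrite scaler0 mul0r.
  congr (_, _); apply: lvalP => v; first by have := H v 0; rewrite !l0 !addr0.
  by have := H 0 v; rewrite !l0 !add0r.
have Fl : linear F.
  move=> b a a'; apply: pairP => s u.
  rewrite FP /= !lvalDf !lval_act addrACA FP dvalD; congr (_ + _); last by rewrite FP.
  by rewrite -[(_ *: s, _)]/((b : A) *: ((s, u) : S * U)) gZ dval_act.
apply: (mod_iso_bij (f := mk_linear Fl)) => [a a' /eqP|[f f']].
  rewrite -subr_eq0 -linearB => /eqP Fa; apply/eqP; rewrite -subr_eq0; apply/eqP.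
  apply: dval_separates => x; have := FP (a - a') (phi x).1 (phi x).2.
  rewrite -surjective_pairing gK => <-.
  by rewrite [F _]Fa addr0.
have [|a aP] := reflexive (F := fun x : lhom (restr_scal (Aop^o)) K^o =>
    lval f (phi (x : dual_regular A)).1 + lval f' (phi (x : dual_regular A)).2) fA.
  move=> k x y z hE.
  have -> : z = kscal A k *: (x : dual_regular A) + (y : dual_regular A) :> dual_regular A.
    apply: dvalP => u; rewrite dvalDf dval_act.
    by rewrite -[dval x (_ *: _)]/(dval (x : dual_regular A) (kscal Aop k *: u)) dvalk; exact: hE.
  by rewrite linearP /= !lvalD !lvalk mulrDr addrACA.
exists a; apply: pairP => s u; rewrite FP.
by have := aP (g (s, u)); rewrite phiK => ->.
Qed.

Lemma fdim_complement : fdim (restr_scal U).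
Proof.
have [phi [g gK phiK]] := isoD.
have fl : linear (fun x : restr_scal (dual_regular A) => (phi x).2 : restr_scal U).
  by move=> k x y; rewrite [phi _](linearP phi).
apply: (@fdim_surj _ _ _ (mk_linear fl)); last exact: fdim_D_right.
by move=> u; exists (g (0, u)); rewrite mk_linearE phiK.
Qed.

(** Double duality, on the summand of the cotilting module that is not a dual. *)
Lemma dual_summand (N : lmodType Aop) :
  mod_iso (D_right N * U)%type (D_right (N * D_left U)%type).
Proof.
have /choice [F FP] (p : D_right N * U) : exists f : D_right (N * D_left U)%type,
    forall m, dval f m = dval p.1 m.1 + lval m.2 p.2.
  apply: dval_mk => [m m'|k m]; first by rewrite /= dvalD lvalDf addrACA.
  rewrite /= dvalk mulrDr; congr (_ + _).
  by rewrite lval_act; exact: lvalk.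
have Fl : linear F.
  move=> b p p'; apply: dvalP => m; rewrite dvalDf dval_act !FP /=.
  by rewrite dvalDf dval_act lvalD lval_act addrACA.
apply: (mod_iso_bij (f := mk_linear Fl)) => [p p' FE|f].
  have E m : dval p.1 m.1 + lval m.2 p.2 = dval p'.1 m.1 + lval m.2 p'.2.
    by rewrite -!FP -[F p]/(mk_linear Fl p) FE.
  case: p p' {FE} E => [q u] [q' u'] /= E; congr (_, _).
    by apply: dvalP => n; have := E (n, 0); rewrite /= ![lval 0 _]/(0) !addr0.
  apply/eqP; rewrite -subr_eq0; apply/eqP; apply: lval_separates => xi.
  have lvB : lval xi (u - u') = lval xi u - lval xi u'.
    exact: (linearB (lhom_fun (xi : lhom (restr_scal U) K^o))).
  by have := E (0, xi); rewrite /= !dval0 !add0r lvB => ->; rewrite subrr.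
have [n n'|k n|q qP] := @dval_mk K A N (fun n => dval f (n, 0)).
- by rewrite -dvalD; congr (dval f (_, _)); rewrite /= addr0.
- by rewrite -dvalk; congr (dval f (_, _)); exact/esym/scaler0.
have [|u uP] := reflexive (F := fun xi : lhom (restr_scal U) K^o => dval f (0, (xi : D_left U)))
    fdim_complement.
  move=> k x y z hE.
  have -> : z = kscal Aop k *: (x : D_left U) + (y : D_left U) :> D_left U.
    apply: lvalP => u; rewrite lvalDf lval_act.
    by rewrite -[lval x (_ *: _)]/(lval (x : D_left U) (kscal A k *: u)) lvalk; exact: hE.
  rewrite -dvalk -dvalD; congr (dval f (_, _)).
  by rewrite [RHS]addr0; exact/esym/scaler0.
exists (q, u); apply: dvalP => -[n xi]; rewrite mk_linearE FP /= qP.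
have := uP xi; rewrite -[RHS]/(lval xi u) => <-; rewrite -dvalD.
by congr (dval f (_, _)); rewrite /= ?addr0 ?add0r.
Qed.

End DualComplement.

End Duality.

(** * Cotilting at a sink *)

Lemma fdim_pair (K : fieldType) (R : kalg K) (M N : lmodType R) :
  fdim (restr_scal M) -> fdim (restr_scal N) -> fdim (restr_scal (M * N)%type).
Proof.
move=> fM fN.
have fl : linear (fun p : restr_scal M * restr_scal N => p : restr_scal (M * N)%type) by [].
by apply: (@fdim_surj _ _ _ (mk_linear fl)) (fdim_prod fM fN) => p; exists p.
Qed.

Lemma fdim_generated (K : fieldType) (A : kalg K) (N : lmodType (op_alg A)) (T : finType)
    (t : T -> N) : finite_dimensional A ->
  (forall v, exists g : T -> op_alg A, v = \sum_j g j *: t j) -> fdim (restr_scal N).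
Proof.
move=> fdA genP.
have fl : linear (fun u : restr_scal {ffun T -> (op_alg A)^o} =>
    \sum_j ((u : {ffun T -> (op_alg A)^o}) j : op_alg A) *: t j : restr_scal N).
  move=> k u v; rewrite [X in _ = X + _](scaler_sumr (kscal (op_alg A) k)) -big_split.
  by apply: eq_bigr => j _; rewrite [(_ + _ : {ffun _ -> _}) _]ffunE [(_ *: _ : {ffun _ -> _}) _]ffunE scalerDl scalerA.
apply: (@fdim_surj _ _ _ (mk_linear fl)) (fdim_free T fdA) => v.
have [g ->] := genP v; exists [ffun j => g j]; rewrite mk_linearE.
by apply: eq_bigr => j _; rewrite ffunE.
Qed.

Section SinkCotilting.
Variables (K : fieldType) (Q : quiver) (W : cpath K Q) (C : {set arrow Q}) (x : vertex Q).
Hypothesis oW : ord 2 W.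
Hypothesis homW : forall y s, pcoef W y s != 0 -> count (mem C) s = 1%N.
Hypothesis minW : min_rel W C.
Hypothesis srcx : forall a : arrow Q, tgt a = x -> a \in C.
Variables (A : kalg K) (pi : {rmorphism cpath K Q -> op_alg A}).
Hypothesis piS : forall b, exists f, pi f = b.
Hypothesis pik : forall k, pi (cscal k) = kscal (op_alg A) k.
Hypothesis piker : forall f, pi f = 0 <-> cl (relset W C) f.
Hypothesis fdA : finite_dimensional A.
Variables (B : kalg K) (piB : {rmorphism cpath K Q -> op_alg B}).
Hypothesis piBS : forall b, exists f, piB f = b.
Hypothesis piBk : forall k, piB (cscal k) = kscal (op_alg B) k.
Hypothesis piBker : forall f, piB f = 0 <-> cl (relset W (mu_plus x C)) f.

Local Notation e_ := (cor_e x pi).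
Local Notation a_ := (cor_a x pi).
Local Notation y_ := (cor_y x pi).

(** Since [Y = D N] for the transpose [N] of the syzygy, the module [Y * U] is dual to [N * D
    U], a module over the opposite algebra to which [core_endo_alg] applies; duality reverses
    the endomorphism algebra once more. *)
Theorem sink_cotilting (S U T X Y : lmodType A) : gldim_le A 2 ->
  (exists s : S, s <> 0 /\ forall v : S, exists k, v = kscal A k *: s) ->
  (forall v : S, (e_ : A) *: v = v) ->
  ~ projective S -> ext1_vanishes S A^o -> mod_iso (dual_regular A) (S * U)%type ->
  is_syzygy S X -> is_tau X Y -> mod_iso T (Y * U)%type -> alg_iso (endo_alg T) B.
Proof.
move=> gl S_line S_e nproj ext isoD syzX [N [trN isoY]] isoT.
have fdR := fdim_op_regular fdA.
have [chi [be eb]] := character_at srcx piS pik piker.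
have be' (b : A) : (e_ : A) * b = kscal A (chi b) * (e_ : A).
  by rewrite kscalC; exact: be.
have eb' (b : A) : exists u : arrow Q -> A, (forall i, u i * y_ i = u i) /\
    b * (e_ : A) = kscal A (chi b) * (e_ : A) + \sum_i u i * (a_ i : A).
  by have [u [uy uE]] := eb b; exists u; split=> //; rewrite kscalC; exact: uE.
have S_act (b : A) (v : S) : b *: v = kscal A (chi b) *: v.
  by rewrite -[b *: v]S_e scalerA be' -scalerA S_e.
have e_neq0 : e_ <> 0 by apply/eqP; exact: (cor_e_neq0 oW homW minW srcx piS pik piker fdR).
have ee := cor_ee x pi; have ea := cor_ea x pi; have ay := cor_ay x pi.
have yy := cor_yy x pi; have zz := cor_zz x pi.
have ye := cor_ye oW homW minW srcx pi.
have yr := cor_yr oW homW minW srcx pi; have rz := cor_rz oW homW minW srcx pi.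
have ar := cor_ar x oW homW piker.
have syz := cor_syz oW homW minW srcx piS pik piker fdR.
have H2 : syzygy_projection W x pi.
  have [rho [rho1 rho2]] := @syzygy_projection_pdim K A _ (e_ : A) a_ y_ (cor_z x pi)
    (cor_r W x pi) chi be' eb' e_neq0 ee ea ay yy yr rz ye ar syz S S_line S_act (gl S).
  exists rho; split; [exact: rho1 | exact: rho2].
have rinj := cor_rinj oW homW minW srcx piS pik piker fdR H2.
have H3 := @extension_cotilting K A _ (e_ : A) a_ y_ (cor_z x pi) (cor_r W x pi) chi be' eb'
    e_neq0 ea ay yy ye syz S S_line S_act ext.
have a0 := @sink_arrows_neq0 K A _ (e_ : A) a_ y_ chi be' eb' e_neq0 ee S S_line S_act nproj.
have [iota [iota_inj iota_im]] := @syzygy_ideal K A _ (e_ : A) a_ y_ chi be' eb' e_neq0 ee ea ay ye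
  S S_line S_act X syzX.
have [t tP] := @transpose_presents K A (op_alg A) (op_id A) (fun b => b) (fun _ => erefl)
  (fun _ => erefl) _ (a_ : _ -> A) y_ (cor_z x pi) (cor_r W x pi) ay yy zz yr rz ar syz
  rinj _ iota iota_inj iota_im N trN.
have dline := line_dual S_line.
have dact (b : op_alg A) (f : D_left S) : b *: f = kscal (op_alg A) (chi b) *: f.
  by apply: lvalP => v; rewrite !lval_act S_act.
have [u0 [eu0 Ugen Ufree]] := complement_generator be ee (chi_co be e_neq0 ee) dline dact
  (dual_complement fdA isoD).
have isoTD : mod_iso T (D_right (N * D_left U)%type).
  apply: mod_iso_trans isoT _; apply: mod_iso_trans (dual_summand fdA isoD N).
  exact: mod_iso_prod.
apply: alg_iso_trans (endo_alg_iso isoTD) _.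
apply: (alg_iso_trans (alg_iso_sym (endo_dual _))).
  have [_ genP _] := tP; apply: fdim_pair (fdim_generated fdA genP) _.
  exact: fdim_D_left (fdim_complement fdA isoD).
apply: alg_iso_op.
exact: (core_endo_alg oW homW minW srcx piS pik piker fdR H2 H3 tP eu0 Ugen Ufree
  piBS piBk piBker a0).
Qed.

End SinkCotilting.

(** * Both mutations of an algebraic cut *)

Section OppositeProjection.
Variables (K : fieldType) (Q : quiver) (W : cpath K Q) (C : {set arrow Q}).
Local Notation A := (truncated_jacobian W C).

(** At a sink, the same arguments apply to the opposite quiver, whose path algebra maps onto
    the opposite algebra by reversal of paths. *)
Definition trpi_op (g : cpath K (opq Q)) : op_alg A := trpi W C (vr g).

Fact trpi_op_zmod_morphism : zmod_morphism trpi_op.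
Proof. by move=> g h; rewrite /trpi_op vrB rmorphB. Qed.
Fact trpi_op_monoid_morphism : monoid_morphism trpi_op.
Proof.
split=> [|g h]; last by rewrite /trpi_op vrM rmorphM.
by rewrite /trpi_op -[1]rv1 rvK rmorph1.
Qed.
HB.instance Definition _ :=
  GRing.isZmodMorphism.Build _ _ trpi_op trpi_op_zmod_morphism.
HB.instance Definition _ :=
  GRing.isMonoidMorphism.Build _ _ trpi_op trpi_op_monoid_morphism.

Lemma trpi_op_surj b : exists g, trpi_op g = b.
Proof. by have [f <-] := trpi_surj b; exists (rv f); rewrite /trpi_op rvK. Qed.

Lemma trpi_op_scal k : trpi_op (cscal k) = kscal (op_alg A) k.
Proof. by rewrite /trpi_op -rv_cscal rvK trpi_scal. Qed.

Lemma trpi_op_ker g : trpi_op g = 0 <-> cl (@relset K (opq Q) (rv W) C) g.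
Proof. by rewrite -cl_relset_op -trpi_ker. Qed.

End OppositeProjection.

(** The algebras depend on the class of the potential only, so it may be replaced by a
    homogeneous representative. *)
Lemma relset_potential_eq (K : fieldType) (Q : quiver) (W W' : cpath K Q) (C : {set arrow Q}) :
  potential_eq W W' -> relset W C = relset W' C.
Proof.
move=> /deriv_potential_eq WW'; apply/seteqP; split=> g [gC|[a gE]]; try by left.
  by right; exists a; rewrite -WW'.
by right; exists a; rewrite WW'.
Qed.

Lemma simple_idempotent (K : fieldType) (Q : quiver) (W : cpath K Q) (C : {set arrow Q})
    (x : vertex Q) (S : lmodType (truncated_jacobian W C)) :
  is_simple_at x S -> forall v : S, trpi W C (vtx x) *: v = v.
Proof.
by move=> [_ S_act] v; rewrite trpiE S_act /vtx eqxx rmorph1 scale1r.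
Qed.

Theorem theorem7p7 (K : closedFieldType) (Q : quiver) (W : cpath K Q)
    (C : {set arrow Q}) (hW : is_potential W) (hC : is_algebraic_cut W C) :
  (forall (x : vertex Q) (T : lmodType (truncated_jacobian W C)),
     is_source (Q := cut_quiver C) x -> is_2APR_tilting x T ->
     alg_iso (endo_alg T) (truncated_jacobian W (mu_plus x C))) /\
  (forall (x : vertex Q) (T : lmodType (truncated_jacobian W C)),
     is_sink (Q := cut_quiver C) x -> is_2APR_cotilting x T ->
     alg_iso (endo_alg T) (truncated_jacobian W (mu_minus x C))).
Proof.
have [[W' [potW' WW' degW']] fdA gl minC] := hC.
have relW D := relset_potential_eq D WW'.
have oW : ord 2 W' by exact/ideal_expE.
have homW y s : pcoef W' y s != 0 -> count (mem C) s = 1%N.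
  have [w|w] := boolP (is_walk y s); last by rewrite pcoef_out // eqxx.
  by rewrite pcoefE => /degW' <-; rewrite /gdeg /= -sum1_count big_mkcond.
have minW : min_rel W' C.
  move=> c cC; have := minimal_min_rel minC cC; rewrite (deriv_potential_eq WW').
  apply: contra_not; congr (cl _ _); apply/seteqP.
  split=> g [gC|[b bC [bc gE]]]; try (by left); right; exists b => //; split=> //.
    by rewrite (deriv_potential_eq WW').
  by rewrite -(deriv_potential_eq WW').
split=> x T ext [S [U [simS nS extS isoA [X [Y [cosyz tauY isoT]]]]]].
  have srcx a : tgt a = x -> a \in C.
    move=> ax; apply: contraT => aC.
    by have := ext (Sub a aC); rewrite /= ax eqxx.
  have ker D f : trpi W D f = 0 <-> cl (relset W' D) f by rewrite trpi_ker relW.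
  exact: (@source_tilting K Q W' C x oW homW minW srcx _ (trpi W C) (@trpi_surj K Q W C)
    (@trpi_scal K Q W C) (ker C) fdA _ (trpi W (mu_plus x C)) (@trpi_surj _ _ _ _)
    (@trpi_scal _ _ _ _) (ker _) S U T X Y gl (proj1 simS) (simple_idempotent simS) nS extS isoA
    cosyz tauY isoT).
have srcx (a : arrow (opq Q)) : tgt a = x -> a \in C.
  move=> ax; apply: contraT => aC.
  by case/negP: (ext (Sub a aC)); apply/eqP; exact: ax.
have ker D f : trpi_op W D f = 0 <-> cl (@relset K (opq Q) (rv W') D) f.
  by rewrite -cl_relset_op -relW cl_relset_op trpi_op_ker.
have homW_op y s : pcoef (rv W') y s != 0 -> count (mem C) s = 1%N.
  have [w|w] := boolP (@is_walk (opq Q) y s); last by rewrite pcoef_out // eqxx.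
  by rewrite pcoef_rv // => /homW; rewrite count_rev.
have S_e (v : S) : (trpi_op W C (@vtx K (opq Q) x) : truncated_jacobian W C) *: v = v.
  by rewrite /trpi_op -rv_vtx rvK; exact: (simple_idempotent simS).
exact: (@sink_cotilting K (opq Q) (rv W') C x (rv_ord oW) homW_op (min_rel_op minW) srcx _
  (trpi_op W C) (@trpi_op_surj K Q W C) (@trpi_op_scal K Q W C) (ker C) fdA _
  (trpi_op W (mu_minus x C)) (@trpi_op_surj _ _ _ _) (@trpi_op_scal _ _ _ _) (ker _)
  S U T X Y gl (proj1 simS) S_e nS extS isoA cosyz tauY isoT).
Qed.
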